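(* For every $z_0\in G_0$ the full-memory control strategies $\mathbb U_\varepsilon$ ($\varepsilon\in(0,1)$) constructed in the context satisfy $$\limsup_{\varepsilon\to0}\Gamma_{c}(z_0,\mathbb U_\varepsilon)\le\Gamma_{q}(z_0),$$ and moreover $$\Gamma_{p}(z_0)=\Gamma_{c}(z_0)=\Gamma_{q}(z_0).$$
   Context: **System.** $T=[t_0,\vartheta]\subset\mathbb R$; $\mathcal P\subset\mathbb R^p$, $\mathcal Q\subset\mathbb R^q$, $G_0\subset\mathbb R^n$ are (nonempty) compact sets. $f:T\times\mathbb R^n\times\mathcal P\times\mathcal Q\to\mathbb R^n$ is continuous, locally Lipschitz in the second argument, and for some $K\ge0$, $\sup_{(\tau,u,v)\in T\times\mathcal P\times\mathcal Q}\|f(\tau,x,u,v)\|\le K(1+\|x\|)$ for all $x\in\mathbb R^n$. The system is $\dot x(\tau)=f(\tau,x(\tau),u(\tau),v(\tau))$, $\tau\in T$, $x(t_0)=z_0\in G_0$. $\mathcal U$ (controls) is the set of Lebesgue measurable $u:T\to\mathcal P$; $\mathcal V$ (disturbances) is the set of Lebesgue measurable $v:T\to\mathcal Q$. $x(\cdot,t_0,z_0,u(\cdot),v(\cdot))$ is the unique Carathéodory solution on $T$. The cost functional $\gamma:C(T;\mathbb R^n)\to\mathbb R$ is continuous (sup norm). **Full-memory strategies.** A partition is $\Delta=(\tau_i)_{i=0}^{n_\Delta}$ with $t_0=\tau_0<\tau_1<\dots<\tau_{n_\Delta}=\vartheta$; $\Delta_T$ is the set of all partitions; $\mathrm D(\Delta)=\max_{1\le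 i\le n_\Delta}(\tau_i-\tau_{i-1})$, $\mathrm d(\Delta)=\min_{1\le i\le n_\Delta-1}(\tau_i-\tau_{i-1})$. A full-memory feedback for $\Delta$ is a family $\mathbf U^\Delta=(\mathbf U^\Delta_i)_{i=0}^{n_\Delta-1}$ of maps $\mathbf U^\Delta_i:C([t_0,\tau_i],\mathbb R^n)\to\mathcal U|_{[\tau_i,\tau_{i+1})}$ (restrictions of controls). A full-memory control strategy is a family $\mathbb U=(\mathbf U^\Delta)_{\Delta\in\Delta_T}$ of such feedbacks; $\mathbf S$ is the set of all of them. For $z_0\in G_0$, $\Delta$, $\mathbf U^\Delta$, $v(\cdot)\in\mathcal V$, the motion $x(\cdot,z_0,\mathbf U^\Delta,v(\cdot))$ is the function $x(\cdot)=x(\cdot,t_0,z_0,u(\cdot),v(\cdot))$, where $u(\cdot)\in\mathcal U$ satisfies $u(t)=\mathbf U^\Delta_i(x(\cdot)|_{[t_0,\tau_i]})(t)$ for $t\in[\tau_i,\tau_{i+1})$, $0\le i\le n_\Delta-1$. For nonempty $\mathbf V\subseteq\mathcal V$, $X(z_0,\mathbb U,\mathbf V)$ is the set of all $x(\cdot)\in C(T;\mathbb R^n)$ for which there are sequences $z_{0k}\in G_0$, $v_k(\cdot)\in\mathbf V$, $\Delta_k\in\Delta_T$ with $z_{0k}\to z_0$, $\mathrm D(\Delta_k)\to0$ and $x(\cdot,z_{0k},\mathbf U^{\Delta_k},v_k(\cdot))\to x(\cdot)$ in $C(T;\mathbb R^n)$, where $\mathbf U^{\Delta_k}$ is the member of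 $\mathbb U$ for $\Delta_k$. Put $\mathcal X_{c}(z_0,\mathbb U)=\bigcup_{\mathbf V}X(z_0,\mathbb U,\mathbf V)$ (union over all nonempty $\mathbf V\subseteq\mathcal V$ compact in $L_2(T;\mathbb R^q)$), $\mathcal X_{p}(z_0,\mathbb U)=\bigcup_{v(\cdot)\in\mathcal V}X(z_0,\mathbb U,\{v(\cdot)\})$; $\Gamma_{c}(z_0,\mathbb U)=\sup_{x(\cdot)\in\mathcal X_{c}(z_0,\mathbb U)}\gamma(x(\cdot))$, $\Gamma_{p}(z_0,\mathbb U)=\sup_{x(\cdot)\in\mathcal X_{p}(z_0,\mathbb U)}\gamma(x(\cdot))$, $\Gamma_{c}(z_0)=\inf_{\mathbb U\in\mathbf S}\Gamma_{c}(z_0,\mathbb U)$, $\Gamma_{p}(z_0)=\inf_{\mathbb U\in\mathbf S}\Gamma_{p}(z_0,\mathbb U)$. **Quasi-strategies.** $\mathbf Q$ is the set of maps $\alpha:\mathcal V\to\mathcal U$ such that for all $\tau\in T$ and $v,v'\in\mathcal V$ with $v|_{[t_0,\tau]}=v'|_{[t_0,\tau]}$ one has $\alpha(v)|_{[t_0,\tau]}=\alpha(v')|_{[t_0,\tau]}$. $\mathcal X(z_0,\alpha)=\{x(\cdot,t_0,z_0,\alpha(v),v):v\in\mathcal V\}$, $\Gamma_{q}(z_0,\alpha)=\sup_{x(\cdot)\in\mathcal X(z_0,\alpha)}\gamma(x(\cdot))$, $\Gamma_{q}(z_0)=\inf_{\alpha\in\mathbf Q}\Gamma_{q}(z_0,\alpha)$.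 **Target sets.** For $z\in G_0$, $\delta>0$: $\mathbf Q(z,\delta)=\{\alpha\in\mathbf Q:\Gamma_{q}(z,\alpha)\le\Gamma_{q}(z)+\delta\}$ and $\mathcal W(z)=\bigcap_{\delta>0}\mathrm{cl}\bigcup_{\alpha\in\mathbf Q(z,\delta)}\mathcal X(z,\alpha)$ (closure in $C(T;\mathbb R^n)$; $\mathcal W(z)$ is nonempty and compact). $\mathcal W(z)|_{[t_0,\tau]}$ is the set of restrictions of its elements to $[t_0,\tau]$. For $\tau\in T$ and $y(\cdot)\in C([t_0,\tau],\mathbb R^n)$ with $y(t_0)\in G_0$, fix some $w(\cdot\mid\tau,y(\cdot))\in\operatorname{argmin}_{w(\cdot)\in\mathcal W(y(t_0))|_{[t_0,\tau]}}\|w(\cdot)-y(\cdot)\|_C$ (sup norm on $[t_0,\tau]$). **The strategy $\mathbb U_\varepsilon=(\mathbf U^\Delta_\varepsilon)_{\Delta\in\Delta_T}$, $\varepsilon\in(0,1)$.** Fix a finite $\varepsilon$-net $u^\varepsilon_1,\dots,u^\varepsilon_{n_\varepsilon}$ in $\mathcal P$ (each $u\in\mathcal P$ is within distance $\varepsilon$ of some $u^\varepsilon_j\in\mathcal P$), and $u_*\in\mathcal P$, $v_*\in\mathcal Q$. Every partition $\Delta$ can be thinned, by removing points, to a partition $\Delta'\subseteq\Delta$ with $\mathrm D(\Delta')/\mathrm d(\Delta')\le3$ and $\mathrm D(\Delta')\le3\mathrm D(\Delta)$; if $\Delta$ itself does not satisfy $\mathrm D(\Delta)/\mathrm d(\Delta)\le3$,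 the feedback for $\Delta$ is the one constructed for such a thinned $\Delta'$. So let $\mathrm D(\Delta)/\mathrm d(\Delta)\le3$. For $1\le i\le n_\Delta-1$ put $\tau_i'=\tau_i-\varepsilon\,\mathrm d(\Delta)$, $\tau'_{ij}=\tau_i'+j(\tau_i-\tau_i')/n_\varepsilon$ ($0\le j\le n_\varepsilon$), and $d_{ij}(x(\cdot))=\dfrac{x(\tau'_{ij})-x(\tau'_{i(j-1)})}{\tau'_{ij}-\tau'_{i(j-1)}}$ ($1\le j\le n_\varepsilon$). Define inductively, for histories $x_i(\cdot)\in C([t_0,\tau_i],\mathbb R^n)$ with $x_i(t_0)\in G_0$ (values on other histories are irrelevant): - $i=0$: $\bar v_0=v_*$, $u_0=u_*$, $y_0(\tau_0)=x_0(\tau_0)$. - $1\le i\le n_\Delta-1$: with $\bar v_{i-1}$, $u_{i-1}$, $y_{i-1}(\cdot)$ computed from $x_i(\cdot)|_{[t_0,\tau_{i-1}]}$, let $y_i(\cdot)$ extend $y_{i-1}(\cdot)$ to $[t_0,\tau_i]$ by $y_i(\tau)=y_{i-1}(\tau_{i-1})+\int_{\tau_{i-1}}^{\tau}f(t,y_i(t),u_{i-1},\bar v_{i-1})\,dt$, $\tau\in[\tau_{i-1},\tau_i]$, and choose $\bar v_i\in\operatorname{argmin}_{v\in\mathcal Q}\max_{1\le j\le n_\varepsilon}\|d_{ij}(x_i(\cdot))-f(\tau_i,x_i(\tau_i),u^\varepsilon_j,v)\|$, $u_i\in\operatorname{argmin}_{u\in\mathcal P}\langle y_i(\tau_i)-w(\tau_i\mid\tau_i,y_i(\cdot)),\,f(\tau_i,y_i(\tau_i),u,\bar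 v_i)\rangle$. - For $0\le i\le n_\Delta-2$: $\mathbf U^\Delta_{\varepsilon i}(x_i(\cdot))(t)=u_i$ for $t\in[\tau_i,\tau'_{i+1})$ and $=u^\varepsilon_j$ for $t\in[\tau'_{(i+1)(j-1)},\tau'_{(i+1)j})$, $1\le j\le n_\varepsilon$. For $i=n_\Delta-1$: $\mathbf U^\Delta_{\varepsilon i}(x_i(\cdot))(t)=u_i$ on all of $[\tau_i,\tau_{i+1})$. All choices (nets, $u_*$, $v_*$, thinnings, minimizers) are arbitrary but fixed. *)

(* Defs.v *)
From HB Require Import structures.
From mathcomp Require Import all_boot all_order all_algebra.
From mathcomp Require Import all_classical all_reals all_analysis.

Set Implicit Arguments.
Unset Strict Implicit.
Unset Printing Implicit Defensive.

Import Order.TTheory GRing.Theory Num.Theory.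
Import numFieldNormedType.Exports.

Local Open Scope classical_set_scope.
Local Open Scope ring_scope.

(* [`|x|] on row vectors is the maximum norm; the minimizers below depend on
   the norm and are taken with respect to the Euclidean one. *)
Definition inner (R : realType) (m : nat) (x y : 'rV[R]_m) : R :=
  \sum_(i < m) x ord0 i * y ord0 i.

Definition enorm (R : realType) (m : nat) (x : 'rV[R]_m) : R :=
  Num.sqrt (inner x x).

Definition argmin (d : Order.disp_t) (K : porderType d) (A : Type)
    (S : set A) (phi : A -> K) : set A :=
  [set a | S a /\ forall b, S b -> (phi a <= phi b)%O].

(* R with the Lebesgue (that is, completed Borel) sigma-algebra. *)
Definition lebR (R : realType) :=
  caratheodory_type (R := R) (T := ocitv_type R) (wlength idfun)^*%mu.

Definition leb (R : realType) : {measure set (lebR R) -> \bar R} :=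
  @completed_lebesgue_measure R.

Definition leb_measurable (R : realType) (m : nat) (T : set (lebR R))
    (u : R -> 'rV[R]_m) : Prop :=
  forall k, measurable_fun T (fun t : lebR R => u t ord0 k).

(* Functions on an interval [a, b] are represented by functions on R, whose
   values outside of [a, b] play no role: [Cts a b] stands for
   C([a, b]; R^m). The restriction x|_[a, b] is represented by
   [x \_ `[a, b]], which replaces the values outside of [a, b] by a fixed
   default one. *)
Definition Cts (R : realType) (m : nat) (a b : R) : set (R -> 'rV[R]_m) :=
  [set x | {within `[a, b], continuous x}].

Definition Cdist (R : realType) (m : nat) (a b : R) (x y : R -> 'rV[R]_m) :
    \bar R :=
  ereal_sup [set (enorm (x t - y t))%:E | t in `[a, b]].

(* The topology generated by the open balls of L_2([a, b]; R^m); it induces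
   the norm topology (up to equality almost everywhere) on the set of the
   square integrable functions, so that [compact V] is compactness in L_2 for
   any set [V] of such functions. *)
Definition L2norm (R : realType) (m : nat) (a b : R) (v : R -> 'rV[R]_m) :
    \bar R :=
  ((\int[@leb R]_(t in (`[a, b] : set (lebR R))) ((enorm (v t)) ^+ 2)%:E)
     `^ 2^-1)%E.

Definition L2set (R : realType) (m : nat) (a b : R) : set (R -> 'rV[R]_m) :=
  [set v | leb_measurable `[a, b] v /\ (L2norm a b v < +oo)%E].

Definition L2space (R : realType) (m : nat) (a b : R) : Type :=
  R -> 'rV[R]_m.

HB.instance Definition _ (R : realType) (m : nat) (a b : R) :=
  Pointed.copy (L2space m a b) (R -> 'rV[R]_m).

Definition L2ball (R : realType) (m : nat) (a b : R)
    (c : L2space m a b * R) : set (L2space m a b) :=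
  [set w | L2set a b w /\ (L2norm a b (fun t => (w t - c.1 t)%R) < c.2%:E)%E].

HB.instance Definition _ (R : realType) (m : nat) (a b : R) :=
  @isSubBaseTopological.Build (L2space m a b)
    (L2space m a b * R)%type
    [set c | L2set a b c.1 /\ 0 < c.2]
    (@L2ball R m a b).

Record game (R : realType) (n p q : nat) := Game {
  t0 : R;
  theta : R;
  Pset : set 'rV[R]_p;
  Qset : set 'rV[R]_q;
  G0 : set 'rV[R]_n;
  dyn : R -> 'rV[R]_n -> 'rV[R]_p -> 'rV[R]_q -> 'rV[R]_n;
  cost : (R -> 'rV[R]_n) -> R }.

Section Game.
Variables (R : realType) (n p q : nat) (g : game R n p q).

Local Notation t0 := (t0 g).
Local Notation theta := (theta g).
Local Notation P := (Pset g).
Local Notation Q := (Qset g).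
Local Notation G0 := (G0 g).
Local Notation f := (dyn g).
Local Notation gamma := (cost g).
Local Notation T := (`[t0, theta]%classic : set R).

(* - Continuity of the cost for the uniform topology on T forces it to depend
     on the restriction of its argument to T only.
   - The Lipschitz constant is uniform in (t, u, v) near each x0; the constant
     depends on the norms used, its existence does not. *)
Record standing_assumptions : Prop := StandingAssumptions {
  t0_lt_theta : t0 < theta;
  P_compact : compact P;
  P_nonempty : P !=set0;
  Q_compact : compact Q;
  Q_nonempty : Q !=set0;
  G0_compact : compact G0;
  G0_nonempty : G0 !=set0;
  dyn_continuous :
    {within T `*` [set: 'rV[R]_n] `*` P `*` Q, continuous
      (fun a : R * 'rV[R]_n * 'rV[R]_p * 'rV[R]_q =>
         f a.1.1.1 a.1.1.2 a.1.2 a.2)};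
  dyn_locally_lipschitz :
    forall x0 : 'rV[R]_n, exists L : R, exists2 N : set 'rV[R]_n, nbhs x0 N &
      forall t u v, T t -> P u -> Q v ->
        L.-lipschitz_N (fun x => f t x u v);
  dyn_sublinear :
    exists2 K : R, 0 <= K &
      forall x t u v, T t -> P u -> Q v ->
        enorm (f t x u v) <= K * (1 + enorm x);
  cost_continuous :
    {within (Cts t0 theta : set {uniform` T -> 'rV[R]_n}), continuous
      (gamma : {uniform` T -> 'rV[R]_n} -> R)} }.

Definition controls : set (R -> 'rV[R]_p) :=
  [set u | leb_measurable T u /\ forall t, T t -> P (u t)].

Definition disturbances : set (R -> 'rV[R]_q) :=
  [set v | leb_measurable T v /\ forall t, T t -> Q (v t)].

(* [x] is a Caratheodory solution on [a, b] with x(a) = z. *)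
Definition solution (a b : R) (z : 'rV[R]_n) (u : R -> 'rV[R]_p)
    (v : R -> 'rV[R]_q) (x : R -> 'rV[R]_n) : Prop :=
  Cts a b x /\
  forall t, t \in `[a, b] -> forall k,
    (@leb R).-integrable (`[a, t] : set (lebR R))
      (fun s : lebR R => (f s (x s) (u s) (v s) ord0 k)%:E) /\
    x t ord0 k = z ord0 k +
      \int[@leb R]_(s in (`[a, t] : set (lebR R)))
        f s (x s) (u s) (v s) ord0 k.

(* A partition t0 = tau_0 < ... < tau_n = theta is represented by the sequence
   tau_1, ..., tau_n. *)
Definition partition (Delta : seq R) : Prop := itv_partition t0 theta Delta.

Definition tau (Delta : seq R) (i : nat) : R := nth theta (t0 :: Delta) i.

Definition Dmax (Delta : seq R) : R :=
  \big[Num.max/0]_(1 <= i < (size Delta).+1) (tau Delta i - tau Delta i.-1).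

(* The last subinterval is not taken into account. The default value
   theta - t0, which bounds all the lengths, only matters when Delta has a
   single subinterval; then dmin Delta = Dmax Delta. *)
Definition dmin (Delta : seq R) : R :=
  \big[Num.min/theta - t0]_(1 <= i < size Delta) (tau Delta i - tau Delta i.-1).

(* A feedback gives the map U_i at index [i]; it is only ever applied to
   histories of the form [x \_ `[t0, tau_i]], and only the values of the
   resulting control on [tau_i, tau_(i+1)) are used. *)
Definition feedback : Type := nat -> (R -> 'rV[R]_n) -> (R -> 'rV[R]_p).

Definition is_feedback (Delta : seq R) (F : feedback) : Prop :=
  forall i, (i < size Delta)%N -> forall x, Cts t0 (tau Delta i) x ->
    exists2 u, controls u &
      forall t, t \in `[tau Delta i, tau Delta i.+1[ ->
        F i (x \_ `[t0, tau Delta i]) t = u t.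

Definition strategy : Type := seq R -> feedback.

Definition strategies : set strategy :=
  [set U | forall Delta, partition Delta -> is_feedback Delta (U Delta)].

Definition motion (z0 : 'rV[R]_n) (Delta : seq R) (F : feedback)
    (v : R -> 'rV[R]_q) (x : R -> 'rV[R]_n) : Prop :=
  exists2 u, controls u &
    (forall i, (i < size Delta)%N ->
       forall t, t \in `[tau Delta i, tau Delta i.+1[ ->
         u t = F i (x \_ `[t0, tau Delta i]) t) /\
    solution t0 theta z0 u v x.

Definition limit_motions (z0 : 'rV[R]_n) (U : strategy)
    (V : set (R -> 'rV[R]_q)) : set (R -> 'rV[R]_n) :=
  [set x | Cts t0 theta x /\
    exists (z : nat -> 'rV[R]_n) (v : nat -> R -> 'rV[R]_q)
           (Delta : nat -> seq R) (y : nat -> R -> 'rV[R]_n),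
      [/\ forall k, [/\ G0 (z k), V (v k), partition (Delta k) &
                        motion (z k) (Delta k) (U (Delta k)) (v k) (y k)],
          z @ \oo --> z0,
          (fun k => Dmax (Delta k)) @ \oo --> (0 : R) &
          {uniform T, y @ \oo --> x}]].

Definition X_c (z0 : 'rV[R]_n) (U : strategy) : set (R -> 'rV[R]_n) :=
  \bigcup_(V in [set V : set (L2space q t0 theta) |
                  [/\ V !=set0, V `<=` disturbances & compact V]])
    limit_motions z0 U V.

Definition X_p (z0 : 'rV[R]_n) (U : strategy) : set (R -> 'rV[R]_n) :=
  \bigcup_(v in disturbances) limit_motions z0 U [set v].

Definition Gamma_c_of (z0 : 'rV[R]_n) (U : strategy) : \bar R :=
  ereal_sup [set (gamma x)%:E | x in X_c z0 U].

Definition Gamma_p_of (z0 : 'rV[R]_n) (U : strategy) : \bar R :=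
  ereal_sup [set (gamma x)%:E | x in X_p z0 U].

Definition Gamma_c (z0 : 'rV[R]_n) : \bar R :=
  ereal_inf [set Gamma_c_of z0 U | U in strategies].

Definition Gamma_p (z0 : 'rV[R]_n) : \bar R :=
  ereal_inf [set Gamma_p_of z0 U | U in strategies].

Definition quasi_strategies : set ((R -> 'rV[R]_q) -> (R -> 'rV[R]_p)) :=
  [set alpha |
    (forall v, disturbances v -> controls (alpha v)) /\
    forall s v v', T s -> disturbances v -> disturbances v' ->
      {in `[t0, s], v =1 v'} -> {in `[t0, s], alpha v =1 alpha v'}].

Definition X_q (z0 : 'rV[R]_n) (alpha : (R -> 'rV[R]_q) -> (R -> 'rV[R]_p)) :
    set (R -> 'rV[R]_n) :=
  [set x | exists2 v, disturbances v & solution t0 theta z0 (alpha v) v x].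

Definition Gamma_q_of (z0 : 'rV[R]_n)
    (alpha : (R -> 'rV[R]_q) -> (R -> 'rV[R]_p)) : \bar R :=
  ereal_sup [set (gamma x)%:E | x in X_q z0 alpha].

Definition Gamma_q (z0 : 'rV[R]_n) : \bar R :=
  ereal_inf [set Gamma_q_of z0 alpha | alpha in quasi_strategies].

Definition near_optimal (z : 'rV[R]_n) (delta : R) :
    set ((R -> 'rV[R]_q) -> (R -> 'rV[R]_p)) :=
  [set alpha | quasi_strategies alpha /\
               (Gamma_q_of z alpha <= Gamma_q z + delta%:E)%E].

Definition target (z : 'rV[R]_n) : set (R -> 'rV[R]_n) :=
  [set x | Cts t0 theta x /\
    forall delta : R, 0 < delta ->
      closure (\bigcup_(alpha in near_optimal z delta) X_q z alpha :
                 set {uniform` T -> 'rV[R]_n}) x].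

(* [w s (y \_ `[t0, s])] is a best approximation of [y] on [t0, s] by
   restrictions of elements of the target set. *)
Definition target_selector
    (w : R -> (R -> 'rV[R]_n) -> (R -> 'rV[R]_n)) : Prop :=
  forall s y, T s -> Cts t0 s y -> G0 (y t0) ->
    argmin [set x \_ `[t0, s] | x in target (y t0)]
      (fun x => Cdist t0 s x y)
      (w s (y \_ `[t0, s])).

Definition is_net (eps : R) (net : seq 'rV[R]_p) : Prop :=
  (forall j, (j < size net)%N -> P (nth 0 net j)) /\
  forall u, P u -> exists2 j, (j < size net)%N & enorm (u - nth 0 net j) <= eps.

Definition balanced (Delta : seq R) : Prop := Dmax Delta / dmin Delta <= 3.

Definition thinning (Delta Delta' : seq R) : Prop :=
  [/\ partition Delta', subseq Delta' Delta, balanced Delta' &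
      Dmax Delta' <= 3 * Dmax Delta].

Section Construction.
Variables (w : R -> (R -> 'rV[R]_n) -> (R -> 'rV[R]_n)) (eps : R)
  (net : seq 'rV[R]_p) (ustar : 'rV[R]_p) (vstar : 'rV[R]_q).

(* The points tau'_(i j), 0 <= j <= size net, from tau_i - eps * dmin to
   tau_i. The j-th probing control is [nth 0 net j], 0 <= j < size net, and it
   is used between the points of indices j and j.+1. *)
Definition probe (Delta : seq R) (i j : nat) : R :=
  let start := tau Delta i - eps * dmin Delta in
  start + j%:R * (tau Delta i - start) / (size net)%:R.

Definition slope (Delta : seq R) (i j : nat) (x : R -> 'rV[R]_n) : 'rV[R]_n :=
  (probe Delta i j.+1 - probe Delta i j)^-1 *:
    (x (probe Delta i j.+1) - x (probe Delta i j)).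

Definition mismatch (Delta : seq R) (i : nat) (x : R -> 'rV[R]_n)
    (v : 'rV[R]_q) : R :=
  \big[Num.max/0]_(0 <= j < size net)
    enorm (slope Delta i j x - f (tau Delta i) (x (tau Delta i)) (nth 0 net j) v).

(* [vb i], [ub i] and [y i] compute the estimate of the disturbance, the
   control and the model motion from the history on [t0, tau_i]. *)
Definition model_based (Delta : seq R)
    (vb : nat -> (R -> 'rV[R]_n) -> 'rV[R]_q)
    (ub : nat -> (R -> 'rV[R]_n) -> 'rV[R]_p)
    (y : nat -> (R -> 'rV[R]_n) -> (R -> 'rV[R]_n)) : Prop :=
  forall i x, (i < size Delta)%N -> Cts t0 (tau Delta i) x -> G0 (x t0) ->
    let h := x \_ `[t0, tau Delta i] in
    if i is i'.+1 then
      let h' := x \_ `[t0, tau Delta i'] in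
      [/\ {in `[t0, tau Delta i'], y i h =1 y i' h'},
          solution (tau Delta i') (tau Delta i) (y i' h' (tau Delta i'))
            (cst (ub i' h')) (cst (vb i' h')) (y i h),
          argmin Q (mismatch Delta i x) (vb i h) &
          argmin P
            (fun u =>
               inner (y i h (tau Delta i)
                      - w (tau Delta i) (y i h \_ `[t0, tau Delta i])
                          (tau Delta i))
                     (f (tau Delta i) (y i h (tau Delta i)) u (vb i h)))
            (ub i h)]
    else [/\ vb i h = vstar, ub i h = ustar & y i h t0 = x t0].

Definition constructed_feedback (Delta : seq R) (F : feedback) : Prop :=
  exists vb ub y, model_based Delta vb ub y /\
    forall i x, (i < size Delta)%N -> Cts t0 (tau Delta i) x -> G0 (x t0) ->
      let h := x \_ `[t0, tau Delta i] in
      if (i.+1 < size Delta)%N then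
        (forall t, t \in `[tau Delta i, probe Delta i.+1 0[ ->
           F i h t = ub i h) /\
        (forall j, (j < size net)%N ->
           forall t, t \in `[probe Delta i.+1 j, probe Delta i.+1 j.+1[ ->
             F i h t = nth 0 net j)
      else
        forall t, t \in `[tau Delta i, tau Delta i.+1[ -> F i h t = ub i h.

End Construction.

(* [F] runs on Delta the feedback [F'] designed for the coarser partition
   Delta'. *)
Definition runs_coarser (Delta Delta' : seq R) (F F' : feedback) : Prop :=
  forall i i', (i < size Delta)%N -> (i' < size Delta')%N ->
    tau Delta' i' <= tau Delta i < tau Delta' i'.+1 ->
    forall x, Cts t0 (tau Delta i) x -> G0 (x t0) ->
    forall t, t \in `[tau Delta i, tau Delta i.+1[ ->
      F i (x \_ `[t0, tau Delta i]) t =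
      F' i' (x \_ `[t0, tau Delta' i']) t.

Definition constructed_strategy
    (w : R -> (R -> 'rV[R]_n) -> (R -> 'rV[R]_n)) (eps : R)
    (U : strategy) : Prop :=
  strategies U /\
  exists net ustar vstar,
    [/\ is_net eps net, P ustar, Q vstar &
      forall Delta, partition Delta ->
        (balanced Delta ->
           constructed_feedback w eps net ustar vstar Delta (U Delta)) /\
        (~ balanced Delta ->
           exists2 Delta', thinning Delta Delta' &
             runs_coarser Delta Delta' (U Delta) (U Delta'))].

End Game.

(* Main.v *)
Require Import Defs.
From mathcomp Require Import all_boot all_order all_algebra.
From mathcomp Require Import all_classical all_reals all_analysis.
From mathcomp Require Import measurable_realfun ring lra.

Set Implicit Arguments.
Unset Strict Implicit.
Unset Printing Implicit Defensive.

Import Order.TTheory GRing.Theory Num.Theory.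
Import numFieldNormedType.Exports.

Local Open Scope classical_set_scope.
Local Open Scope ring_scope.

(** The values satisfy [Gamma_p <= Gamma_c <= Gamma_q <= Gamma_p]. The first
    inequality holds because a single disturbance forms a compact set.

    [Gamma_q <= Gamma_p] ([Gamma_q_le_Gamma_p]). Given a full-memory strategy,
    its motions for finer and finer partitions have a limit along a fixed
    ultrafilter, uniform by equicontinuity. The limit is a response to the
    disturbance that does not anticipate it, precisely because the ultrafilter
    does not depend on the disturbance ([limit_response]). A quasi-strategy,
    which knows the current value of the disturbance, can track this response by
    extremal aiming on a fine partition ([track_response]), and therefore costs
    hardly more than the strategy.

    Extremal aiming ([aim_step]) is the common mechanism. If the control
    minimizes the projection of the velocity on the deviation from a guide, and
    the guide is a limit of motions under the same disturbance, then the squared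
    deviation grows only by second-order terms in the length of the interval.

    [Gamma_c <= Gamma_q], with the constructed strategies ([guarantee]). Paths of
    the target set cost at most [Gamma_q] ([target_cost]), so it is enough that
    the motions stay close to the target set. There are two steps.

    First, the motion stays close to the model ([real_model_close]). A compact
    set of disturbances is close in mean, uniformly, to equicontinuous functions
    ([compact_disturbances]), hence on a fine partition the disturbance is close
    in mean, around [tau_i], to one of its values [vh] ([typical_value]). The
    slopes measured under the probing controls are close to the velocities for
    [vh] ([mismatch_typical]); an estimate that explains the slopes as well
    therefore acts as [vh] does under every control ([identified]), and the
    velocities of the motion and of the model differ little on the next interval
    ([defect_estimate], [step_defect]). As the number of the net controls and
    [eps] are fixed before the partition is refined, the errors in mean, which
    they magnify, still tend to zero. Gronwall's lemma adds up the defects.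

    Second, the model stays close to the target set ([model_target]). The target
    set is stable: if the disturbance changes at the time [s], then a target path
    can be continued from [s] on inside the target set as a limit of motions
    under the new disturbance ([target_stable]). The best approximation of the
    model can thus be continued along the estimated disturbance, and the control
    of the model aims at it.

    Since [Gamma_q] is upper semicontinuous in the initial state
    ([Gamma_q_usc]), the bound passes to limit motions ([Gamma_c_of_le]). To
    bound [Gamma_c] itself, target selectors and strategies of the prescribed
    form must exist ([selector_exists], [constructed_strategy_exists]). *)

(** * Euclidean norm *)

Section Euclidean.
Variables (R : realType) (m : nat).
Implicit Types (x y z : 'rV[R]_m) (a : R).

Lemma innerC x y : inner x y = inner y x.
Proof. by apply: eq_bigr => i _; rewrite mulrC. Qed.

Lemma innerDr x y z : inner x (y + z) = inner x y + inner x z.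
Proof. by rewrite -big_split; apply: eq_bigr => i _; rewrite mxE mulrDr. Qed.

Lemma innerZr x a y : inner x (a *: y) = a * inner x y.
Proof. by rewrite /inner mulr_sumr; apply: eq_bigr => i _; rewrite mxE mulrCA. Qed.

Lemma innerNr x y : inner x (- y) = - inner x y.
Proof. by rewrite -scaleN1r innerZr mulN1r. Qed.

Lemma innerBr x y z : inner x (y - z) = inner x y - inner x z.
Proof. by rewrite innerDr innerNr. Qed.

Lemma innerDl x y z : inner (y + z) x = inner y x + inner z x.
Proof. by rewrite innerC innerDr !(innerC x). Qed.

Lemma innerBl x y z : inner (y - z) x = inner y x - inner z x.
Proof. by rewrite innerC innerBr !(innerC x). Qed.

Lemma innerZl x a y : inner (a *: y) x = a * inner y x.
Proof. by rewrite innerC innerZr innerC. Qed.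

Lemma inner_ge0 x : 0 <= inner x x.
Proof. by apply: sumr_ge0 => i _; rewrite -expr2 sqr_ge0. Qed.

Lemma enorm_ge0 x : 0 <= enorm x. Proof. exact: sqrtr_ge0. Qed.

Lemma sqr_enorm x : enorm x ^+ 2 = inner x x.
Proof. by rewrite sqr_sqrtr// inner_ge0. Qed.

Lemma enormN x : enorm (- x) = enorm x.
Proof. by rewrite /enorm innerNr innerC innerNr opprK. Qed.

Lemma enormB x y : enorm (x - y) = enorm (y - x).
Proof. by rewrite -enormN opprB. Qed.

Lemma enormZ a x : enorm (a *: x) = `|a| * enorm x.
Proof.
by rewrite /enorm innerZr innerZl mulrA -expr2 sqrtrM ?sqr_ge0// sqrtr_sqr.
Qed.

Lemma enorm0 : enorm (0 : 'rV[R]_m) = 0.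
Proof. by rewrite -(scale0r (0 : 'rV[R]_m)) enormZ normr0 mul0r. Qed.

Lemma coord_le_enorm x i : `|x ord0 i| <= enorm x.
Proof.
rewrite -sqrtr_sqr ler_sqrt ?inner_ge0// /inner (bigD1 i)//= expr2 lerDl.
by apply: sumr_ge0 => j _; rewrite -expr2 sqr_ge0.
Qed.

Lemma enorm_le_sum x : enorm x <= \sum_(i < m) `|x ord0 i|.
Proof.
have s0 : 0 <= \sum_(i < m) `|x ord0 i| by apply: sumr_ge0.
rewrite -(ler_pXn2r (n := 2)) ?nnegrE ?enorm_ge0// sqr_enorm /inner.
rewrite expr2 mulr_suml ler_sum// => i _.
rewrite (le_trans (ler_norm _))// normrM ler_wpM2l// (bigD1 i)//= lerDl.
exact: sumr_ge0.
Qed.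

Lemma Cauchy_Schwarz x y : inner x y <= enorm x * enorm y.
Proof.
apply: (le_trans (ler_norm _)).
rewrite -(ler_pXn2r (n := 2)) ?nnegrE ?mulr_ge0 ?enorm_ge0//.
rewrite real_normK ?num_real// exprMn !sqr_enorm.
have [y0|y0] := eqVneq (inner y y) 0.
  have -> : inner x y = 0.
    apply: big1 => i _; have := coord_le_enorm y i.
    by rewrite /enorm y0 sqrtr0 normr_le0 => /eqP ->; rewrite mulr0.
  by rewrite y0 expr0n mulr0.
have yp : 0 < inner y y by rewrite lt0r y0 inner_ge0.
have := inner_ge0 (inner y y *: x - inner x y *: y).
rewrite !(innerBl, innerBr, innerZl, innerZr) (innerC y x) => h.
by rewrite -subr_ge0 -(pmulr_rge0 _ yp); nra.
Qed.

Lemma sqr_enormD x y :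
  enorm (x + y) ^+ 2 = enorm x ^+ 2 + 2 * inner x y + enorm y ^+ 2.
Proof. by rewrite !sqr_enorm innerDr !innerDl (innerC y x); ring. Qed.

Lemma ler_enormD x y : enorm (x + y) <= enorm x + enorm y.
Proof.
rewrite -(ler_pXn2r (n := 2)) ?nnegrE ?addr_ge0 ?enorm_ge0//.
rewrite sqr_enorm !(innerDl, innerDr) (innerC y x) sqrrD !sqr_enorm.
by have := Cauchy_Schwarz x y; lra.
Qed.

Lemma ler_distD_enorm z x y : enorm (x - y) <= enorm (x - z) + enorm (z - y).
Proof. by rewrite (le_trans _ (ler_enormD _ _))// addrA subrK. Qed.

Lemma ler_enormB x y : enorm x <= enorm y + enorm (x - y).
Proof. by have := ler_enormD y (x - y); rewrite addrC subrK. Qed.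

Lemma norm_le_enorm x : `|x| <= enorm x.
Proof.
rewrite [`|x|]mx_normrE; apply: bigmax_le => [|[i j] _] /=; first exact: enorm_ge0.
by rewrite (ord1 i) coord_le_enorm.
Qed.

Lemma enorm_le0 x : enorm x <= 0 -> x = 0.
Proof. by move=> h; apply/eqP; rewrite -normr_le0; exact: le_trans (norm_le_enorm _) h. Qed.

Lemma enorm_le_norm x : enorm x <= m%:R * `|x|.
Proof.
rewrite (le_trans (enorm_le_sum x))//.
rewrite -[X in X%:R]card_ord -sum1_card natr_sum mulr_suml ler_sum// => i _.
rewrite mul1r [`|x|]mx_normrE.
by rewrite (le_bigmax _ (fun i : 'I_1 * 'I_m => `|x i.1 i.2|) (ord0, i)).
Qed.

End Euclidean.

(** * Integration over intervals *)

Section Integral.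
Variable R : realType.
Local Notation mu := (@leb R).

Lemma leb_measurable_itv (i : interval R) :
  measurable ([set` i] : set (lebR R)).
Proof. by apply: sub_caratheodory; exact: measurable_itv. Qed.

Lemma leb_itv (a b : R) : a <= b -> mu `[a, b]%classic = (b - a)%:E.
Proof.
move=> ab; have := @lebesgue_measure_itv R `[a, b]; rewrite /= lte_fin => H.
transitivity (@lebesgue_measure R `[a, b]%classic) => //.
rewrite H; case: ltgtP ab => // -> _; by rewrite subrr.
Qed.

Lemma leb_set1 (a : R) : mu [set a] = 0.
Proof. by rewrite -set_itv1 leb_itv// subrr. Qed.

Definition ig (a b : R) (h : R -> R) : Prop :=
  mu.-integrable (`[a, b]%classic : set (lebR R)) (fun s : lebR R => (h s)%:E).

Definition J (a b : R) (h : R -> R) : R :=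
  \int[mu]_(s in (`[a, b]%classic : set (lebR R))) h s.

Definition mf (a b : R) (h : R -> R) : Prop :=
  measurable_fun (`[a, b]%classic : set (lebR R)) (h : lebR R -> R).

Lemma subset_itv_cc (a b c d : R) : a <= c -> d <= b ->
  `[c, d]%classic `<=` `[a, b]%classic.
Proof.
move=> ac db x /=; rewrite !in_itv/= => /andP[cx xd].
by rewrite (le_trans ac cx) (le_trans xd db).
Qed.

Lemma mf_sub a b c d h : a <= c -> d <= b -> mf a b h -> mf c d h.
Proof.
move=> ac db; apply: measurable_funS; first exact: leb_measurable_itv.
exact: subset_itv_cc.
Qed.

Lemma ig_sub a b c d h : a <= c -> d <= b -> ig a b h -> ig c d h.
Proof.
move=> ac db; apply: integrableS; [exact: leb_measurable_itv..|].
exact: subset_itv_cc.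
Qed.

Lemma ig_mf a b h : ig a b h -> mf a b h.
Proof. by move=> /measurable_int; move/measurable_EFinP. Qed.

Lemma ig_bounded a b h M : mf a b h -> (forall s, a <= s <= b -> `|h s| <= M) ->
  ig a b h.
Proof.
move=> mh hM; have [ab|ba] := leP a b; last first.
  by rewrite /ig set_itv_ge ?bnd_simp -?ltNge//; exact: integrable_set0.
apply: (@le_integrable _ _ _ mu _ _ _ (cst M%:E)).
- exact: leb_measurable_itv.
- exact/measurable_EFinP.
- move=> x; rewrite /= in_itv/= => xab.
  by rewrite lee_fin (le_trans (hM _ xab))// ler_norm.
- apply/integrableP; split; first exact: measurable_cst.
  under eq_integral do rewrite /cst/=.
  rewrite integral_cst/=; last exact: leb_measurable_itv.
  by rewrite leb_itv// -EFinM ltry.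
Qed.

Lemma ig_cst a b (c : R) : ig a b (fun=> c).
Proof.
by apply: (@ig_bounded _ _ _ `|c|) => [|s _]; first exact: measurable_cst.
Qed.

Lemma igD a b h1 h2 : ig a b h1 -> ig a b h2 -> ig a b (fun s => h1 s + h2 s).
Proof.
move=> i1 i2.
exact: (@integrableD _ _ _ mu _ (leb_measurable_itv _) _ _ i1 i2).
Qed.

Lemma igZ a b (c : R) h : ig a b h -> ig a b (fun s => c * h s).
Proof.
move=> i1.
exact: (@integrableZl _ _ _ mu _ (leb_measurable_itv _) c _ i1).
Qed.

Lemma igN a b h : ig a b h -> ig a b (fun s => - h s).
Proof. by move=> /(igZ (-1)); under eq_fun do rewrite mulN1r. Qed.

Lemma igB a b h1 h2 : ig a b h1 -> ig a b h2 -> ig a b (fun s => h1 s - h2 s).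
Proof. by move=> i1 /igN; exact: igD. Qed.

Lemma ig_sum a b (I : Type) (r : seq I) (h : I -> R -> R) :
  (forall i, ig a b (h i)) -> ig a b (fun s => \sum_(i <- r) h i s).
Proof.
move=> hi; elim: r => [|i r IH].
  by under eq_fun do rewrite big_nil; exact: ig_cst.
by under eq_fun do rewrite big_cons; exact: igD.
Qed.

Lemma J_ext a b h1 h2 : (forall s, a <= s <= b -> h1 s = h2 s) ->
  J a b h1 = J a b h2.
Proof.
by move=> h; apply: eq_Rintegral => x; rewrite inE/= in_itv/=; exact: h.
Qed.

Lemma ig_ext a b h1 h2 : (forall s, a <= s <= b -> h1 s = h2 s) ->
  ig a b h1 -> ig a b h2.
Proof.
move=> h; apply: eq_integrable; first exact: leb_measurable_itv.
by move=> x; rewrite inE/= in_itv/= => xab; rewrite h.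
Qed.

Lemma JD a b h1 h2 : ig a b h1 -> ig a b h2 ->
  J a b (fun s => h1 s + h2 s) = J a b h1 + J a b h2.
Proof. by move=> *; apply: RintegralD => //; exact: leb_measurable_itv. Qed.

Lemma JZ a b c h : ig a b h -> J a b (fun s => c * h s) = c * J a b h.
Proof. by move=> *; apply: RintegralZl => //; exact: leb_measurable_itv. Qed.

Lemma JB a b h1 h2 : ig a b h1 -> ig a b h2 ->
  J a b (fun s => h1 s - h2 s) = J a b h1 - J a b h2.
Proof. by move=> *; apply: RintegralB => //; exact: leb_measurable_itv. Qed.

Lemma J_sum a b (I : Type) (r : seq I) (h : I -> R -> R) :
  (forall i, ig a b (h i)) ->
  J a b (fun s => \sum_(i <- r) h i s) = \sum_(i <- r) J a b (h i).
Proof.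
move=> hi; elim: r => [|i r IH].
  rewrite big_nil; transitivity (0 * J a b (fun=> 0)); last by rewrite mul0r.
  rewrite -JZ; last exact: ig_cst.
  by apply: J_ext => s _; rewrite big_nil mul0r.
rewrite big_cons -IH -JD//; last exact: ig_sum.
by apply: J_ext => s _; rewrite big_cons.
Qed.

Lemma J_cst a b c : a <= b -> J a b (fun=> c) = c * (b - a).
Proof.
move=> ab; rewrite /J Rintegral_cst; last exact: leb_measurable_itv.
by rewrite leb_itv.
Qed.

Lemma J_le a b h1 h2 : ig a b h1 -> ig a b h2 ->
  (forall s, a <= s <= b -> h1 s <= h2 s) -> J a b h1 <= J a b h2.
Proof.
by move=> i1 i2 h; apply: le_Rintegral => //; exact: leb_measurable_itv.
Qed.

Lemma J_ge0 a b h : (forall s, a <= s <= b -> 0 <= h s) -> 0 <= J a b h.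
Proof. by move=> h0; apply: Rintegral_ge0 => x/=; rewrite in_itv/=; exact: h0. Qed.

(** Controls built interval by interval agree on half-open intervals only. *)
Lemma J_ae0 a b h : mf a b h -> (forall s, a <= s < b -> h s = 0) -> J a b h = 0.
Proof.
move=> mh h0; have [ab|ba] := ltP b a.
  by rewrite /J set_itv_ge ?Rintegral_set0// bnd_simp -ltNge.
rewrite (_ : J a b h = J a b (fun=> 0)); first by rewrite J_cst// mul0r.
congr fine; apply: ae_eq_integral.
- exact: leb_measurable_itv.
- exact/measurable_EFinP.
- exact: measurable_cst.
- exists [set b]; split; first by rewrite -set_itv1; exact: leb_measurable_itv.
    exact: leb_set1.
  move=> x /= /not_implyP[]; rewrite in_itv/= => /andP[ax xb] hx.
  apply/eqP; rewrite eq_le xb /= leNgt; apply/negP => xb'.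
  by apply: hx; rewrite h0 // ax.
Qed.

Lemma J_pt a h : J a a h = 0.
Proof.
rewrite (_ : J a a h = J a a (fun=> h a)).
  by rewrite J_cst// subrr mulr0.
by apply: J_ext => s /le_anti ->.
Qed.

Lemma J_split a b c h : a <= b -> b <= c -> ig a c h ->
  J a c h = J a b h + J b c h.
Proof.
move=> ab bc ih.
have E : [set` `[a, c]] = [set` `[a, b]] `|` [set` `]b, c]] :> set (lebR R).
  by rewrite -itv_bndbnd_setU// bnd_simp.
rewrite {1}/J E Rintegral_setU; [|exact: leb_measurable_itv..| |].
- congr (_ + _); rewrite /J.
  have E' : [set` `[b, c]] = [set b] `|` [set` `]b, c]] :> set (lebR R).
    by rewrite -set_itv1 -itv_bndbnd_setU// bnd_simp.
  rewrite E' Rintegral_setU; [| | | |].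
  + by rewrite -set_itv1 -[X in _ = X + _]/(J b b h) J_pt add0r.
  + by rewrite -set_itv1; exact: leb_measurable_itv.
  + exact: leb_measurable_itv.
  + by rewrite -E'; exact: (ig_sub ab (lexx c) ih).
  + apply/disj_setPS => x /= [->]; rewrite in_itv/= ltxx//.
- by rewrite -E.
- apply/disj_setPS => x /= []; rewrite !in_itv/= => /andP[_ xb] /andP[bx _].
  by move: (le_lt_trans xb bx); rewrite ltxx.
Qed.

Lemma ig_abs a b h : ig a b h -> ig a b (fun s => `|h s|).
Proof.
move=> ih; have := @integrable_norm _ _ _ mu _ _ ih.
by apply: eq_integrable => //; exact: leb_measurable_itv.
Qed.

End Integral.

(** * Measurability of compositions *)

Lemma within_continuous_ball (R : realType) (E F : pseudoMetricType R) (K : set E)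
    (phi : E -> F) a eta : {within K, continuous phi} -> K a -> 0 < eta ->
  exists2 d : R, 0 < d & forall b, K b -> ball a d b -> ball (phi a) eta (phi b).
Proof.
move=> /subspace_continuousP/(_ a) h Ka eta0.
have /nbhs_ballP[d d0 hd] := h Ka _ (nbhsx_ballx (phi a) eta eta0).
by exists d => // b Kb ab; exact: hd.
Qed.

Section Measurability.
Variables (R : realType) (a b : R).
Local Notation D := (`[a, b]%classic : set (lebR R)).

(** Measurability with respect to the countable family of sets
    [box], which refines every neighborhood; it is stable by pairing, whatever
    the Borel structure of the codomain. *)
Definition base_measurable (E : pseudoMetricType R) (Y : R -> E) : Prop :=
  exists (I : countType) (box : I -> set E),
    (forall x e, 0 < e -> exists2 i, box i x & box i `<=` ball x e) /\
    (forall i, measurable (D `&` [set t : lebR R | box i (Y t)])).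

Lemma base_measurable_pair (E F : pseudoMetricType R) (Y : R -> E) (Z : R -> F) :
  base_measurable Y -> base_measurable Z -> base_measurable (fun t => (Y t, Z t)).
Proof.
move=> [I [bx [hb mb]]] [I' [bx' [hb' mb']]].
exists (I * I')%type, (fun i => bx i.1 `*` bx' i.2); split.
  move=> [x x'] e e0; have [i bi si] := hb x e e0; have [i' bi' si'] := hb' x' e e0.
  by exists (i, i') => // -[y y'] /= [] /si ? /si' ?; split.
move=> [i i'] /=; have := measurableI _ _ (mb i) (mb' i').
by congr measurable; apply/seteqP; split => t /= => [[[? ?] [? ?]]|[? [? ?]]].
Qed.

(** The preimage of an open half-line is the union of the boxes on which [phi]
    stays above its end; only countably many boxes are needed. *)
Lemma continuous_base_measurable (E : pseudoMetricType R) (K : set E)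
    (phi : E -> R) (Y : R -> E) :
  {within K, continuous phi} -> (forall t, a <= t <= b -> K (Y t)) ->
  base_measurable Y -> mf a b (fun t => phi (Y t)).
Proof.
move=> cphi KY [I [bx [hb mb]]].
apply: (@measurability _ _ (lebR R) _ _ _ _ (RGenOInfty.measurableE R)) => _ [_ [r ->] <-].
have -> : D `&` (fun t => phi (Y t)) @^-1` `]r, +oo[%classic =
    \bigcup_(i in [set i | forall x, K x -> bx i x -> r < phi x])
      (D `&` [set t : lebR R | bx i (Y t)]).
  apply/seteqP; split => t /=; rewrite !in_itv/= ?andbT.
    move=> [tD rt]; have Kt := KY _ tD.
    have e0 : 0 < phi (Y t) - r by rewrite subr_gt0.
    have [d d0 hd] := within_continuous_ball cphi Kt e0.
    have [i bi si] := hb (Y t) d d0.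
    exists i => /= [x Kx /si /(hd _ Kx)|]; last by rewrite in_itv.
    by rewrite /ball/= => /ltr_normlP[]; lra.
  by move=> [i /= hi []]; rewrite in_itv/= => tD /(hi _ (KY _ tD)).
rewrite bigcup_mkcond; apply: countable_bigcupT_measurable => [|i].
  exact: countableP.
by case: ifP => // _; exact: mb.
Qed.

Lemma base_measurable_row m (u : R -> 'rV[R]_m) :
  (forall k, mf a b (fun t => u t ord0 k)) -> base_measurable u.
Proof.
move=> mu; exists ('rV[rat]_m * nat)%type.
pose r k : R := k.+1%:R^-1 / 2.
exists (fun i : 'rV[rat]_m * nat => [set x : 'rV[R]_m | forall j,
  ratr (i.1 ord0 j) - r i.2 < x ord0 j < ratr (i.1 ord0 j) + r i.2]).
split=> [x e e0|[c k] /=].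
  have [k /= hk] : exists k, k.+1%:R^-1 < e.
    by have [N _ H] := near_infty_natSinv_lt (PosNum e0); exists N; exact: (H N (leqnn N)).
  have rk : 0 < r k by rewrite divr_gt0.
  have ex j : exists q : rat, x ord0 j - r k < ratr q < x ord0 j + r k.
    have /rat_in_itvoo[q] : x ord0 j - r k < x ord0 j + r k by lra.
    by rewrite inE/= => H; exists q.
  pose c := \row_j projT1 (cid (ex j)).
  have hc j : x ord0 j - r k < ratr (c ord0 j) < x ord0 j + r k.
    by rewrite /c mxE; case: cid.
  exists (c, k) => /= [j|y hy]; first by move: (hc j); lra.
  rewrite mx_norm_ball /ball_/=.
  apply: le_lt_trans hk; rewrite [`|_|]mx_normrE.
  apply: bigmax_le => [|[i j] _] /=; first by rewrite invr_ge0.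
  have H : `|x ord0 j - y ord0 j| <= k.+1%:R^-1 :> R.
    move: (hc j) (hy j) => /andP[h1 h2] /andP[h3 h4]; rewrite ler_norml; apply/andP.
    by move: h1 h2 h3 h4; rewrite /r; move: (k.+1%:R^-1) => z *; split; lra.
  by rewrite (ord1 i : i = ord0) !mxE.
have -> : D `&` [set t | forall j, ratr (c ord0 j) - r k < u t ord0 j < ratr (c ord0 j) + r k]
  = \bigcap_(j in [set: 'I_m]) (D `&` (fun t : lebR R => u t ord0 j) @^-1`
       `](ratr (c ord0 j) - r k), (ratr (c ord0 j) + r k)[%classic) `&` D.
  apply/seteqP; split => t /=; rewrite ?in_itv/=.
    by move=> [tD H]; split => // j _ /=; rewrite in_itv/= !in_itv/=.
  by move=> [H tD]; split=> // j; have [] := H j I; rewrite /= in_itv.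
apply: measurableI; last exact: leb_measurable_itv.
apply: fin_bigcap_measurable => [|j _]; first exact: finite_finset.
by apply: (mu j); [exact: leb_measurable_itv|exact: measurable_itv].
Qed.

Lemma base_measurable_real (h : R -> R) : mf a b h -> base_measurable h.
Proof.
move=> mh; exists (rat * nat)%type.
pose r k : R := k.+1%:R^-1 / 2.
exists (fun i : rat * nat => [set x | ratr i.1 - r i.2 < x < ratr i.1 + r i.2]).
split=> [x e e0|[c k] /=].
  have [k /= hk] : exists k, k.+1%:R^-1 < e.
    by have [N _ H] := near_infty_natSinv_lt (PosNum e0); exists N; exact: (H N (leqnn N)).
  have rk : 0 < r k by rewrite divr_gt0.
  have /rat_in_itvoo[c] : x - r k < x + r k by lra.
  rewrite inE/= => hc; have {}hc : x - r k < ratr c < x + r k := hc.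
  exists (c, k) => /= [|y hy]; first by move: hc; lra.
  suff : `|x - y| < e :> R by [].
  rewrite ltr_norml; move: hc hy hk => /andP[h1 h2] /andP[h3 h4].
  by move: h1 h2 h3 h4; rewrite /r; move: (k.+1%:R^-1) => z *; apply/andP; split; lra.
have -> : D `&` [set t | ratr c - r k < h t < ratr c + r k]
  = D `&` (h : lebR R -> R) @^-1` `](ratr c - r k), (ratr c + r k)[%classic.
  by apply/seteqP; split => t /=; rewrite !in_itv/=.
by apply: mh; [exact: leb_measurable_itv|exact: measurable_itv].
Qed.

Lemma mf_id : mf a b id.
Proof.
move=> _ B mB; apply: measurableI; first exact: leb_measurable_itv.
exact: sub_caratheodory.
Qed.

Lemma mf_continuous (h : R -> R) : {within `[a, b], continuous h} -> mf a b h.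
Proof.
move=> ch; apply: (continuous_base_measurable ch).
  by move=> t tab /=; rewrite in_itv.
exact: base_measurable_real mf_id.
Qed.

End Measurability.

Lemma within_continuous_coord (R : realType) (T : topologicalType) m (A : set T)
    (x : T -> 'rV[R]_m) k :
  {within A, continuous x} -> {within A, continuous (fun t => x t ord0 k)}.
Proof.
move=> cx t; have ck : {for x t, continuous (fun M : 'rV[R]_m => M ord0 k)}.
  exact: coord_continuous.
exact: (continuous_comp (cx t) ck).
Qed.

Lemma mf_enorm (R : realType) m (a b : R) (h : R -> 'rV[R]_m) :
  (forall k, mf a b (fun t => h t ord0 k)) -> mf a b (fun t => enorm (h t)).
Proof.
move=> mh; rewrite /mf /enorm.
apply: (@measurableT_comp _ _ _ _ _ _ (@Num.sqrt R)).
  by apply: continuous_measurable_fun; exact: sqrt_continuous.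
by rewrite /inner; apply: measurable_sum => i; apply: measurable_funM; exact: mh.
Qed.

Lemma mf_switch (R : realType) (a b s : R) (h1 h2 : R -> R) : mf a b h1 -> mf a b h2 ->
  mf a b (fun t => if t < s then h1 t else h2 t).
Proof.
move=> m1 m2; apply: measurable_fun_if; first exact: leb_measurable_itv.
- by apply: measurable_fun_ltr; [exact: mf_id|exact: measurable_cst].
- apply: measurable_funS m1; [exact: leb_measurable_itv|exact: subIsetl].
- apply: measurable_funS m2; [exact: leb_measurable_itv|exact: subIsetl].
Qed.

(** * Vector integrals, exponential weights and Gronwall's lemma *)

Section VectorIntegral.
Variables (R : realType) (m : nat).
Implicit Types (h : R -> 'rV[R]_m).

Definition vig (a b : R) h : Prop := forall k, ig a b (fun s => h s ord0 k).

Definition vJ (a b : R) h : 'rV[R]_m := \row_k J a b (fun s => h s ord0 k).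

Lemma vig_sub a b c d h : a <= c -> d <= b -> vig a b h -> vig c d h.
Proof. by move=> ac db hh k; exact: (ig_sub ac db (hh k)). Qed.

Lemma vigB a b h1 h2 : vig a b h1 -> vig a b h2 -> vig a b (fun s => h1 s - h2 s).
Proof.
move=> i1 i2 k; apply: (ig_ext _ (igB (i1 k) (i2 k))) => s _.
by rewrite !mxE.
Qed.

Lemma vig_bounded a b h M : (forall k, mf a b (fun s => h s ord0 k)) ->
  (forall s, a <= s <= b -> enorm (h s) <= M) -> vig a b h.
Proof.
move=> mh hM k; apply: (ig_bounded (mh k)) => s sab.
exact: le_trans (coord_le_enorm _ _) (hM _ sab).
Qed.

Lemma vJ_split a b c h : a <= b -> b <= c -> vig a c h ->
  vJ a c h = vJ a b h + vJ b c h.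
Proof.
by move=> ab bc hh; apply/rowP => k; rewrite !mxE (ord1 ord0) (J_split ab bc).
Qed.

Lemma vJB a b h1 h2 : vig a b h1 -> vig a b h2 ->
  vJ a b (fun s => h1 s - h2 s) = vJ a b h1 - vJ a b h2.
Proof.
move=> i1 i2; apply/rowP => k; rewrite !mxE -JB//.
by apply: J_ext => s _; rewrite !mxE.
Qed.

Lemma vJ_ext a b h1 h2 : (forall s, a <= s <= b -> h1 s = h2 s) ->
  vJ a b h1 = vJ a b h2.
Proof. by move=> h; apply/rowP => k; rewrite !mxE; apply: J_ext => s /h ->. Qed.

Lemma vJ_pt a h : vJ a a h = 0.
Proof. by apply/rowP => k; rewrite !mxE J_pt. Qed.

Lemma ig_inner a b h l : vig a b h -> ig a b (fun s => inner l (h s)).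
Proof. by move=> hh; apply: ig_sum => k; exact: igZ. Qed.

Lemma inner_vJ a b h l : vig a b h -> inner l (vJ a b h) = J a b (fun s => inner l (h s)).
Proof.
move=> hh; rewrite J_sum => [|k]; last exact: igZ.
by apply: eq_bigr => k _; rewrite mxE JZ.
Qed.

(** Testing the integral against itself reduces the inequality between norms
    to the scalar one, by the Cauchy-Schwarz inequality under the integral. *)
Lemma enorm_vJ_le a b h (phi : R -> R) : vig a b h -> ig a b phi ->
  (forall s, a <= s <= b -> enorm (h s) <= phi s) ->
  enorm (vJ a b h) <= J a b phi.
Proof.
move=> ih ip hp; set V := vJ a b h.
have phi0 : 0 <= J a b phi.
  by apply: J_ge0 => s /hp; apply: le_trans; exact: enorm_ge0.
have [V0|V0] := eqVneq (enorm V) 0; first by rewrite V0.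
have Vp : 0 < enorm V by rewrite lt0r V0 enorm_ge0.
rewrite -(ler_pM2l Vp) -expr2 sqr_enorm {2}/V inner_vJ// -JZ//.
apply: J_le => [||s sab]; [exact: ig_inner|exact: igZ|].
by rewrite (le_trans (Cauchy_Schwarz _ _))// ler_wpM2l ?hp// ltW.
Qed.

Lemma enorm_vJ_le_cst a b h M : a <= b -> vig a b h ->
  (forall s, a <= s <= b -> enorm (h s) <= M) ->
  enorm (vJ a b h) <= M * (b - a).
Proof. by move=> ab ih hM; rewrite -J_cst//; apply: enorm_vJ_le => //; exact: ig_cst. Qed.

End VectorIntegral.

Section Gronwall.
Variable R : realType.

(** On Borel functions the completed measure and the Lebesgue measure have the
    same integrals, so that the fundamental theorem of calculus applies. *)
Lemma J_borel (a b : R) (h : R -> R) :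
  measurable_fun (`[a, b]%classic : set (measurableTypeR R)) (h : measurableTypeR R -> R) ->
  (forall s, a <= s <= b -> 0 <= h s) ->
  J a b h = fine (\int[@lebesgue_measure R]_(s in `[a, b]) (h s)%:E)%E.
Proof.
move=> mh h0; congr fine.
pose phi : lebR R -> measurableTypeR R := id.
have mphi : measurable_fun setT phi.
  by move=> _ B mB; rewrite setTI; exact: sub_caratheodory.
transitivity (\int[pushforward (@leb R) phi]_(s in `[a, b]) (h s)%:E)%E.
  rewrite (@ge0_integral_pushforward _ _ _ _ _ _ mphi)//.
    exact/measurable_EFinP.
  by move=> y; rewrite inE/= in_itv/= lee_fin; exact: h0.
by apply: eq_measure_integral.
Qed.

Lemma J_expR (c a t : R) : 0 < c -> a <= t ->
  J a t (fun s => expR (c * (s - a))) = (expR (c * (t - a)) - 1) / c.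
Proof.
move=> c0; rewrite le_eqVlt => /orP[/eqP<-|at_].
  by rewrite J_pt subrr mulr0 expR0 subrr mul0r.
have dF (x : R) : is_derive x 1 (fun s => c^-1 * expR (c * (s - a))) (expR (c * (x - a))).
  apply: is_derive_eq; rewrite /GRing.scale/= subr0 mulr1 mulrCA mulVf ?gt_eqF//.
  by rewrite mulr1.
have cF : continuous (fun s => c^-1 * expR (c * (s - a))).
  by move=> x; apply/differentiable_continuous/derivable1_diffP; have [] := dF x.
have cf : continuous (fun s => expR (c * (s - a))).
  move=> x; rewrite (_ : (fun s => _) = (fun s => c * (c^-1 * expR (c * (s - a))))).
    by apply: cvgM; [exact: cvg_cst|exact: cF].
  by apply/funext => s; rewrite mulrA mulfV ?gt_eqF// mul1r.
rewrite J_borel; first last.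
- by move=> s _; exact: expR_ge0.
- by apply: measurable_funTS; exact: continuous_measurable_fun.
rewrite (continuous_FTC2 (F := fun s => c^-1 * expR (c * (s - a))))//; first last.
- by move=> x _; rewrite derive1E; have [] := dF x.
- split.
  + by move=> x _; have [] := dF x.
  + exact/cvg_at_right_filter/cF.
  + exact/cvg_at_left_filter/cF.
- exact: continuous_subspaceT.
by rewrite /= subrr mulr0 expR0 -mulrBr mulrC.
Qed.

Lemma ig_expR (c a b : R) : ig a b (fun s => expR (c * (s - a))).
Proof.
apply: (@ig_bounded _ _ _ _ (expR (`|c| * (b - a)))).
  apply: mf_continuous; apply: continuous_subspaceT => x.
  apply: continuous_comp; last exact: continuous_expR.
  by apply: cvgM; [exact: cvg_cst|apply: cvgB; [exact: cvg_id|exact: cvg_cst]].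
move=> r /andP[ar rb]; rewrite ger0_norm ?expR_ge0// ler_expR.
have := ler_norm c; have := normr_ge0 c; nra.
Qed.

(** If the supremum [m] of [e] relative to the weight [expR (L * (t - a))]
    exceeded [A], the hypothesis would bound that relative value by a convex
    combination of [A] and [m] in which the coefficient of [A] is at least the
    inverse of the largest weight: less than [m], a contradiction. *)
Lemma Gronwall (a b A L B : R) (e : R -> R) : 0 < L -> 0 <= A ->
  ig a b e -> (forall t, a <= t <= b -> 0 <= e t <= B) ->
  (forall t, a <= t <= b -> e t <= A + L * J a t e) ->
  forall t, a <= t <= b -> e t <= A * expR (L * (t - a)).
Proof.
move=> L0 A0 ie eB he.
pose W t := expR (L * (t - a)).
have W1 t : a <= t <= b -> 1 <= W t.
  move=> /andP[at_ _]; rewrite (le_trans _ (expR_ge1Dx _))// lerDl mulr_ge0 ?subr_ge0//.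
  exact: ltW.
pose S := [set e t / W t | t in `[a, b]].
have Sub : ubound S B.
  move=> y [t]; rewrite /= in_itv/= => tab <-.
  have /andP[e0 eB'] := eB _ tab; have W1t := W1 _ tab.
  by rewrite ler_pdivrMr ?(lt_le_trans ltr01)//; nra.
move=> t tab.
have S0 : S !=set0 by exists (e t / W t), t => //=; rewrite in_itv.
have em s : a <= s <= b -> e s <= sup S * W s.
  move=> sab; rewrite -ler_pdivrMr ?expR_gt0//.
  by apply: ub_le_sup; [exists B|exists s => //=; rewrite in_itv].
suff mA : sup S <= A.
  by apply: (le_trans (em _ tab)); rewrite ler_wpM2r ?expR_ge0.
rewrite leNgt; apply/negP => Am.
have ab : a <= b by case/andP: tab => ? ?; lra.
have Wb1 : 1 <= W b by apply: W1; rewrite ab lexx.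
suff : sup S <= sup S - (sup S - A) / W b.
  have : 0 < (sup S - A) / W b by rewrite divr_gt0 ?expR_gt0// subr_gt0.
  lra.
apply: ge_sup => // y [s]; rewrite /= in_itv/= => sab <-.
have /andP[as_ sb] := sab.
have W1s := W1 _ sab.
have Wsb : W s <= W b by rewrite ler_expR ler_wpM2l ?lerB// ltW.
have HJ : L * J a s e <= sup S * (W s - 1).
  have -> : sup S * (W s - 1) = L * (sup S * ((W s - 1) / L)).
    by field; rewrite gt_eqF.
  rewrite ler_wpM2l ?(ltW L0)// -J_expR// -JZ; last exact: ig_expR.
  apply: J_le; [exact: (ig_sub (lexx a) sb ie)|by apply: igZ; exact: ig_expR|].
  by move=> r /andP[ar rs]; apply: em; rewrite ar (le_trans rs).
have es := he _ sab.
have : (sup S - A) / W b <= (sup S - A) / W s.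
  by rewrite ler_wpM2l ?subr_ge0 ?(ltW Am)// lef_pV2 ?posrE ?expR_gt0.
suff : e s / W s <= sup S - (sup S - A) / W s by lra.
rewrite ler_pdivrMr ?expR_gt0// mulrBl divfK ?gt_eqF ?expR_gt0//.
by lra.
Qed.

End Gronwall.

(** * Compactness and limits along ultrafilters *)

Lemma compact_uniformly_continuous (R : realType) (E F : pseudoMetricType R)
    (K : set E) (phi : E -> F) eta :
  compact K -> {within K, continuous phi} -> 0 < eta ->
  exists2 d : R, 0 < d & forall a b, K a -> K b -> ball a d b ->
    ball (phi a) eta (phi b).
Proof.
move=> /compact_near_coveringP cK cphi eta0.
pose P (d : R) (a : E) := K a -> forall b, K b -> ball a d b ->
  ball (phi a) eta (phi b).
have : \forall d \near 0^'+, K `<=` P d.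
  apply: (cK R (0^'+)) => x Kx.
  have e2 : 0 < eta / 2 by rewrite divr_gt0.
  have [r r0 hr] := within_continuous_ball cphi Kx e2.
  have r2 : 0 < r / 2 by rewrite divr_gt0.
  near=> x' d => /= Kx' b Kb x'b.
  have xx' : ball x (r / 2) x' by near: x'; exact: nbhsx_ballx.
  have dr : d <= r / 2 by near: d; exact: nbhs_right_le.
  apply: (@ball_splitr _ _ (phi x)).
    by apply: hr => //; apply: le_ball xx'; lra.
  apply: hr => //; apply: (@ball_split _ _ x') => //.
  exact: le_ball dr _ x'b.
move=> H; near (0 : R)^'+ => d.
exists d; first by near: d; exact: nbhs_right_gt.
move=> a b Ka Kb; have : K `<=` P d by near: d.
by move=> /(_ a Ka); exact.
Unshelve. all: by end_near. Qed.

Section EuclideanTopology.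
Variables (R : realType) (m : nat).
Implicit Types (x y l : 'rV[R]_m).

Lemma enorm_ball x e : 0 < e -> \forall y \near x, enorm (x - y) < e.
Proof.
move=> e0; have m1 : 0 < m%:R + 1 :> R by rewrite ltr_wpDl.
have d0 : 0 < e / (m%:R + 1) by rewrite divr_gt0.
apply/nbhs_ballP; exists (e / (m%:R + 1)) => //= y.
rewrite mx_norm_ball /ball_/= => xy.
apply: (le_lt_trans (enorm_le_norm _)).
move: xy; rewrite ltr_pdivlMr// => xy.
by apply: le_lt_trans xy; rewrite mulrC ler_wpM2l// lerDl.
Qed.

Lemma ball_enorm x y e : enorm (x - y) < e -> ball x e y.
Proof. by move=> xy; rewrite mx_norm_ball; exact: le_lt_trans (norm_le_enorm _) xy. Qed.

Lemma enorm_continuous : continuous (@enorm R m).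
Proof.
move=> x; apply/(@cvgrPdist_lt _ _ _ _ (nbhs_filter x)) => e e0.
near=> y; have xy : enorm (x - y) < e by near: y; exact: enorm_ball.
apply: le_lt_trans xy; rewrite ler_norml; apply/andP; split.
  by have := ler_enormB y x; rewrite (enormB y); lra.
by have := ler_enormB x y; lra.
Unshelve. all: by end_near. Qed.

Lemma cvg_enormP (T : Type) (F : set_system T) (FF : Filter F) (x : T -> 'rV[R]_m) l :
  x @ F --> l <-> forall e, 0 < e -> \forall k \near F, enorm (l - x k) < e.
Proof.
split=> [xl e e0|h]; first exact: xl (enorm_ball l e0).
apply/cvg_ballP => e e0; have := h e e0.
by apply: filterS => k; exact: ball_enorm.
Qed.

Lemma compact_enorm_ball B : compact [set x : 'rV[R]_m | enorm x <= B].
Proof.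
apply: bounded_closed_compact.
  exists B; split; first exact: num_real.
  by move=> M BM x /= xB; rewrite (le_trans (norm_le_enorm x))// (le_trans xB)// ltW.
apply: (@preimage_closed _ _ (@enorm R m) [set r | r <= B]).
  by move=> x _; exact: enorm_continuous.
exact: closed_le.
Qed.

End EuclideanTopology.

Section Ultralimit.
Variables (R : realType) (m : nat) (F : set_system nat).
Hypothesis FU : UltraFilter F.

Local Instance F_proper : ProperFilter F := ultra_proper.

Definition ulim (x : nat -> 'rV[R]_m) : 'rV[R]_m := lim (x @ F).

Lemma ulimP (x : nat -> 'rV[R]_m) B : (forall k, enorm (x k) <= B) ->
  forall e, 0 < e -> F [set k | enorm (ulim x - x k) < e].
Proof.
move=> xB.
have PFx : ProperFilter (x @ F) by exact: fmap_proper_filter.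
have [l [_ cl]] := @compact_enorm_ball R m B (x @ F) PFx (filterE _ xB).
suff xl : x @ F --> l.
  have -> : ulim x = l by apply: (cvg_lim _ xl); exact: norm_hausdorff.
  exact/cvg_enormP.
move=> U lU; have [//|FnU] := in_ultra_setVsetC (x @^-1` U) FU.
by have [y [nUy Uy]] := cl (~` U) U FnU lU.
Qed.

(** Along an ultrafilter a bounded equi-Lipschitz sequence converges uniformly
    to its pointwise limit: the Arzela-Ascoli theorem, without subsequences. *)
Lemma ulim_uniform (x : nat -> R -> 'rV[R]_m) a b B M :
  0 <= M ->
  (forall k t, a <= t <= b -> enorm (x k t) <= B) ->
  (forall k s t, a <= s <= b -> a <= t <= b ->
     enorm (x k t - x k s) <= M * `|t - s|) ->
  (forall s t, a <= s <= b -> a <= t <= b ->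
     enorm (ulim (x^~ t) - ulim (x^~ s)) <= M * `|t - s|) /\
  forall e, 0 < e -> F [set k | forall t, a <= t <= b ->
    enorm (ulim (x^~ t) - x k t) < e].
Proof.
move=> M0 xB xM.
pose xx k t := x k (Num.min (Num.max a t) b).
have cl t : a <= b -> a <= Num.min (Num.max a t) b <= b.
  by move=> ab; rewrite le_min ge_min le_max lexx ab /= lexx orbT.
have pw t e : a <= t <= b -> 0 < e -> F [set k | enorm (ulim (x^~ t) - x k t) < e].
  move=> /andP[at_ tb]; have ab := le_trans at_ tb.
  have -> : x^~ t = xx^~ t by apply/funext => k; rewrite /xx max_r// min_l.
  move=> e0; have := @ulimP (xx^~ t) B (fun k => xB k _ (cl t ab)) e e0.
  by apply: filterS => k; rewrite /xx max_r// min_l.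
have lipM s t : a <= s <= b -> a <= t <= b ->
    enorm (ulim (x^~ t) - ulim (x^~ s)) <= M * `|t - s|.
  move=> sab tab; apply/ler_addgt0Pr => e e0.
  have e2 : 0 < e / 2 by rewrite divr_gt0.
  near F => k.
  have h1 : enorm (ulim (x^~ t) - x k t) < e / 2 by near: k; exact: pw.
  have h2 : enorm (ulim (x^~ s) - x k s) < e / 2 by near: k; exact: pw.
  have := xM k s t sab tab.
  have := ler_distD_enorm (x k t) (ulim (x^~ t)) (ulim (x^~ s)).
  have := ler_distD_enorm (x k s) (x k t) (ulim (x^~ s)).
  by rewrite (enormB (x k s)); lra.
split=> // e e0.
have /compact_near_coveringP cab : compact `[a, b]%classic by exact: segment_compact.
pose P k t := a <= t <= b -> enorm (ulim (x^~ t) - x k t) < e.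
have : \forall k \near F, `[a, b]%classic `<=` P k.
  apply: cab => t; rewrite /= in_itv/= => tab.
  have e3 : 0 < e / 3 by rewrite divr_gt0.
  have d0 : 0 < e / 3 / (M + 1) by rewrite divr_gt0// ltr_wpDl.
  near=> s k => /= sab.
  have h1 : enorm (ulim (x^~ t) - x k t) < e / 3 by near: k; exact: pw.
  have ts : `|t - s| < e / 3 / (M + 1) by near: s; exact: nbhsx_ballx.
  have {}ts : M * `|t - s| < e / 3.
    move: ts; rewrite ltr_pdivlMr ?ltr_wpDl// => ts; apply: le_lt_trans ts.
    by rewrite mulrC ler_wpM2l// lerDl.
  have := xM k s t sab tab.
  have := lipM _ _ tab sab.
  have := ler_distD_enorm (ulim (x^~ t)) (ulim (x^~ s)) (x k s).
  have := ler_distD_enorm (x k t) (ulim (x^~ t)) (x k s).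
  rewrite (distrC s t); lra.
by apply: filterS => k H t tab; apply: H => //=; rewrite in_itv.
Unshelve. all: by end_near. Qed.

End Ultralimit.

Section LipschitzPaths.
Variables (R : realType) (m : nat).
Implicit Types (x y : R -> 'rV[R]_m).

Definition lip_on (a b M : R) x : Prop :=
  forall s t, a <= s <= b -> a <= t <= b -> enorm (x t - x s) <= M * `|t - s|.

Lemma lip_on_sub a b c d M x : a <= c -> d <= b -> lip_on a b M x -> lip_on c d M x.
Proof.
move=> ac db h s t /andP[? ?] /andP[? ?]; apply: h; apply/andP; split; lra.
Qed.

Lemma lip_on_Cts a b M x : lip_on a b M x -> Cts a b x.
Proof.
move=> h; apply/subspace_continuousP => t tab; apply/cvg_enormP => e e0.
have [M0|M0] := ltP M 0.
  near=> s; move: tab; rewrite /= in_itv/= => tab.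
  have sab : s \in `[a, b] by near: s; exact: withinT.
  rewrite enormB; move: (h _ _ tab sab) (normr_ge0 (s - t)) (enorm_ge0 (x s - x t)).
  by move=> *; nra.
have d0 : 0 < e / (M + 1) by rewrite divr_gt0// ltr_wpDl.
near=> s; move: tab; rewrite /= in_itv/= => tab.
have sab : s \in `[a, b] by near: s; exact: withinT.
have ts : `|t - s| < e / (M + 1).
  by near: s; apply: cvg_within; exact: nbhsx_ballx.
apply: (le_lt_trans (h _ _ sab tab)).
move: ts; rewrite ltr_pdivlMr ?ltr_wpDl// => ts; apply: le_lt_trans ts.
by rewrite mulrC ler_wpM2l// lerDl.
Unshelve. all: by end_near. Qed.

Lemma lip_on_cat a b c M x : a <= b -> b <= c ->
  lip_on a b M x -> lip_on b c M x -> lip_on a c M x.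
Proof.
move=> ab bc h1 h2.
have key s t : a <= s <= c -> a <= t <= c -> s <= t ->
    enorm (x t - x s) <= M * (t - s).
  move=> /andP[as_ sc] /andP[at_ tc] st.
  have n1 (u v : R) : u <= v -> `|v - u| = v - u by move=> uv; rewrite ger0_norm// subr_ge0.
  have [tb|bt] := leP t b.
    rewrite -n1//; apply: h1; lra.
  have [bs|sb] := leP b s; first by rewrite -n1//; apply: h2; lra.
  have := ler_distD_enorm (x b) (x t) (x s).
  have H1 := h1 s b ltac:(lra) ltac:(lra); have H2 := h2 b t ltac:(lra) ltac:(lra).
  rewrite !n1 in H1 H2; lra.
move=> s t sac tac; have [st|ts] := leP s t.
  by rewrite ger0_norm ?subr_ge0//; exact: key.
have := key _ _ tac sac (ltW ts); rewrite enormB distrC ger0_norm// subr_ge0 ltW//.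
Qed.

End LipschitzPaths.

(** * Caratheodory solutions *)

Section Dynamics.
Variables (R : realType) (n p q : nat) (g : game R n p q).
Hypothesis hg : standing_assumptions g.
Local Notation f := (dyn g).
Local Notation P := (Pset g).
Local Notation Q := (Qset g).

Definition admissible (a b : R) (u : R -> 'rV[R]_p) (v : R -> 'rV[R]_q) : Prop :=
  [/\ forall k, mf a b (fun t => u t ord0 k),
      forall k, mf a b (fun t => v t ord0 k),
      forall t, a <= t <= b -> P (u t) &
      forall t, a <= t <= b -> Q (v t)].

Lemma admissible_sub a b c d u v : a <= c -> d <= b ->
  admissible a b u v -> admissible c d u v.
Proof.
move=> ac db [mu mv Pu Qv]; split.
- by move=> k; exact: (mf_sub ac db (mu k)).
- by move=> k; exact: (mf_sub ac db (mv k)).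
- by move=> t tcd; apply: Pu; lra.
- by move=> t tcd; apply: Qv; lra.
Qed.

Lemma controls_admissible u v : controls g u -> disturbances g v ->
  admissible (t0 g) (theta g) u v.
Proof.
by move=> [mu Pu] [mv Qv]; split.
Qed.

Definition velocity (x : R -> 'rV[R]_n) (u : R -> 'rV[R]_p) (v : R -> 'rV[R]_q) s :=
  f s (x s) (u s) (v s).

(** The dynamics is continuous only within the sets of controls and
    disturbances, and need not be Borel measurable elsewhere. *)
Lemma velocity_measurable a b x u v : t0 g <= a -> b <= theta g ->
  Cts a b x -> admissible a b u v ->
  forall k, mf a b (fun s => velocity x u v s ord0 k).
Proof.
move=> ta bt cx [mu mv Pu Qv] k.
have cf := within_continuous_coord (k := k) (dyn_continuous hg).
apply: (continuous_base_measurable (Y := fun s => (s, x s, u s, v s)) cf).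
  move=> t /[dup] tab /andP[at_ tb]; split; last exact: Qv.
  split; last exact: Pu.
  by split => //=; rewrite in_itv/= (le_trans ta) ?(le_trans tb).
apply: base_measurable_pair; last exact: base_measurable_row.
apply: base_measurable_pair; last exact: base_measurable_row.
apply: base_measurable_pair; first exact/base_measurable_real/mf_id.
apply: base_measurable_row => j; apply: mf_continuous.
exact: within_continuous_coord.
Qed.

Lemma solutionP a b z u v x : solution g a b z u v x <->
  Cts a b x /\ forall t, a <= t <= b ->
    vig a t (velocity x u v) /\ x t = z + vJ a t (velocity x u v).
Proof.
split=> -[cx h]; split=> // t tab.
  have {}h := h t; rewrite in_itv/= in h; have {}h := h tab.
  split=> [k|]; first exact: (h k).1.
  by apply/rowP => k; rewrite !mxE !(ord1 0); exact: (h k).2.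
move=> k; rewrite in_itv/= in tab; have [h1 h2] := h t tab.
split; first exact: h1.
by rewrite h2 !mxE.
Qed.

Lemma solution_init a b z u v x : a <= b -> solution g a b z u v x -> x a = z.
Proof.
move=> ab /solutionP[_ h]; have [_ ->] := h a ltac:(lra).
by rewrite vJ_pt addr0.
Qed.

Lemma solution_Cts a b z u v x : solution g a b z u v x -> Cts a b x.
Proof. by case. Qed.

Lemma Cts_sub m (a b c d : R) (x : R -> 'rV[R]_m) : a <= c -> d <= b ->
  Cts a b x -> Cts c d x.
Proof. by move=> ac db; apply: continuous_subspaceW; exact: subset_itv_cc. Qed.

Lemma solution_incr a b z u v x s t : solution g a b z u v x ->
  a <= s -> s <= t -> t <= b ->
  vig s t (velocity x u v) /\ x t = x s + vJ s t (velocity x u v).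
Proof.
move=> /solutionP[_ h] as_ st tb.
have [h1 ->] := h t ltac:(lra); have [h2 ->] := h s ltac:(lra).
split; first exact: (vig_sub as_ (lexx t) h1).
by rewrite -addrA -vJ_split.
Qed.

Lemma solution_sub a b z u v x c d : solution g a b z u v x ->
  a <= c -> c <= d -> d <= b -> solution g c d (x c) u v x.
Proof.
move=> hx ac cd db; apply/solutionP; split.
  exact: Cts_sub ac db (solution_Cts hx).
by move=> t tcd; apply: (solution_incr hx); lra.
Qed.

Lemma solution_ext a b z u v u' v' x x' : solution g a b z u v x ->
  (forall t, a <= t <= b -> [/\ u t = u' t, v t = v' t & x t = x' t]) ->
  solution g a b z u' v' x'.
Proof.
move=> /solutionP[cx h] e; apply/solutionP; split.
  apply: (@subspace_eq_continuous _ _ _ x) cx => t tab.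
  by have [] := e t _; rewrite ?(inE, in_itv)//= in tab *.
move=> t tab; have [h1 h2] := h t tab.
have E s : a <= s <= t -> velocity x u v s = velocity x' u' v' s.
  by move=> sat; have [] := e s ltac:(lra); rewrite /velocity => -> -> ->.
split; first by move=> k; apply: (ig_ext _ (h1 k)) => s /E ->.
by have [_ _ <-] := e t tab; rewrite h2; congr (_ + _); exact: vJ_ext.
Qed.

Lemma growth_rate_exists : exists K : R, 0 < K /\
  forall x t u v, t0 g <= t <= theta g -> P u -> Q v ->
    enorm (f t x u v) <= K * (1 + enorm x).
Proof.
have [K K0 hK] := dyn_sublinear hg; exists (K + 1); split; first lra.
move=> x t u v tT Pu Qv.
have := hK x t u v _ Pu Qv; rewrite /= in_itv/= => /(_ tT).
by have := enorm_ge0 x; nra.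
Qed.

Definition growth_rate : R := projT1 (cid growth_rate_exists).
Local Notation K := growth_rate.

Lemma growth_rate_gt0 : 0 < K. Proof. by rewrite /K; case: cid => ? []. Qed.
Let K0 := growth_rate_gt0.

Lemma dyn_growth x t u v : t0 g <= t <= theta g -> P u -> Q v ->
  enorm (f t x u v) <= K * (1 + enorm x).
Proof. by rewrite /K; case: cid => k [k0 h]; exact: h. Qed.

Lemma init_bound_exists : exists B : R, forall z, G0 g z -> enorm z <= B.
Proof.
have := G0_compact hg => /compact_bounded[M [_ hM]].
exists (n%:R * (`|M| + 1)) => z Gz; apply: (le_trans (enorm_le_norm z)).
by rewrite ler_wpM2l//; apply: (hM (`|M| + 1)) => //; have := ler_norm M; lra.
Qed.

Definition init_bound : R := projT1 (cid init_bound_exists).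
Local Notation B0 := init_bound.

Lemma G0_bounded z : G0 g z -> enorm z <= B0.
Proof. by rewrite /B0; case: cid => ? h /=; exact: h. Qed.

Definition reach_radius : R := (1 + B0) * expR (K * (theta g - t0 g)).
Local Notation Rb := reach_radius.

(** A Lipschitz constant on a ball: near the diagonal it comes from finitely
    many neighborhoods, away from it from the boundedness of the dynamics. *)
Lemma lip_const_exists : exists L : R, 0 < L /\
  forall x y t u v, t0 g <= t <= theta g -> P u -> Q v ->
    1 + enorm x <= Rb -> 1 + enorm y <= Rb ->
    enorm (f t x u v - f t y u v) <= L * enorm (x - y).
Proof.
have /compact_near_coveringP cB := @compact_enorm_ball R n (Rb - 1).
pose Pk (k : nat) (x : 'rV[R]_n) := forall y t u v, enorm (x - y) < k.+1%:R^-1 ->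
  t0 g <= t <= theta g -> P u -> Q v ->
  enorm (f t x u v - f t y u v) <= k%:R * enorm (x - y).
have : \forall k \near \oo, [set x : 'rV[R]_n | enorm x <= Rb - 1] `<=` Pk k.
  apply: cB => x _.
  have [L0 [N /nbhs_ballP[r /= r0 rN] hL]] := dyn_locally_lipschitz hg x.
  have r2 : 0 < r / 2 by rewrite divr_gt0.
  near=> x' k => y t u v x'y tT Pu Qv.
  have xx' : enorm (x - x') < r / 2 by near: x'; exact: enorm_ball.
  have kr : k.+1%:R^-1 < r / 2.
    by near: k; exact: (near_infty_natSinv_lt (PosNum r2)).
  have kL : n%:R * `|L0| <= k%:R by near: k; exact: nbhs_infty_ger.
  have Nx' : N x' by apply: rN; apply: ball_enorm; lra.
  have Ny : N y.
    apply: rN; apply: ball_enorm.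
    by have := lt_trans x'y kr; have := ler_distD_enorm x' x y; lra.
  have := hL t u v; rewrite /= in_itv/= => /(_ tT Pu Qv (x', y) (conj Nx' Ny)) /= h.
  apply: (le_trans (enorm_le_norm _)).
  apply: (@le_trans _ _ (n%:R * (`|L0| * enorm (x' - y)))).
    rewrite ler_wpM2l// (le_trans h)// (@le_trans _ _ (`|L0| * `|x' - y|))//.
      by rewrite ler_wpM2r// ler_norm.
    by rewrite ler_wpM2l// norm_le_enorm.
  by rewrite mulrA ler_wpM2r// enorm_ge0.
move=> H; near \oo => k.
have hk : [set x : 'rV[R]_n | enorm x <= Rb - 1] `<=` Pk k by near: k.
exists (k%:R + 2 * (K * `|Rb|) * k.+1%:R + 1).
have k0 : 0 <= k%:R :> R by [].
have k1 : 0 < k.+1%:R :> R by [].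
have K0' := ltW K0; have KR : 0 <= K * `|Rb| by rewrite mulr_ge0.
have Kk : 0 <= K * `|Rb| * k.+1%:R by rewrite mulr_ge0// ltW.
split; first lra.
move=> x y t u v tT Pu Qv xR yR.
have d0 := enorm_ge0 (x - y).
have [xy|xy] := ltP (enorm (x - y)) (k.+1%:R^-1).
  have := hk x _ y t u v xy tT Pu Qv; rewrite /= => /(_ ltac:(lra)) h.
  by apply: (le_trans h); nra.
have {}xy : 1 <= k.+1%:R * enorm (x - y).
  by have := ler_wpM2l (ltW k1) xy; rewrite mulfV ?gt_eqF.
apply: (le_trans (ler_enormD _ _)); rewrite enormN.
have hx := dyn_growth x tT Pu Qv; have hy := dyn_growth y tT Pu Qv.
have RR := ler_norm Rb.
have : K * (1 + enorm x) <= K * `|Rb| by rewrite ler_wpM2l//; lra.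
have : K * (1 + enorm y) <= K * `|Rb| by rewrite ler_wpM2l//; lra.
have : K * `|Rb| <= K * `|Rb| * (k.+1%:R * enorm (x - y)) by rewrite ler_peMr.
by nra.
Unshelve. all: by end_near. Qed.

Definition lip_const : R := projT1 (cid lip_const_exists).
Local Notation L := lip_const.

Lemma lip_const_gt0 : 0 < L. Proof. by rewrite /L; case: cid => ? []. Qed.
Let L0 := lip_const_gt0.

Lemma dyn_lip x y t u v : t0 g <= t <= theta g -> P u -> Q v ->
  1 + enorm x <= Rb -> 1 + enorm y <= Rb ->
  enorm (f t x u v - f t y u v) <= L * enorm (x - y).
Proof. by rewrite /L; case: cid => k [k0 h]; exact: h. Qed.

Definition speed : R := K * Rb.

Lemma B0_ge0 : 0 <= B0.
Proof.
by have [z Gz] := G0_nonempty hg; apply: le_trans (G0_bounded Gz); exact: enorm_ge0.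
Qed.

Lemma Rb_ge1 : 1 <= Rb.
Proof.
have := B0_ge0; have : 1 <= expR (K * (theta g - t0 g)).
  rewrite (le_trans _ (expR_ge1Dx _))// lerDl mulr_ge0 ?subr_ge0 ?ltW//.
  exact: t0_lt_theta hg.
by rewrite /Rb; nra.
Qed.

Lemma speed_ge0 : 0 <= speed.
Proof. by have := Rb_ge1; rewrite /speed => ?; rewrite mulr_ge0 ?ltW//; lra. Qed.

(** A growing ball that no solution leaves, so that the same Lipschitz constant
    serves for all solutions, wherever they start. *)
Definition reach (t : R) (z : 'rV[R]_n) : Prop :=
  1 + enorm z <= (1 + B0) * expR (K * (t - t0 g)).

Lemma reach_init z : G0 g z -> reach (t0 g) z.
Proof. by move=> /G0_bounded; rewrite /reach subrr mulr0 expR0 mulr1 lerD2l. Qed.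

Lemma reach_ball t z : t <= theta g -> reach t z -> 1 + enorm z <= Rb.
Proof.
move=> tt h; apply: (le_trans h); rewrite ler_wpM2l//; first by have := B0_ge0; lra.
by rewrite ler_expR ler_wpM2l ?lerB// ltW.
Qed.

Lemma velocity_bound a b x u v s : t0 g <= a -> b <= theta g ->
  admissible a b u v -> a <= s <= b ->
  enorm (velocity x u v s) <= K * (1 + enorm (x s)).
Proof.
by move=> ta bt [_ _ Pu Qv] sab; apply: dyn_growth; [lra|exact: Pu|exact: Qv].
Qed.

Lemma Cts_bounded m a b (x : R -> 'rV[R]_m) : Cts a b x ->
  exists B, forall t, a <= t <= b -> enorm (x t) <= B.
Proof.
move=> cx; have [ab|ba] := leP a b; last by exists 0 => t; lra.
have cn : {within `[a, b], continuous (fun t => enorm (x t))}.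
  move=> t; have ce : {for x t, continuous (@enorm R m)} by exact: enorm_continuous.
  exact: continuous_comp (cx t) ce.
have [c _ hc] := EVT_max ab cn.
by exists (enorm (x c)) => t tab; apply: hc; rewrite in_itv.
Qed.

Lemma solution_growth a b z u v x : t0 g <= a -> b <= theta g ->
  admissible a b u v -> solution g a b z u v x ->
  forall t, a <= t <= b -> 1 + enorm (x t) <= (1 + enorm z) * expR (K * (t - a)).
Proof.
move=> ta bt ad /[dup] sx /solutionP[cx h] t tab.
have [B hB] := Cts_bounded cx.
have me : mf a b (fun t => 1 + enorm (x t)).
  apply: measurable_funD; first exact: measurable_cst.
  by apply: mf_enorm => k; apply: mf_continuous; exact: within_continuous_coord.
apply: (@Gronwall _ a b (1 + enorm z) K (1 + B) (fun t => 1 + enorm (x t))) => //.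
- by have := enorm_ge0 z; lra.
- apply: (ig_bounded me (M := 1 + B)) => s /hB.
  by rewrite ger0_norm; have := enorm_ge0 (x s); lra.
- by move=> s /hB; have := enorm_ge0 (x s); lra.
- move=> s sab; have [ih ->] := h s sab.
  rewrite -addrA lerD2l (le_trans (ler_enormD _ _))// lerD2l.
  have ie : ig a s (fun t => 1 + enorm (x t)).
    apply: (ig_bounded (mf_sub (lexx a) _ me) (M := 1 + B)); first lra.
    move=> r sar; have /hB : a <= r <= b by lra.
    by rewrite ger0_norm; have := enorm_ge0 (x r); lra.
  rewrite -JZ//; apply: enorm_vJ_le => //; first exact: igZ.
  by move=> r sar; apply: (velocity_bound _ ta bt ad); lra.
Qed.

Lemma solution_reach a b z u v x : t0 g <= a -> b <= theta g ->
  admissible a b u v -> solution g a b z u v x -> reach a z ->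
  forall t, a <= t <= b -> reach t (x t).
Proof.
move=> ta bt ad sx rz t tab; rewrite /reach.
apply: (le_trans (solution_growth ta bt ad sx tab)).
have -> : K * (t - t0 g) = K * (a - t0 g) + K * (t - a) by ring.
by rewrite expRD mulrA ler_wpM2r// expR_ge0.
Qed.

Lemma solution_lip a b z u v x : t0 g <= a -> b <= theta g ->
  admissible a b u v -> solution g a b z u v x -> reach a z ->
  lip_on a b speed x.
Proof.
move=> ta bt ad sx rz.
have key s t : a <= s -> s <= t -> t <= b -> enorm (x t - x s) <= speed * (t - s).
  move=> as_ st tb; have [ih ->] := solution_incr sx as_ st tb.
  rewrite addrC addKr; apply: enorm_vJ_le_cst => // r str.
  have rab : a <= r <= b by lra.
  apply: (le_trans (velocity_bound _ ta bt ad rab)).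
  rewrite ler_wpM2l ?(ltW K0)//; apply: (@reach_ball r); first lra.
  exact: (solution_reach ta bt ad sx rz).
move=> s t sab tab; have [st|ts] := leP s t.
  by rewrite ger0_norm ?subr_ge0//; apply: key; lra.
have := key t s; rewrite enormB distrC ger0_norm; last by rewrite subr_ge0 ltW.
by case/andP: sab => _ sb; case/andP: tab => at_ _; apply=> //; exact: ltW.
Qed.

Lemma defect_measurable a b x u v u' v' : t0 g <= a -> b <= theta g ->
  admissible a b u v -> admissible a b u' v' -> Cts a b x ->
  mf a b (fun s => enorm (velocity x u v s - velocity x u' v' s)).
Proof.
move=> ta bt ad ad' cx; apply: mf_enorm => k.
have -> : (fun s => (velocity x u v s - velocity x u' v' s) ord0 k) =
  (fun s => velocity x u v s ord0 k - velocity x u' v' s ord0 k).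
  by apply/funext => s; rewrite !mxE.
by apply: measurable_funB; exact: velocity_measurable.
Qed.

Lemma defect_ig a b x u v u' v' : t0 g <= a -> b <= theta g ->
  admissible a b u v -> admissible a b u' v' -> Cts a b x ->
  (forall t, a <= t <= b -> reach t (x t)) ->
  ig a b (fun s => enorm (velocity x u v s - velocity x u' v' s)).
Proof.
move=> ta bt ad ad' cx rx.
apply: (ig_bounded (defect_measurable ta bt ad ad' cx) (M := 2 * speed)) => s sab.
rewrite ger0_norm ?enorm_ge0// (le_trans (ler_enormD _ _))// enormN.
have h : K * (1 + enorm (x s)) <= speed.
  by rewrite ler_wpM2l ?(ltW K0)//; apply: (@reach_ball s); [lra|exact: rx].
have := velocity_bound x ta bt ad sab; have := velocity_bound x ta bt ad' sab.
by lra.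
Qed.

(** The velocities of [u, v] and [u', v'] are compared along the same path [x]. *)
Lemma solution_compare a b z z' u v u' v' x x' : t0 g <= a -> b <= theta g ->
  admissible a b u v -> admissible a b u' v' ->
  solution g a b z u v x -> solution g a b z' u' v' x' ->
  reach a z -> reach a z' ->
  forall t, a <= t <= b -> enorm (x t - x' t) <=
   (enorm (z - z') + J a b (fun s => enorm (velocity x u v s - velocity x u' v' s)))
     * expR (L * (t - a)).
Proof.
move=> ta bt ad ad' sx sx' rz rz'.
have cx := solution_Cts sx; have cx' := solution_Cts sx'.
have rx := solution_reach ta bt ad sx rz.
have rx' := solution_reach ta bt ad' sx' rz'.
set phi := fun s => enorm (velocity x u v s - velocity x u' v' s).
have iphi : ig a b phi by exact: defect_ig.
have Rb1 := Rb_ge1.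
have e2 t : a <= t <= b -> 0 <= enorm (x t - x' t) <= 2 * Rb.
  move=> tab; rewrite enorm_ge0/= (le_trans (ler_enormD _ _))// enormN.
  have := @reach_ball t _ ltac:(lra) (rx t tab).
  by have := @reach_ball t _ ltac:(lra) (rx' t tab); lra.
have ie : ig a b (fun t => enorm (x t - x' t)).
  apply: (@ig_bounded _ _ _ _ (2 * Rb)).
    apply: mf_enorm => k.
    have -> : (fun t => (x t - x' t) ord0 k) = (fun t => x t ord0 k - x' t ord0 k).
      by apply/funext => s; rewrite !mxE.
    apply: measurable_funB; apply: mf_continuous; exact: within_continuous_coord.
  by move=> s /e2 /andP[? ?]; rewrite ger0_norm.
apply: (@Gronwall _ a b _ L (2 * Rb) (fun t => enorm (x t - x' t))) => //.
  by rewrite addr_ge0 ?enorm_ge0//; apply: J_ge0 => s _; exact: enorm_ge0.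
move=> t tab.
have /solutionP[_ hx] := sx; have [i1 ->] := hx t tab.
have /solutionP[_ hx'] := sx'; have [i2 ->] := hx' t tab.
have -> : z + vJ a t (velocity x u v) - (z' + vJ a t (velocity x' u' v')) =
  z - z' + (vJ a t (velocity x u v) - vJ a t (velocity x' u' v')).
  by rewrite opprD addrACA.
rewrite (le_trans (ler_enormD _ _))// -addrA lerD2l -vJB//.
have ip : ig a t phi by apply: (ig_sub (lexx a) _ iphi); lra.
have ied : ig a t (fun t => enorm (x t - x' t)).
  by apply: (ig_sub (lexx a) _ ie); lra.
apply: (@le_trans _ _ (J a t (fun s => phi s + L * enorm (x s - x' s)))).
  apply: enorm_vJ_le; [exact: vigB|apply: igD => //; exact: igZ|].
  move=> s sat; have sab : a <= s <= b by lra.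
  rewrite (le_trans (ler_distD_enorm (velocity x u' v' s) _ _))// lerD2l.
  have [_ _ Pu Qv] := ad'; apply: dyn_lip; [lra|exact: Pu|exact: Qv| |].
    by apply: (@reach_ball s); [lra|exact: rx].
  by apply: (@reach_ball s); [lra|exact: rx'].
rewrite JD//; last exact: igZ.
rewrite JZ// lerD2r.
rewrite (@J_split _ a t b phi)//; [|lra..].
by rewrite lerDl; apply: J_ge0 => s _; exact: enorm_ge0.
Qed.

Lemma solution_unique a b z u v u' v' x x' : t0 g <= a -> b <= theta g ->
  admissible a b u v -> admissible a b u' v' ->
  solution g a b z u v x -> solution g a b z u' v' x' -> reach a z ->
  (forall t, a <= t < b -> u t = u' t /\ v t = v' t) ->
  forall t, a <= t <= b -> x t = x' t.
Proof.
move=> ta bt ad ad' sx sx' rz e t tab.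
have := solution_compare ta bt ad ad' sx sx' rz rz tab.
rewrite J_ae0; first last.
- by move=> s /e[us vs]; rewrite /velocity us vs subrr enorm0.
- by apply: defect_measurable => //; exact: solution_Cts sx.
rewrite subrr enorm0 addr0 mul0r => h.
by apply/eqP; rewrite -subr_eq0 (enorm_le0 h).
Qed.

Definition reaches (a b : R) (x : R -> 'rV[R]_n) : Prop :=
  forall t, a <= t <= b -> reach t (x t).

Section Picard.
Variables (a b : R) (z : 'rV[R]_n) (u : R -> 'rV[R]_p) (v : R -> 'rV[R]_q).
Hypotheses (ta : t0 g <= a) (bt : b <= theta g).
Hypothesis ad : admissible a b u v.
Hypothesis rz : reach a z.

Fixpoint picard (m : nat) : R -> 'rV[R]_n :=
  if m is m'.+1 then fun t => z + vJ a t (velocity (picard m') u v) else cst z.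

Let reaches_ball x t : reaches a b x -> a <= t <= b -> 1 + enorm (x t) <= Rb.
Proof. by have [ta' bt'] := conj ta bt; move=> rx tab; apply: (@reach_ball t); [lra|exact: rx]. Qed.

Let velocity_vig x s t : Cts a b x -> reaches a b x -> a <= s -> t <= b ->
  vig s t (velocity x u v).
Proof.
have [ta' bt'] := conj ta bt.
move=> cx rx as_ tb; apply: (vig_sub as_ tb).
apply: (vig_bounded (M := speed)) => [k|r rab]; first exact: velocity_measurable.
apply: (le_trans (velocity_bound x ta bt ad rab)).
by rewrite ler_wpM2l ?(ltW K0)// reaches_ball.
Qed.

Let integral_lip x : Cts a b x -> reaches a b x ->
  lip_on a b speed (fun t => z + vJ a t (velocity x u v)).
Proof.
have [ta' bt'] := conj ta bt.
move=> cx rx.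
have key s t : a <= s -> s <= t -> t <= b ->
    enorm (z + vJ a t (velocity x u v) - (z + vJ a s (velocity x u v))) <= speed * (t - s).
  move=> as_ st tb; rewrite (vJ_split as_ st); last by apply: velocity_vig => //; lra.
  rewrite opprD addrACA subrr add0r addrC addKr.
  apply: enorm_vJ_le_cst => //; first by apply: velocity_vig.
  move=> r rst; have rab : a <= r <= b by lra.
  apply: (le_trans (velocity_bound x ta bt ad rab)).
  by rewrite ler_wpM2l ?(ltW K0)// reaches_ball.
move=> s t sab tab; have [st|ts] := leP s t.
  by rewrite ger0_norm ?subr_ge0//; apply: key; lra.
have := key t s; rewrite enormB distrC ger0_norm; last by rewrite subr_ge0 ltW.
by case/andP: sab => _ sb; case/andP: tab => at_ _; apply=> //; exact: ltW.
Qed.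

Let picard_reaches m : Cts a b (picard m) /\ reaches a b (picard m).
Proof.
have [ta' bt'] := conj ta bt.
have E t : a <= t -> (1 + B0) * expR (K * (t - t0 g)) =
    (1 + B0) * expR (K * (a - t0 g)) * expR (K * (t - a)).
  by move=> _; rewrite -mulrA -expRD; congr (_ * expR _); ring.
elim: m => [|m [cm rm]] /=.
  split; first by apply: continuous_subspaceT => x; exact: cvg_cst.
  move=> t tab; rewrite /reach E; last lra.
  apply: (le_trans rz); rewrite ler_peMr//.
    by rewrite mulr_ge0 ?expR_ge0//; have := B0_ge0; lra.
  rewrite (le_trans _ (expR_ge1Dx _))// lerDl mulr_ge0 ?(ltW K0)//; lra.
split; first by apply: (@lip_on_Cts _ _ _ _ speed); exact: integral_lip.
move=> t tab; rewrite /reach E; last lra.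
set A := (1 + B0) * expR (K * (a - t0 g)).
apply: (@le_trans _ _ (A + K * (A * ((expR (K * (t - a)) - 1) / K)))); last first.
  by rewrite [K * _](_ : _ = A * (expR (K * (t - a)) - 1)); [lra|field; rewrite gt_eqF].
have : enorm (vJ a t (velocity (picard m) u v)) <=
    K * (A * ((expR (K * (t - a)) - 1) / K)).
  rewrite -J_expR ?(growth_rate_gt0)//; last lra.
  rewrite -(JZ A); last exact: ig_expR.
  rewrite -(JZ K); last by apply: igZ; exact: ig_expR.
  apply: enorm_vJ_le; [by apply: velocity_vig => //; lra|by do 2 apply: igZ; exact: ig_expR|].
  move=> s sat; have sab : a <= s <= b by lra.
  apply: (le_trans (velocity_bound _ ta bt ad sab)).
  rewrite ler_wpM2l ?(ltW K0)//; have := rm s sab; rewrite /reach E//; lra.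
have := ler_enormD z (vJ a t (velocity (picard m) u v)).
by have := rz; rewrite /reach -/A; lra.
Qed.

Let velocity_lip x y s : reaches a b x -> reaches a b y -> a <= s <= b ->
  enorm (velocity x u v s - velocity y u v s) <= L * enorm (x s - y s).
Proof.
have [ta' bt'] := conj ta bt.
move=> rx ry sab; have [_ _ Pu Qv] := ad.
by apply: dyn_lip; [lra|exact: Pu|exact: Qv|exact: reaches_ball..].
Qed.

(** Relative to the weight [expR (2 * L * (t - a))] each iteration halves the
    distance, whatever the length of the interval. *)
Let picard_contracts m t : a <= t <= b ->
  enorm (picard m.+1 t - picard m t) <= 2 * Rb / 2 ^+ m * expR (2 * L * (t - a)).
Proof.
have [ta' bt'] := conj ta bt.
elim: m t => [|m IH] t tab.
  have := reaches_ball (picard_reaches 1).2 tab.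
  have := reaches_ball (picard_reaches 0).2 tab.
  have := ler_enormD (picard 1 t) (- picard 0 t); rewrite enormN => h1 h2 h3.
  rewrite expr0 divr1 (@le_trans _ _ (2 * Rb))//; first lra.
  rewrite ler_peMr//; first by have := Rb_ge1; lra.
  rewrite (le_trans _ (expR_ge1Dx _))// lerDl mulr_ge0 ?mulr_ge0 ?(ltW L0)//; lra.
have [c1 r1] := picard_reaches m.+1; have [c0 r0] := picard_reaches m.
have -> : picard m.+2 t - picard m.+1 t =
    vJ a t (fun s => velocity (picard m.+1) u v s - velocity (picard m) u v s).
  rewrite vJB; [|by apply: velocity_vig => //; lra..].
  by rewrite [picard m.+2 t]/= [X in _ - X]/= opprD addrACA subrr add0r.
set D := 2 * Rb / 2 ^+ m.
have D0 : 0 <= D by rewrite divr_ge0 ?exprn_ge0//; have := Rb_ge1; lra.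
have L2 : 0 < 2 * L by rewrite mulr_gt0.
apply: (@le_trans _ _ (J a t (fun s => L * (D * expR (2 * L * (s - a)))))).
  apply: enorm_vJ_le.
  - by apply: vigB; apply: velocity_vig => //; lra.
  - by do 2 apply: igZ; exact: ig_expR.
  - move=> s sat; have sab : a <= s <= b by lra.
    apply: (le_trans (velocity_lip r1 r0 sab)).
    by rewrite ler_wpM2l ?(ltW L0)//; exact: IH.
rewrite JZ; last by apply: igZ; exact: ig_expR.
rewrite JZ; last exact: ig_expR.
rewrite J_expR//; last lra.
have -> : 2 * Rb / 2 ^+ m.+1 = D / 2.
  by rewrite /D exprS; field; rewrite expf_neq0.
have -> : L * (D * ((expR (2 * L * (t - a)) - 1) / (2 * L))) =
    D / 2 * (expR (2 * L * (t - a)) - 1) by field; rewrite gt_eqF.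
by rewrite mulrBr mulr1 gerBl divr_ge0.
Qed.

(** The iterates converge; taking the limit along an ultrafilter gives at once
    a uniform limit with the same Lipschitz constant. *)
Lemma solution_exists : exists x, solution g a b z u v x.
Proof.
have [ta' bt'] := conj ta bt.
have [F [FU Foo]] := @ultraFilterLemma nat \oo _.
have PF : ProperFilter F := ultra_proper.
have pB k t : a <= t <= b -> enorm (picard k t) <= Rb.
  by move=> tab; have := reaches_ball (picard_reaches k).2 tab; lra.
have pL k s t : a <= s <= b -> a <= t <= b ->
    enorm (picard k t - picard k s) <= speed * `|t - s|.
  case: k => [|k] sab tab; last first.
    by have [ck rk] := picard_reaches k; exact: (integral_lip ck rk).
  by rewrite subrr enorm0 mulr_ge0// speed_ge0.
have [xL xF] := ulim_uniform FU speed_ge0 pB pL.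
pose x t := ulim F (picard^~ t).
have cx : Cts a b x by apply: (@lip_on_Cts _ _ _ _ speed) => s t; exact: xL.
have rx : reaches a b x.
  move=> t tab; apply/ler_addgt0Pr => e e0; near F => k.
  have h : forall t, a <= t <= b -> enorm (x t - picard k t) < e by near: k; exact: xF.
  have := h t tab; have := (picard_reaches k).2 t tab; rewrite /reach.
  by have := ler_enormB (x t) (picard k t); lra.
exists x; apply/solutionP; split=> // t tab.
have ix : vig a t (velocity x u v) by apply: velocity_vig => //; lra.
split=> //; apply/eqP; rewrite -subr_eq0; apply/eqP/enorm_le0.
apply/ler_addgt0Pr => e e0; rewrite add0r.
set W := expR (2 * L * (b - a)).
have C0 : 0 < 1 + 2 * Rb * W + L * (b - a).
  have := Rb_ge1; have : 0 <= W by exact: expR_ge0.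
  have : 0 <= L * (b - a) by rewrite mulr_ge0 ?(ltW L0)//; lra.
  by nra.
set d := e / (1 + 2 * Rb * W + L * (b - a)).
have d0 : 0 < d by rewrite divr_gt0.
near F => k.
have xk s : a <= s <= b -> enorm (x s - picard k s) < d.
  by move: s; near: k; exact: xF.
have kd : 1 / 2 ^+ k < d :> R.
  by near: k; apply: Foo; exact: (near_infty_natSinv_expn_lt (PosNum d0)).
have [ck rk] := picard_reaches k.
have ik : vig a t (velocity (picard k) u v) by apply: velocity_vig => //; lra.
have -> : x t - (z + vJ a t (velocity x u v)) =
   (x t - picard k t) + (picard k t - picard k.+1 t) +
   (vJ a t (velocity (picard k) u v) - vJ a t (velocity x u v)).
  by rewrite [picard k.+1 t]/= !opprD !addrA !subrK.
have h1 := xk t tab.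
have h2 : enorm (picard k t - picard k.+1 t) <= 2 * Rb * W * d.
  rewrite enormB (le_trans (picard_contracts k tab))//.
  have -> : 2 * Rb / 2 ^+ k * expR (2 * L * (t - a)) =
     (2 * Rb) * (expR (2 * L * (t - a)) * (1 / 2 ^+ k)) by rewrite mul1r; ring.
  have -> : 2 * Rb * W * d = 2 * Rb * (W * d) by ring.
  rewrite ler_wpM2l//; first by have := Rb_ge1; lra.
  apply: ler_pM; rewrite ?expR_ge0 ?(ltW kd) ?divr_ge0 ?exprn_ge0//.
  rewrite ler_expR ler_wpM2l ?mulr_ge0 ?(ltW L0)//; lra.
have h3 : enorm (vJ a t (velocity (picard k) u v) - vJ a t (velocity x u v)) <=
    L * (b - a) * d.
  rewrite -vJB//; apply: (@le_trans _ _ (L * d * (t - a))); last first.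
    have -> : L * (b - a) * d = L * d * (b - a) by ring.
    by apply: ler_wpM2l; [rewrite mulr_ge0// ltW|lra].
  apply: enorm_vJ_le_cst; [lra|exact: vigB|] => s sat.
  have sab : a <= s <= b by lra.
  apply: (le_trans (velocity_lip rk rx sab)).
  by rewrite ler_wpM2l ?(ltW L0)// enormB ltW// xk.
have -> : e = d + 2 * Rb * W * d + L * (b - a) * d.
  by rewrite /d; field; rewrite gt_eqF.
rewrite (le_trans (ler_enormD _ _))//.
have := ler_enormD (x t - picard k t) (picard k t - picard k.+1 t); lra.
Unshelve. all: by end_near. Qed.

End Picard.

End Dynamics.

(** * Partitions and motions *)

Lemma restrict_eq (R : realType) m (x y : R -> 'rV[R]_m) (A : set R) :
  (forall t, A t -> x t = y t) -> x \_ A = y \_ A.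
Proof.
by move=> h; apply/funext => t; rewrite !patchE; case: ifPn => // /set_mem /h.
Qed.

Lemma restrict_in (R : realType) m (x : R -> 'rV[R]_m) a b t :
  a <= t <= b -> (x \_ `[a, b]) t = x t.
Proof. by move=> tab; rewrite patchE ifT// inE/= in_itv. Qed.

Section Partitions.
Variables (R : realType) (n p q : nat) (g : game R n p q).
Hypothesis hg : standing_assumptions g.
Local Notation tau := (tau g).
Implicit Types (D : seq R).

Lemma tau0 D : tau D 0 = t0 g. Proof. by []. Qed.

Lemma tau_over D i : Defs.partition g D -> (size D <= i)%N -> tau D i = theta g.
Proof.
move=> [_ /eqP e]; rewrite leq_eqVlt => /orP[/eqP<-|si].
  by rewrite -[RHS]e (last_nth (theta g)).
by rewrite /Defs.tau nth_default.
Qed.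

Lemma tau_last D : Defs.partition g D -> tau D (size D) = theta g.
Proof. by move=> /tau_over; apply. Qed.

Lemma tau_S D i : Defs.partition g D -> (i < size D)%N -> tau D i < tau D i.+1.
Proof. by move=> [/(pathP (theta g)) h _]; exact: h. Qed.

Lemma tau_le D i j : Defs.partition g D -> (i <= j)%N -> tau D i <= tau D j.
Proof.
move=> pD; elim: j => [|j IH]; first by rewrite leqn0 => /eqP ->.
rewrite leq_eqVlt => /orP[/eqP->//|/IH ij]; apply: (le_trans ij).
have [jD|Dj] := ltnP j (size D); first exact/ltW/tau_S.
by rewrite !tau_over// leqW.
Qed.

Lemma tau_in D i : Defs.partition g D -> t0 g <= tau D i <= theta g.
Proof.
move=> pD; rewrite -{1}(tau0 D) tau_le//=.
have [iD|Di] := leqP i (size D); first by rewrite -(tau_last pD) tau_le.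
by rewrite tau_over// ltnW.
Qed.

Lemma partition_size_gt0 D : Defs.partition g D -> (0 < size D)%N.
Proof.
move=> pD; rewrite lt0n; apply/eqP => /size0nil D0.
rewrite D0 in pD; have E : t0 g = theta g := tau_last pD.
by have := t0_lt_theta hg; rewrite E ltxx.
Qed.

Lemma tau_locate D t : Defs.partition g D -> t0 g <= t < theta g ->
  exists2 i, (i < size D)%N & tau D i <= t < tau D i.+1.
Proof.
move=> pD /andP[tt tth].
have ex : exists i, t < tau D i by exists (size D); rewrite tau_last.
case: (ex_minnP ex) => -[|i] ti hi; first by move: ti; rewrite tau0 ltNge tt.
have ti' : tau D i <= t.
  by rewrite leNgt; apply/negP => /hi; rewrite ltnn.
exists i; last by rewrite ti'.
rewrite ltnNge; apply/negP => Di.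
by move: ti'; rewrite tau_over// leNgt tth.
Qed.

Lemma tau_step_le D i : (i < size D)%N -> tau D i.+1 - tau D i <= Dmax g D.
Proof.
move=> iD; apply: (@le_bigmax_seq _ _ _ _ 0 i.+1 xpredT (fun i => tau D i - tau D i.-1)) => //.
by rewrite mem_index_iota ltnS.
Qed.

Lemma Dmax_le D h : 0 <= h -> (forall i, (i < size D)%N -> tau D i.+1 - tau D i <= h) ->
  Dmax g D <= h.
Proof.
move=> h0 H; rewrite /Dmax big_seq_cond; apply: bigmax_le => // i.
by rewrite mem_index_iota andbT => /andP[i0 iD]; have := H i.-1; rewrite prednK//; exact.
Qed.

Lemma Dmax_ge0 D : 0 <= Dmax g D.
Proof. by rewrite /Dmax; apply: bigmax_ge_id. Qed.

Lemma fine_partition h : 0 < h -> exists2 D, Defs.partition g D & Dmax g D <= h.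
Proof.
move=> h0; have tt := t0_lt_theta hg.
have [k hk] : exists k, (theta g - t0 g) / h < k%:R.
  exists (Num.truncn ((theta g - t0 g) / h)).+1.
  exact: truncnS_gt.
have l0 : 0 < theta g - t0 g by rewrite subr_gt0.
have k0 : 0 < k%:R :> R by apply: lt_trans hk; rewrite divr_gt0.
have kn0 : (0 < k)%N by rewrite -(ltr0n R).
pose d := (theta g - t0 g) / k%:R.
have d0 : 0 < d by rewrite divr_gt0.
pose D := [seq t0 g + d * i%:R | i <- iota 1 k].
have sD : size D = k by rewrite size_map size_iota.
have tD i : (i <= k)%N -> tau D i = t0 g + d * i%:R.
  case: i => [_|i ik]; first by rewrite tau0 mulr0 addr0.
  by rewrite /Defs.tau /= (nth_map 0%N) ?size_iota// nth_iota// add1n.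
have tS i : (i < k)%N -> tau D i.+1 - tau D i = d.
  by move=> ik; rewrite !tD ?(ltnW ik)// -natr1; ring.
exists D; last first.
  apply: Dmax_le => [|i]; first exact: ltW.
  rewrite sD => /tS ->; rewrite ler_pdivrMr// mulrC -ler_pdivrMr//.
  exact: ltW.
split.
  apply/(pathP (theta g)) => i; rewrite sD => ik.
  have := tS i ik; rewrite {2}/Defs.tau => E.
  by rewrite -subr_gt0 [X in 0 < X](_ : _ = d).
rewrite (last_nth (theta g)) sD -[nth _ _ _]/(tau D k) tD//.
by apply/eqP; rewrite /d divfK ?gt_eqF// addrC subrK.
Qed.

End Partitions.

Section Motions.
Variables (R : realType) (n p q : nat) (g : game R n p q).
Hypothesis hg : standing_assumptions g.
Local Notation tau := (tau g).
Implicit Types (D : seq R).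

Lemma controls_switch s c1 c2 : controls g c1 -> controls g c2 ->
  controls g (fun t => if t < s then c1 t else c2 t).
Proof.
move=> [m1 P1] [m2 P2]; split=> [k|t tT]; last by case: ifP => _; [exact: P1|exact: P2].
have := mf_switch s (m1 k) (m2 k).
by congr mf; apply/funext => t; case: ifP.
Qed.

Lemma disturbances_switch s c1 c2 : disturbances g c1 -> disturbances g c2 ->
  disturbances g (fun t => if t < s then c1 t else c2 t).
Proof.
move=> [m1 P1] [m2 P2]; split=> [k|t tT]; last by case: ifP => _; [exact: P1|exact: P2].
have := mf_switch s (m1 k) (m2 k).
by congr mf; apply/funext => t; case: ifP.
Qed.

Lemma controls_cst u : Pset g u -> controls g (cst u).
Proof. by move=> Pu; split=> // k; exact: measurable_cst. Qed.

Lemma disturbances_cst v : Qset g v -> disturbances g (cst v).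
Proof. by move=> Qv; split=> // k; exact: measurable_cst. Qed.

Definition follows D (F : feedback R n p) (u : R -> 'rV[R]_p) (x : R -> 'rV[R]_n) m :=
  forall i, (i < m)%N -> forall t, t \in `[tau D i, tau D i.+1[ ->
    u t = F i (x \_ `[t0 g, tau D i]) t.

Lemma solution_exists_T z u v : G0 g z -> controls g u -> disturbances g v ->
  exists x, solution g (t0 g) (theta g) z u v x.
Proof.
move=> Gz cu dv; apply: (solution_exists (lexx _) (lexx _)).
  exact: controls_admissible.
exact: reach_init.
Qed.

Lemma solution_unique_T z u v u' v' x x' s : G0 g z ->
  controls g u -> disturbances g v -> controls g u' -> disturbances g v' ->
  solution g (t0 g) (theta g) z u v x -> solution g (t0 g) (theta g) z u' v' x' ->
  t0 g <= s <= theta g ->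
  (forall t, t0 g <= t < s -> u t = u' t /\ v t = v' t) ->
  forall t, t0 g <= t <= s -> x t = x' t.
Proof.
move=> Gz cu dv cu' dv' sx sx' sT e.
have tt := ltW (t0_lt_theta hg).
have ad := controls_admissible cu dv; have ad' := controls_admissible cu' dv'.
have x0 := solution_init tt sx; have x0' := solution_init tt sx'.
have [ts sth] := andP sT.
apply: (solution_unique (lexx (t0 g)) sth _ _ _ _ (reach_init hg Gz) e).
- exact: (admissible_sub (lexx _) sth ad).
- exact: (admissible_sub (lexx _) sth ad').
- by rewrite -x0; exact: (solution_sub sx).
- by rewrite -x0'; exact: (solution_sub sx').
Qed.

(** By induction over the intervals: the feedback for the next one only depends
    on the part of the motion that is already known. *)
Lemma motion_exists z D F v : G0 g z -> Defs.partition g D -> is_feedback g D F ->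
  disturbances g v -> exists x, motion g z D F v x.
Proof.
move=> Gz pD fF dv.
suff H m : (m <= size D)%N -> exists u x, [/\ controls g u,
    solution g (t0 g) (theta g) z u v x & follows D F u x m].
  by have [u [x [cu sx fx]]] := H _ (leqnn _); exists x, u.
elim: m => [_|i IH iD].
  have [u0 Pu0] := P_nonempty hg.
  have [x sx] := solution_exists_T Gz (controls_cst Pu0) dv.
  by exists (cst u0), x; split=> //; exact: controls_cst.
have [u [x [cu sx fx]]] := IH (ltnW iD).
have /andP[ti it] := tau_in i pD.
have [c cc hc] := fF i iD x (Cts_sub (lexx _) it (solution_Cts sx)).
pose u' t := if t < tau D i then u t else c t.
have cu' : controls g u' by exact: controls_switch.
have [x' sx'] := solution_exists_T Gz cu' dv.
have E t : t0 g <= t <= tau D i -> x t = x' t.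
  apply: (solution_unique_T Gz cu dv cu' dv sx sx'); first by rewrite ti it.
  by move=> s /andP[_ si]; rewrite /u' si.
exists u', x'; split=> // j; rewrite ltnS leq_eqVlt => /orP[/eqP ->|ji] t tj.
  rewrite -(@restrict_eq _ _ x x'); last by move=> s; rewrite /= in_itv/=; exact: E.
  rewrite hc// /u'; move: tj; rewrite in_itv/= => /andP[it' _].
  by rewrite ltNge it'.
rewrite -(@restrict_eq _ _ x x'); last first.
  move=> s; rewrite /= in_itv/= => /andP[ts sj]; apply: E; rewrite ts (le_trans sj)//.
  exact: tau_le (ltnW ji).
rewrite -(fx j)// /u' ifT//; move: tj; rewrite in_itv/= => /andP[_ /lt_le_trans]; apply.
exact: tau_le.
Qed.

(** On each interval the two feedbacks see the same history and give the same
    controls up to [s]; solutions are unique. *)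
Lemma motion_agree z D F F' v v' u u' x x' s : G0 g z -> Defs.partition g D ->
  controls g u -> disturbances g v -> controls g u' -> disturbances g v' ->
  solution g (t0 g) (theta g) z u v x -> solution g (t0 g) (theta g) z u' v' x' ->
  follows D F u x (size D) -> follows D F' u' x' (size D) ->
  t0 g <= s <= theta g ->
  (forall i h t, tau D i <= t < tau D i.+1 -> t <= s -> F i h t = F' i h t) ->
  (forall t, t0 g <= t <= s -> v t = v' t) ->
  (forall t, t0 g <= t <= s -> x t = x' t) /\
  (forall t, t0 g <= t <= s -> t < theta g -> u t = u' t).
Proof.
move=> Gz pD cu dv cu' dv' sx sx' fx fx' sT eF ev.
suff H i : (i <= size D)%N ->
    (forall t, t0 g <= t <= Num.min (tau D i) s -> x t = x' t) /\
    (forall t, t0 g <= t < tau D i -> t <= s -> u t = u' t).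
  have [h1 h2] := H _ (leqnn _); rewrite (tau_last pD) in h1 h2.
  split=> t tt; first by apply: h1; rewrite min_r//; lra.
  by move=> tth; apply: h2; lra.
elim: i => [_|i IH iD].
  split=> t; rewrite tau0; last first.
    by move=> /andP[t1 t2]; move: (le_lt_trans t1 t2); rewrite ltxx.
  move=> /andP[t1 t2]; have -> : t = t0 g.
    by apply/le_anti; rewrite t1 andbT (le_trans t2)// ge_min lexx.
  have tt := ltW (t0_lt_theta hg).
  by rewrite (solution_init tt sx) (solution_init tt sx').
have [h1 h2] := IH (ltnW iD).
have U t : t0 g <= t < tau D i.+1 -> t <= s -> u t = u' t.
  move=> /andP[t1 t2] ts; have [ti|it] := ltP t (tau D i); first by apply: h2; lra.
  have tI : t \in `[tau D i, tau D i.+1[ by rewrite in_itv/= it.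
  rewrite (fx i iD t tI) (fx' i iD t tI) (@restrict_eq _ _ x x').
    by apply: eF; [rewrite it|].
  move=> r; rewrite /= in_itv/= => /andP[r1 r2]; apply: h1.
  by rewrite r1 le_min r2/= (le_trans r2)// (le_trans it).
split=> //.
have ms : Num.min (tau D i.+1) s <= s by rewrite ge_min lexx orbT.
have mi : Num.min (tau D i.+1) s <= tau D i.+1 by rewrite ge_min lexx.
apply: (solution_unique_T Gz cu dv cu' dv' sx sx').
  have /andP[ti it] := tau_in i.+1 pD; rewrite le_min ti/=.
  by case/andP: sT => -> sth; exact: le_trans sth.
move=> t /andP[t1 t2]; split; first by apply: U; lra.
by apply: ev; lra.
Qed.

End Motions.

(** * Quasi-strategies and the target set *)

Section UniformTopology.
Variables (R : realType) (n : nat) (T : set R).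
Local Notation UT := {uniform` T -> 'rV[R]_n}.

Lemma uniform_nbhs_enorm (x : UT) (A : set UT) : nbhs x A <->
  exists2 e : R, 0 < e &
    forall y : R -> 'rV[R]_n, (forall t, T t -> enorm (x t - y t) < e) -> A y.
Proof.
split.
  move=> /uniform_nbhs[E [entE EA]].
  move: entE; rewrite -entourage_ballE => -[e /= e0 eE].
  exists e => // y xy; apply: EA => t Tt; apply: eE => /=.
  exact/ball_enorm/xy.
move=> [e e0 h]; apply/uniform_nbhs.
have n1 : 0 < n%:R + 1 :> R by rewrite ltr_wpDl.
exists [set xy | ball xy.1 (e / (n%:R + 1)) xy.2]; split.
  rewrite -entourage_ballE; exists (e / (n%:R + 1)) => //=.
  by rewrite divr_gt0.
move=> y /= xy; apply: h => t /xy; rewrite mx_norm_ball /ball_/= => {}xy.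
apply: (le_lt_trans (enorm_le_norm _)).
move: xy; rewrite ltr_pdivlMr// => xy; apply: le_lt_trans xy.
by rewrite mulrC ler_wpM2l// lerDl.
Qed.

Lemma uniform_closure (A : set UT) (x : UT) : closure A x <->
  forall e : R, 0 < e -> exists2 y, A y & forall t, T t -> enorm (x t - y t) < e.
Proof.
split=> [cA e e0|h B /uniform_nbhs_enorm[e e0 eB]].
  have [|y [Ay xy]] := cA [set y | forall t, T t -> enorm (x t - y t) < e].
    by apply/uniform_nbhs_enorm; exists e.
  by exists y.
by have [y Ay xy] := h e e0; exists y; split=> //; exact: eB.
Qed.

Lemma uniform_cvg (y : nat -> R -> 'rV[R]_n) (x : R -> 'rV[R]_n) :
  {uniform T, y @ \oo --> x} <->
  forall e : R, 0 < e -> \forall k \near \oo, forall t, T t -> enorm (x t - y k t) < e.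
Proof.
split=> [h e e0|h A /uniform_nbhs_enorm[e e0 eA]].
  apply: (h [set z : UT | forall t, T t -> enorm (x t - z t) < e]).
  by apply/uniform_nbhs_enorm; exists e.
by have := h e e0; apply: filterS => k; exact: eA.
Qed.

End UniformTopology.

Section Paths.
Variables (R : realType) (n p q : nat) (g : game R n p q).
Hypothesis hg : standing_assumptions g.
Local Notation a := (t0 g).
Local Notation b := (theta g).
Local Notation gamma := (cost g).

Lemma cost_ball x e : Cts a b x -> 0 < e -> exists2 d : R, 0 < d &
  forall y, Cts a b y -> (forall t, a <= t <= b -> enorm (x t - y t) < d) ->
    `|gamma x - gamma y| < e.
Proof.
move=> cx e0.
have := cost_continuous hg; move=> /subspace_continuousP/(_ x cx).
move=> /(_ _ (nbhsx_ballx (gamma x) e e0)) /uniform_nbhs_enorm[d d0 hd].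
exists d => // y cy xy; apply: (hd y) => //= t; rewrite in_itv/=; exact: xy.
Qed.

(** A compact set of paths to which every solution starting in [G0] belongs. *)
Definition good_path (x : R -> 'rV[R]_n) : Prop :=
  (forall t, a <= t <= b -> enorm (x t) <= reach_radius hg) /\ lip_on a b (speed hg) x.

Lemma good_path_Cts x : good_path x -> Cts a b x.
Proof. by move=> [_ /lip_on_Cts]. Qed.

Lemma solution_good_path z u v x : G0 g z -> controls g u -> disturbances g v ->
  solution g a b z u v x -> good_path x.
Proof.
move=> Gz cu dv sx; have ad := controls_admissible cu dv.
have rz := reach_init hg Gz; split; last exact: (solution_lip _ _ ad sx rz).
move=> t tT; have := solution_reach (lexx _) (lexx _) ad sx rz tT.
by move=> /(reach_ball (proj2 (andP tT))); lra.
Qed.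

Lemma exists_ultra : exists F : set_system nat, UltraFilter F /\ \oo `<=` F.
Proof. exact: ultraFilterLemma. Qed.

Section Limits.
Variable F : set_system nat.
Hypotheses (FU : UltraFilter F).

Definition path_lim (x : nat -> R -> 'rV[R]_n) : R -> 'rV[R]_n :=
  fun t => ulim F (x^~ t).

Lemma path_limP (x : nat -> R -> 'rV[R]_n) : (forall k, good_path (x k)) ->
  good_path (path_lim x) /\
  forall e, 0 < e -> F [set k | forall t, a <= t <= b -> enorm (path_lim x t - x k t) < e].
Proof.
move=> gx; have PF : ProperFilter F := ultra_proper.
have [xL xF] := ulim_uniform FU (speed_ge0 hg)
  (fun k => (gx k).1) (fun k s t h h' => (gx k).2 s t h h').
split=> //; split=> [t tab|s t]; last exact: xL.
apply/ler_addgt0Pr => e e0; near F => k.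
have h : forall t, a <= t <= b -> enorm (path_lim x t - x k t) < e.
  by near: k; exact: xF.
by have := h t tab; have := (gx k).1 t tab; have := ler_enormB (path_lim x t) (x k t); lra.
Unshelve. all: by end_near. Qed.

End Limits.

(** Otherwise closer and closer pairs with distant costs would converge, along
    an ultrafilter, to a path at which the cost is discontinuous. *)
Lemma cost_uniform e : 0 < e -> exists2 d : R, 0 < d &
  forall x y, good_path x -> Cts a b y ->
    (forall t, a <= t <= b -> enorm (x t - y t) < d) -> `|gamma x - gamma y| < e.
Proof.
move=> e0; apply: contrapT => no.
have ex k : exists xy : (R -> 'rV[R]_n) * (R -> 'rV[R]_n), [/\ good_path xy.1, Cts a b xy.2,
    forall t, a <= t <= b -> enorm (xy.1 t - xy.2 t) < k.+1%:R^-1 &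
    e <= `|gamma xy.1 - gamma xy.2|].
  apply: contrapT => nk; apply: no; exists k.+1%:R^-1; first by rewrite invr_gt0.
  move=> x y gx cy xy; rewrite ltNge; apply/negP => h.
  by apply: nk; exists (x, y).
have [xy hxy] := choice ex.
have [F [FU Foo]] := exists_ultra; have PF : ProperFilter F := ultra_proper.
have gx k : good_path (xy k).1 by have [] := hxy k.
have [gl cl] := path_limP FU gx.
set x := path_lim _ _ in gl cl.
have e2 : 0 < e / 2 by rewrite divr_gt0.
have [d d0 hd] := cost_ball (good_path_Cts gl) e2.
have d2 : 0 < d / 2 by rewrite divr_gt0.
near F => k.
have h1 : forall t, a <= t <= b -> enorm (x t - (xy k).1 t) < d / 2.
  by near: k; exact: cl.
have h2 : k.+1%:R^-1 < d / 2.
  by near: k; apply: Foo; exact: (near_infty_natSinv_lt (PosNum d2)).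
have [_ cy h3 h4] := hxy k.
have h5 : `|gamma x - gamma (xy k).1| < e / 2.
  by apply: hd => [|t tab]; [exact: good_path_Cts|have := h1 t tab; lra].
have h6 : `|gamma x - gamma (xy k).2| < e / 2.
  apply: hd => // t tab.
  have := ler_distD_enorm ((xy k).1 t) (x t) ((xy k).2 t).
  by have := lt_trans (h3 t tab) h2; have := h1 t tab; lra.
have : `|gamma (xy k).1 - gamma (xy k).2| <=
    `|gamma x - gamma (xy k).1| + `|gamma x - gamma (xy k).2|.
  by rewrite (distrC (gamma x) (gamma (xy k).1)); exact: ler_distD.
lra.
Unshelve. all: by end_near. Qed.

Lemma cost_bounded : exists B : R, forall x, good_path x -> `|gamma x| <= B.
Proof.
apply: contrapT => no.
have ex (k : nat) : exists x, good_path x /\ k%:R < `|gamma x|.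
  apply: contrapT => nk; apply: no; exists k%:R => x gx.
  by rewrite leNgt; apply/negP => h; apply: nk; exists x.
have [x hx] := choice ex.
have [F [FU Foo]] := exists_ultra; have PF : ProperFilter F := ultra_proper.
have [gl cl] := path_limP FU (fun k => (hx k).1).
have [d d0 hd] := cost_ball (good_path_Cts gl) ltr01.
near F => k.
have h1 : forall t, a <= t <= b -> enorm (path_lim F x t - x k t) < d.
  by near: k; exact: cl.
have h2 : `|gamma (path_lim F x)| + 1 <= k%:R.
  by near: k; apply: Foo; exact: nbhs_infty_ger.
have [gk kg] := hx k.
have := hd _ (good_path_Cts gk) h1.
have := lerB_dist (gamma (x k)) (gamma (path_lim F x)).
rewrite distrC; lra.
Unshelve. all: by end_near. Qed.

Local Notation X_q := (X_q g).

Lemma quasi_controls alpha v : quasi_strategies g alpha -> disturbances g v ->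
  controls g (alpha v).
Proof. by move=> [h _]; exact: h. Qed.

Lemma X_q_good_path z alpha x : G0 g z -> quasi_strategies g alpha ->
  X_q z alpha x -> good_path x.
Proof.
move=> Gz qa [v dv sx]; apply: (solution_good_path Gz _ dv sx).
exact: quasi_controls.
Qed.

Lemma X_q_nonempty z alpha : G0 g z -> quasi_strategies g alpha ->
  X_q z alpha !=set0.
Proof.
move=> Gz qa; have [v0 Qv0] := Q_nonempty hg.
have dv := disturbances_cst Qv0.
by have [x sx] := solution_exists_T hg Gz (quasi_controls qa dv) dv; exists x, (cst v0).
Qed.

Lemma quasi_nonempty : exists alpha, quasi_strategies g alpha.
Proof.
have [u0 Pu0] := P_nonempty hg; exists (fun=> cst u0); split=> //.
by move=> v _; exact: controls_cst.
Qed.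

Lemma Gamma_q_fin z : G0 g z -> exists r : R, Gamma_q g z = r%:E.
Proof.
move=> Gz; have [B hB] := cost_bounded.
have [al qa] := quasi_nonempty.
suff : Gamma_q g z \is a fin_num by move/fineK => <-; exists (fine (Gamma_q g z)).
rewrite fin_numElt; apply/andP; split.
  apply: (@lt_le_trans _ _ (- B)%:E); first exact: ltNyr.
  apply: le_ereal_inf_tmp => _ [al' qa' <-].
  have [x Xx] := X_q_nonempty Gz qa'.
  apply: (@le_trans _ _ (gamma x)%:E); last by apply: ereal_sup_ubound; exists x.
  by rewrite lee_fin; have := hB x (X_q_good_path Gz qa' Xx); rewrite ler_norml => /andP[].
apply: (@le_lt_trans _ _ B%:E); last exact: ltry.
apply: (@le_trans _ _ (Gamma_q_of g z al)).
  by apply: ereal_inf_lbound; exists al.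
apply: ge_ereal_sup => _ [x Xx <-]; rewrite lee_fin.
by have := hB x (X_q_good_path Gz qa Xx); rewrite ler_norml => /andP[].
Qed.

Lemma Gamma_q_of_le z alpha r : (forall x, X_q z alpha x -> gamma x <= r) ->
  (Gamma_q_of g z alpha <= r%:E)%E.
Proof. by move=> h; apply: ge_ereal_sup => _ [x Xx <-]; rewrite lee_fin; exact: h. Qed.

Lemma near_optimal_cost z delta alpha x r : near_optimal g z delta alpha ->
  Gamma_q g z = r%:E -> X_q z alpha x -> gamma x <= r + delta.
Proof.
move=> [_ h] Er Xx; rewrite -lee_fin EFinD -Er; apply: le_trans h.
by apply: ereal_sup_ubound; exists x.
Qed.

Lemma near_optimal_nonempty z delta : G0 g z -> 0 < delta ->
  exists alpha, near_optimal g z delta alpha.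
Proof.
move=> Gz d0; have [r Er] := Gamma_q_fin Gz.
have fG : Gamma_q g z \is a fin_num by rewrite Er.
have [_ [al qa <-] /ltW h] := lb_ereal_inf_adherent d0 fG.
by exists al; split.
Qed.

Lemma near_optimal_mono z d d' : d <= d' -> near_optimal g z d `<=` near_optimal g z d'.
Proof.
by move=> dd al [qa h]; split=> //; apply: (le_trans h); rewrite leeD2l ?lee_fin.
Qed.

Lemma targetP z w : target g z w <-> Cts a b w /\ forall delta e : R,
  0 < delta -> 0 < e -> exists alpha x, [/\ near_optimal g z delta alpha,
    X_q z alpha x & forall t, a <= t <= b -> enorm (w t - x t) < e].
Proof.
split=> [[cw h]|[cw h]]; split=> // d.
  move=> e d0 e0; have /uniform_closure := h d d0 => /(_ e e0) [x [al nal Xx] wx].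
  by exists al, x; split=> // t tab; apply: wx; rewrite /= in_itv.
move=> d0; apply/uniform_closure => e e0.
have [al [x [nal Xx wx]]] := h d e d0 e0.
by exists x; [exists al|move=> t; rewrite /= in_itv/=; exact: wx].
Qed.

Lemma target_good_path z w : G0 g z -> target g z w -> good_path w /\ w a = z.
Proof.
move=> Gz /targetP[_ h].
have app e : 0 < e -> exists2 x, good_path x /\ x a = z &
    forall t, a <= t <= b -> enorm (w t - x t) < e.
  move=> e0; have [al [x [[qa _] Xx wx]]] := h 1 e ltr01 e0.
  exists x => //; split; first exact: X_q_good_path Gz qa Xx.
  by case: Xx => v dv /solution_init; apply; apply/ltW/t0_lt_theta.
split; first split.
- move=> t tab; apply/ler_addgt0Pr => e e0; have [x [[xR _] _] wx] := app e e0.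
  by have := wx t tab; have := xR t tab; have := ler_enormB (w t) (x t); lra.
- move=> s t sab tab; apply/ler_addgt0Pr => e e0.
  have e2 : 0 < e / 2 by rewrite divr_gt0.
  have [x [[_ xL] _] wx] := app _ e2.
  have := wx s sab; have := wx t tab; have := xL s t sab tab.
  have := ler_distD_enorm (x t) (w t) (w s).
  by have := ler_distD_enorm (x s) (x t) (w s); rewrite (enormB (x s)); lra.
- apply/eqP; rewrite -subr_eq0; apply/eqP/enorm_le0/ler_addgt0Pr => e e0.
  have [x [_ <-] wx] := app e e0; rewrite add0r; apply/ltW/wx.
  by rewrite lexx ltW// t0_lt_theta.
Qed.

Lemma target_cost z w r : G0 g z -> Gamma_q g z = r%:E -> target g z w -> gamma w <= r.
Proof.
move=> Gz Er tw; have [gw _] := target_good_path Gz tw.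
have /targetP[_ h] := tw.
apply/ler_addgt0Pr => e e0; have e2 : 0 < e / 2 by rewrite divr_gt0.
have [d d0 hd] := cost_ball (good_path_Cts gw) e2.
have [al [x [nal Xx wx]]] := h _ _ e2 d0.
have := near_optimal_cost nal Er Xx.
have := hd x (good_path_Cts (X_q_good_path Gz nal.1 Xx)) wx.
by rewrite ltr_norml; lra.
Qed.

Lemma target_path_lim F z (x : nat -> R -> 'rV[R]_n) alpha :
  UltraFilter F -> \oo `<=` F -> G0 g z ->
  (forall k, near_optimal g z k.+1%:R^-1 (alpha k)) ->
  (forall k, X_q z (alpha k) (x k)) -> target g z (path_lim F x).
Proof.
move=> FU Foo Gz nal Xx; have PF : ProperFilter F := ultra_proper.
have gx k : good_path (x k) := X_q_good_path Gz (nal k).1 (Xx k).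
have [gl cl] := path_limP FU gx.
apply/targetP; split=> [|d e d0 e0]; first exact: good_path_Cts.
near F => k; exists (alpha k), (x k); split=> //; last by near: k; exact: cl.
apply: near_optimal_mono (nal k); apply: ltW.
by near: k; apply: Foo; exact: (near_infty_natSinv_lt (PosNum d0)).
Unshelve. all: by end_near. Qed.

(** A limit of outcomes of better and better quasi-strategies. *)
Lemma target_nonempty z : G0 g z -> target g z !=set0.
Proof.
move=> Gz; have [F [FU Foo]] := exists_ultra.
have ex k : exists ax : _ * (R -> 'rV[R]_n),
    near_optimal g z k.+1%:R^-1 ax.1 /\ X_q z ax.1 ax.2.
  have d0 : 0 < k.+1%:R^-1 :> R by rewrite invr_gt0.
  have [al nal] := near_optimal_nonempty Gz d0.
  by have [x Xx] := X_q_nonempty Gz nal.1; exists (al, x).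
have [ax hax] := choice ex.
exists (path_lim F (fun k => (ax k).2)).
by apply: (target_path_lim FU Foo Gz (fun k => (hax k).1) (fun k => (hax k).2)).
Qed.

(** Quasi-strategies do not anticipate: if the disturbance is replaced by [v]
    from the time [s] on, then their outcomes stay the same up to [s]. A limit
    of the changed outcomes is the continuation of [w] inside the target set. *)
Lemma target_stable z w s v : G0 g z -> target g z w -> a <= s <= b ->
  disturbances g v -> exists w', [/\ target g z w',
    forall t, a <= t <= s -> w' t = w t &
    forall e, 0 < e -> exists u' v' x', [/\ controls g u', disturbances g v',
      (forall t, s <= t -> v' t = v t), solution g a b z u' v' x' &
      forall t, a <= t <= b -> enorm (w' t - x' t) < e]].
Proof.
move=> Gz tw sT dv.
have [F [FU Foo]] := exists_ultra; have PF : ProperFilter F := ultra_proper.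
have /targetP[_ h] := tw.
have ex k : exists avx : _ * (R -> 'rV[R]_q) * (R -> 'rV[R]_n) * (R -> 'rV[R]_n),
  let: (al, vk, x, x') := avx in
  [/\ near_optimal g z k.+1%:R^-1 al, disturbances g vk,
    solution g a b z (al vk) vk x,
    solution g a b z (al (fun t => if t < s then vk t else v t))
       (fun t => if t < s then vk t else v t) x' &
    forall t, a <= t <= b -> enorm (w t - x t) < k.+1%:R^-1].
  have d0 : 0 < k.+1%:R^-1 :> R by rewrite invr_gt0.
  have [al [x [nal [vk dvk sx] wx]]] := h _ _ d0 d0.
  have dv' := disturbances_switch s dvk dv.
  have [x' sx'] := solution_exists_T hg Gz (quasi_controls nal.1 dv') dv'.
  by exists (al, vk, x, x').
have [avx havx] := choice ex.
pose al k := (avx k).1.1.1; pose vk k := (avx k).1.1.2.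
pose x k := (avx k).1.2; pose x' k := (avx k).2.
pose vk' k t := if t < s then vk k t else v t.
have {ex havx} H k : [/\ near_optimal g z k.+1%:R^-1 (al k), disturbances g (vk k),
    solution g a b z (al k (vk k)) (vk k) (x k),
    solution g a b z (al k (vk' k)) (vk' k) (x' k) &
    forall t, a <= t <= b -> enorm (w t - x k t) < k.+1%:R^-1].
  by have := havx k; rewrite /al /vk /x /x' /vk' /vk; case: (avx k) => [[[? ?] ?] ?].
have dvk' k : disturbances g (vk' k).
  by have [_ dvk _ _ _] := H k; exact: disturbances_switch.
have xx' k t : a <= t <= s -> x k t = x' k t.
  have [nal dvk sx sx' _] := H k.
  apply: (solution_unique_T hg Gz (quasi_controls nal.1 dvk) dvk
    (quasi_controls nal.1 (dvk' k)) (dvk' k) sx sx' sT) => r rs.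
  have E r' : a <= r' <= r -> vk k r' = vk' k r' by move=> ?; rewrite /vk' ifT//; lra.
  split; last by apply: E; lra.
  have [_ na] := nal.1.
  have rT : `[a, b]%classic r by rewrite /= in_itv/=; lra.
  have Er : {in `[a, r], vk k =1 vk' k} by move=> r'; rewrite in_itv/=; exact: E.
  by apply: (na r _ _ rT dvk (dvk' k) Er); rewrite in_itv/=; lra.
have gx' k : good_path (x' k).
  by have [nal _ _ sx' _] := H k; exact: (solution_good_path Gz (quasi_controls nal.1 (dvk' k)) (dvk' k) sx').
have [gl cl] := path_limP FU gx'.
exists (path_lim F x'); split.
- apply: (@target_path_lim F z x' al) => // k; first by have [] := H k.
  by have [_ _ _ sx' _] := H k; exists (vk' k).
- move=> t tas; apply/eqP; rewrite -subr_eq0; apply/eqP/enorm_le0/ler_addgt0Pr => e e0.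
  have tab : a <= t <= b by lra.
  have e2 : 0 < e / 2 by rewrite divr_gt0.
  near F => k.
  have h1 : forall t, a <= t <= b -> enorm (path_lim F x' t - x' k t) < e / 2.
    by near: k; exact: cl.
  have h2 : k.+1%:R^-1 < e / 2.
    by near: k; apply: Foo; exact: (near_infty_natSinv_lt (PosNum e2)).
  have [_ _ _ _ /(_ t tab) wx] := H k.
  have {}wx := lt_trans wx h2; have {}h1 := h1 t tab.
  have := ler_distD_enorm (x' k t) (path_lim F x' t) (w t).
  by rewrite -(xx' k t tas) (enormB (x k t)) in h1 *; lra.
- move=> e e0; near F => k.
  have [nal _ _ sx' _] := H k.
  exists (al k (vk' k)), (vk' k), (x' k); split=> //.
  + exact: quasi_controls nal.1 (dvk' k).
  + by move=> t st; rewrite /vk' ltNge st.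
  + by near: k; exact: cl.
Unshelve. all: by end_near. Qed.

(** A nearly optimal quasi-strategy for [z] is nearly as good for any initial
    state close to [z], because the outcomes depend on it continuously. *)
Lemma Gamma_q_usc z e : G0 g z -> 0 < e -> exists2 d : R, 0 < d &
  forall z', G0 g z' -> enorm (z - z') < d -> (Gamma_q g z' <= Gamma_q g z + e%:E)%E.
Proof.
move=> Gz e0; have e2 : 0 < e / 2 by rewrite divr_gt0.
have [r Er] := Gamma_q_fin Gz.
have [d d0 hd] := cost_uniform e2.
have [al nal] := near_optimal_nonempty Gz e2.
pose C := expR (lip_const hg * (b - a)).
have C0 : 0 < C by exact: expR_gt0.
exists (d / C) => [|z' Gz' zz']; first by rewrite divr_gt0.
apply: (@le_trans _ _ (Gamma_q_of g z' al)).
  by apply: ereal_inf_lbound; exists al => //; exact: nal.1.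
rewrite Er -EFinD; apply: Gamma_q_of_le => x' Xx'.
have [v dv sx'] := Xx'; have cv := quasi_controls nal.1 dv.
have [x sx] := solution_exists_T hg Gz cv dv.
have gx := solution_good_path Gz cv dv sx.
have gx' := solution_good_path Gz' cv dv sx'.
have Xx : X_q z al x by exists v.
have := near_optimal_cost nal Er Xx.
suff : `|gamma x - gamma x'| < e / 2 by rewrite ltr_norml; lra.
apply: hd => //; first exact: good_path_Cts.
move=> t tT; have ad := controls_admissible cv dv.
have := solution_compare (lexx _) (lexx _) ad ad sx sx' (reach_init hg Gz) (reach_init hg Gz') tT.
rewrite J_ae0 ?addr0; first last.
- by move=> s _; rewrite subrr enorm0.
- by apply: (defect_measurable hg) => //; exact: good_path_Cts.
move=> h; apply: (le_lt_trans h).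
rewrite ltr_pdivlMr// in zz'; apply: le_lt_trans zz'.
rewrite ler_wpM2l ?enorm_ge0// ler_expR ler_wpM2l ?(ltW (lip_const_gt0 hg))//; lra.
Qed.

End Paths.

(** * Extremal aiming *)

Lemma le_of_small (R : realType) (X A C : R) :
  (forall e, 0 < e <= 1 -> X <= A + e * C) -> X <= A.
Proof.
move=> h; apply/ler_addgt0Pr => d d0.
have C0 : 0 < `|C| + 1 by rewrite ltr_wpDl.
pose e := Num.min 1 (d / (`|C| + 1)).
have e0 : 0 < e <= 1 by rewrite lt_min ltr01 divr_gt0// ge_min lexx.
apply: (le_trans (h e e0)); rewrite lerD2l.
have : e * C <= e * (`|C| + 1).
  by rewrite ler_wpM2l//; [case/andP: e0 => /ltW|have := ler_norm C; lra].
have : e * (`|C| + 1) <= d by rewrite -ler_pdivlMr// ge_min lexx orbT.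
lra.
Qed.

(** The inequality may fail at the right end of the interval, where the
    controls of two consecutive feedback maps meet. *)
Lemma J_le_half (R : realType) (a b C : R) (h : R -> R) : a <= b -> ig a b h ->
  (forall s, a <= s < b -> h s <= C) -> J a b h <= C * (b - a).
Proof.
move=> ab ih hC; have iC : ig a b (fun s => h s - C) by apply: igB => //; exact: ig_cst.
pose k s := if s < b then h s - C else 0.
have mk : mf a b k by apply: mf_switch; [exact: ig_mf|exact: measurable_cst].
have ik : ig a b k.
  apply: (@le_integrable _ _ _ _ _ _ _ (fun s : lebR R => (h s - C)%:E)).
  - exact: leb_measurable_itv.
  - exact/measurable_EFinP.
  - by move=> s _; rewrite /k; case: ifP => // _; rewrite !abse_EFin lee_fin normr0.
  - exact: iC.
have : J a b (fun s => (h s - C) - k s) = 0.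
  apply: J_ae0; first exact/ig_mf/igB.
  by move=> s /andP[_ sb]; rewrite /k sb subrr.
rewrite JB// JB//; last exact: ig_cst.
rewrite J_cst//.
have : J a b k <= 0.
  rewrite -(mul0r (b - a)) -J_cst//; apply: J_le => //; first exact: ig_cst.
  by move=> s sab; rewrite /k; case: ifP => // sb; rewrite subr_le0 hC//; case/andP: sab => ->.
lra.
Qed.

Section Aiming.
Variables (R : realType) (n p q : nat) (g : game R n p q).
Hypothesis hg : standing_assumptions g.
Local Notation f := (dyn g).
Local Notation L := (lip_const hg).
Local Notation Rb := (reach_radius hg).
Local Notation M := (speed hg).

(** Uniform continuity on the compact set in which all motions stay. *)
Lemma dyn_uniform eta : 0 < eta -> exists2 d : R, 0 < d &
  forall t t' x x' u u' v v',
    t0 g <= t <= theta g -> t0 g <= t' <= theta g ->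
    1 + enorm x <= Rb -> 1 + enorm x' <= Rb ->
    Pset g u -> Pset g u' -> Qset g v -> Qset g v' ->
    `|t - t'| < d -> enorm (x - x') < d -> enorm (u - u') < d -> enorm (v - v') < d ->
    enorm (f t x u v - f t' x' u' v') <= eta.
Proof.
move=> eta0.
pose K := `[t0 g, theta g]%classic `*` [set x : 'rV[R]_n | enorm x <= Rb - 1] `*`
  Pset g `*` Qset g.
have cK : compact K.
  apply: compact_setX; last exact: Q_compact hg.
  apply: compact_setX; last exact: P_compact hg.
  apply: compact_setX; first exact: segment_compact.
  exact: compact_enorm_ball.
have cf : {within K, continuous
    (fun a : R * 'rV[R]_n * 'rV[R]_p * 'rV[R]_q => f a.1.1.1 a.1.1.2 a.1.2 a.2)}.
  apply: continuous_subspaceW (dyn_continuous hg).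
  by move=> [[[t x] u] v] [[[/= ? _] ?] ?].
have n1 : 0 < n%:R + 1 :> R by rewrite ltr_wpDl.
have e0 : 0 < eta / (n%:R + 1) by rewrite divr_gt0.
have [d d0 hd] := compact_uniformly_continuous cK cf e0.
exists d => // t t' x x' u u' v v' tT tT' xR xR' Pu Pu' Qv Qv' tt xx uu vv.
have := hd (t, x, u, v) (t', x', u', v'); rewrite /K /= !in_itv/=.
move=> /(_ ltac:(by do !split => //; lra) ltac:(by do !split => //; lra)) H.
have : ball (t, x, u, v) d (t', x', u', v').
  split; last exact: ball_enorm.
  split; last exact: ball_enorm.
  by split; last exact: ball_enorm.
move=> /H; rewrite mx_norm_ball /ball_/= => h.
apply: (le_trans (enorm_le_norm _)).
move: h; rewrite ltr_pdivlMr// => h; apply: le_trans (ltW h).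
by rewrite mulrC ler_wpM2l// lerDl.
Qed.

Definition time_modulus (h eta : R) : Prop :=
  forall t t' x x' u v, t0 g <= t <= theta g -> t0 g <= t' <= theta g ->
    1 + enorm x <= Rb -> 1 + enorm x' <= Rb -> Pset g u -> Qset g v ->
    `|t - t'| <= h -> enorm (x - x') <= M * h ->
    enorm (f t x u v - f t' x' u v) <= eta.

Lemma time_modulus_exists eta : 0 < eta ->
  exists2 h0 : R, 0 < h0 & forall h, h <= h0 -> time_modulus h eta.
Proof.
move=> eta0; have [d d0 hd] := dyn_uniform eta0.
have M1 : 0 < M + 1 by rewrite ltr_wpDl// speed_ge0.
have dM : 0 < d / (M + 1) / 2 by rewrite !divr_gt0.
have E : (M + 1) * (d / (M + 1) / 2) = d / 2 by field; rewrite gt_eqF.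
exists (d / (M + 1) / 2) => // h hh t t' x x' u v tT tT' xR xR' Pu Qv tt xx.
have M0 := speed_ge0 hg.
have Mh : M * h <= M * (d / (M + 1) / 2) by rewrite ler_wpM2l.
have Md : 0 <= M * (d / (M + 1) / 2) by rewrite mulr_ge0// ltW.
apply: hd => //; rewrite ?subrr ?enorm0//; nra.
Qed.

(** The bound on the squared distance that a single step of aiming propagates;
    [psi] is the loss per unit of time. *)
Definition aim_bound (A psi t : R) : R :=
  (A + psi * (t - t0 g)) * expR (2 * L * (t - t0 g)).

Lemma aim_bound_step A psi c t : 0 <= A -> 0 <= psi -> t0 g <= c -> c <= t ->
  aim_bound A psi c * (1 + 2 * L * (t - c)) + (t - c) * psi <= aim_bound A psi t.
Proof.
move=> A0 p0 tc ct; have L0 := lip_const_gt0 hg.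
have ec : 1 <= expR (2 * L * (t - t0 g)).
  rewrite (le_trans _ (expR_ge1Dx _))// lerDl !mulr_ge0//; lra.
have B0 : 0 <= aim_bound A psi c.
  by rewrite mulr_ge0 ?expR_ge0// addr_ge0// mulr_ge0//; lra.
have h1 : aim_bound A psi c * (1 + 2 * L * (t - c)) <=
    (A + psi * (c - t0 g)) * expR (2 * L * (t - t0 g)).
  have -> : 2 * L * (t - t0 g) = 2 * L * (c - t0 g) + 2 * L * (t - c) by ring.
  by rewrite expRD mulrA; apply: ler_wpM2l => //; exact: expR_ge1Dx.
have h2 : (t - c) * psi <= (t - c) * psi * expR (2 * L * (t - t0 g)).
  by rewrite ler_peMr// mulr_ge0//; lra.
have -> : aim_bound A psi t = (A + psi * (c - t0 g)) * expR (2 * L * (t - t0 g)) +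
    (t - c) * psi * expR (2 * L * (t - t0 g)) by rewrite /aim_bound; ring.
lra.
Qed.

Lemma aim_bound_mono A psi c t : 0 <= A -> 0 <= psi -> t0 g <= c -> c <= t ->
  aim_bound A psi c <= aim_bound A psi t.
Proof.
move=> A0 p0 tc ct; apply: le_trans (aim_bound_step A0 p0 tc ct).
have L0 := lip_const_gt0 hg.
have B0 : 0 <= aim_bound A psi c.
  by rewrite mulr_ge0 ?expR_ge0// addr_ge0// mulr_ge0//; lra.
have : 0 <= aim_bound A psi c * (2 * L * (t - c)).
  by apply: mulr_ge0 => //; apply: mulr_ge0; lra.
have : 0 <= (t - c) * psi by rewrite mulr_ge0//; lra.
move: (2 * L * (t - c)) ((t - c) * psi) B0 => Y Z B0 *; nra.
Qed.

(** Extremal shift: on a short interval [[c, d]] the control minimizes, up to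
    [kappa], the projection of the velocity on the deviation [s] of the solution
    [x] from the guide [w] at the time [c]. Any motion that the same disturbance
    allows has a velocity with at least as large a projection, and hence so does its limit
    [w]: the deviation grows only through second-order and modulus terms. *)
Lemma aim_step c d z u v x w h eta kappa A psi :
  t0 g <= c -> c <= d -> d <= theta g -> d - c <= h ->
  admissible g c d u v -> reach hg c z -> solution g c d z u v x ->
  good_path hg w ->
  (forall e, 0 < e -> exists z' u' v' x', [/\ G0 g z', controls g u', disturbances g v',
     (forall t, c <= t < d -> v' t = v t) /\ solution g (t0 g) (theta g) z' u' v' x' &
     forall t, t0 g <= t <= theta g -> enorm (w t - x' t) < e]) ->
  time_modulus h eta -> 0 <= eta ->
  (forall t u0, c <= t < d -> Pset g u0 ->
     inner (z - w c) (f c z (u t) (v t)) <= inner (z - w c) (f c z u0 (v t)) + kappa) ->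
  0 <= kappa -> 0 <= A ->
  psi = 2 * (4 * Rb * eta + kappa) + 4 * M ^+ 2 * h ->
  enorm (z - w c) ^+ 2 <= aim_bound A psi c ->
  forall t, c <= t <= d -> enorm (x t - w t) ^+ 2 <= aim_bound A psi t.
Proof.
move=> tc cd dth dch ad rz sx gw approx tm eta0 aim kappa0 A0 Epsi hA t tcd.
set s := z - w c in aim hA *.
have M0 := speed_ge0 hg; have L0 := lip_const_gt0 hg; have Rb1 := Rb_ge1 hg.
have h0 : 0 <= h by lra.
have ccd : c <= c <= d by rewrite lexx.
have psi0 : 0 <= psi.
  by rewrite Epsi; have := mulr_ge0 (mulr_ge0 (ler0n R 4) (ltW (lt_le_trans ltr01 Rb1))) eta0; nra.
have [tc' td] := andP tcd.
apply: (le_trans _ (aim_bound_step A0 psi0 tc tc')).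
suff : enorm (x t - w t) ^+ 2 <=
    enorm s ^+ 2 * (1 + 2 * L * (t - c)) + (t - c) * psi.
  move/le_trans; apply; rewrite lerD2r ler_wpM2r//.
  by have : 0 <= L * (t - c) by [rewrite mulr_ge0//; lra]; lra.
have xc : x c = z by apply: (solution_init cd sx).
have wR r : t0 g <= r <= theta g -> enorm (w r) <= Rb := gw.1 r.
have rx r : c <= r <= d -> 1 + enorm (x r) <= Rb.
  by move=> rcd; apply: (@reach_ball _ _ _ _ _ hg r); [lra|exact: (solution_reach tc dth ad sx rz)].
have sR : enorm s <= 2 * Rb.
  have := rx c ltac:(lra); rewrite xc; have := wR c ltac:(lra).
  have := ler_enormD z (- w c); rewrite enormN -/s; lra.
have s0 := enorm_ge0 s.
set D := enorm (x t - w t); have D0 : 0 <= D := enorm_ge0 _.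
apply: (@le_of_small _ _ _ (2 * D + 2 * enorm s + 1 + 2 * (t - c) * L * enorm s + 4 * M * (t - c))).
move=> e /andP[e0 e1].
have [z' [u' [v' [x' [Gz' cu' dv' [ev sx'] wx']]]]] := approx e e0.
have adT := controls_admissible cu' dv'.
have ad' : admissible g c d u' v' by exact: (admissible_sub tc dth adT).
have gx' := solution_good_path hg Gz' cu' dv' sx'.
have rx' r : c <= r <= d -> 1 + enorm (x' r) <= Rb.
  move=> rcd; apply: (@reach_ball _ _ _ _ _ hg r); first lra.
  by apply: (solution_reach (lexx _) (lexx _) adT sx' (reach_init hg Gz')); lra.
have lx := solution_lip tc dth ad sx rz.
have lx' : lip_on c d M x' := lip_on_sub tc dth gx'.2.
have [i1 E1] := solution_incr sx (lexx c) tc' td.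
have [i2 E2] := solution_incr sx' tc tc' (le_trans td dth).
set F := velocity g x u v in i1 E1; set F' := velocity g x' u' v' in i2 E2.
set I := vJ c t (fun r => F r - F' r).
have iI : vig c t (fun r => F r - F' r) by exact: vigB.
have E : x t - x' t = (z - x' c) + I.
  by rewrite E1 E2 xc /I vJB// opprD addrACA.
have Fb r : c <= r <= t -> enorm (F r - F' r) <= 2 * M.
  move=> rct; rewrite (le_trans (ler_enormD _ _))// enormN.
  have rcd : c <= r <= d by lra.
  have h1 := velocity_bound hg x tc dth ad rcd.
  have h2 := velocity_bound hg x' tc dth ad' rcd.
  have K0 := growth_rate_gt0 hg.
  have := ler_wpM2l (ltW K0) (rx r rcd); have := ler_wpM2l (ltW K0) (rx' r rcd).
  by rewrite -/M; rewrite -/F in h1; rewrite -/F' in h2; rewrite /speed; lra.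
have Ib : enorm I <= 2 * M * (t - c) by apply: enorm_vJ_le_cst.
have sI : inner s I <= (4 * Rb * eta + kappa + L * enorm s * (enorm s + e)) * (t - c).
  rewrite /I inner_vJ//; apply: J_le_half => //; first exact: ig_inner.
  move=> r /andP[cr rt]; have rcd : c <= r <= d by lra.
  have rT : t0 g <= r <= theta g by lra.
  have cT : t0 g <= c <= theta g by lra.
  have [_ _ Pu Qv] := ad; have [_ _ Pu' Qv'] := ad'.
  have evr : v' r = v r by apply: ev; lra.
  have rc : `|r - c| <= h by rewrite ger0_norm; clear - cr rt td dch; lra.
  have n1 : enorm (F r - f c z (u r) (v r)) <= eta.
    apply: tm => //; [exact: rx|by rewrite -xc; exact: rx ccd|exact: Pu|exact: Qv|].
    rewrite -xc; apply: (le_trans (lx c r _ rcd)) => //.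
    by rewrite ler_wpM2l.
  have n2 : enorm (f c (x' c) (u' r) (v r) - F' r) <= eta.
    rewrite enormB /F' /velocity evr.
    apply: tm => //; [exact: rx'|exact: rx' ccd|exact: Pu'|exact: Qv|].
    apply: (le_trans (lx' c r _ rcd)) => //.
    by rewrite ler_wpM2l.
  have n3 : enorm (f c z (u' r) (v r) - f c (x' c) (u' r) (v r)) <= L * (enorm s + e).
    apply: (@le_trans _ _ (L * enorm (z - x' c))).
      apply: dyn_lip => //; [exact: Pu'|exact: Qv|by rewrite -xc; exact: rx ccd|exact: rx' ccd].
    rewrite ler_wpM2l ?(ltW L0)// (le_trans (ler_distD_enorm (w c) _ _))//.
    by rewrite lerD2l; exact/ltW/wx'/cT.
  have n4 : inner s (f c z (u r) (v r)) <= inner s (f c z (u' r) (v r)) + kappa.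
    apply: aim => //; last exact: Pu'.
    by rewrite cr (lt_le_trans rt td).
  have -> : F r - F' r = (F r - f c z (u r) (v r)) + (f c (x' c) (u' r) (v r) - F' r)
     + (f c z (u' r) (v r) - f c (x' c) (u' r) (v r))
     + (f c z (u r) (v r) - f c z (u' r) (v r)).
    move: (f c z (u r) (v r)) (f c (x' c) (u' r) (v r)) (f c z (u' r) (v r)) => a1 a2 a3.
    by apply/rowP => k; rewrite !mxE; ring.
  rewrite 3!innerDr (innerBr s (f c z (u r) (v r)) (f c z (u' r) (v r))).
  have k1 := Cauchy_Schwarz s (F r - f c z (u r) (v r)).
  have k2 := Cauchy_Schwarz s (f c (x' c) (u' r) (v r) - F' r).
  have k3 := Cauchy_Schwarz s (f c z (u' r) (v r) - f c (x' c) (u' r) (v r)).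
  have m1 : enorm s * enorm (F r - f c z (u r) (v r)) <= 2 * Rb * eta.
    by apply: ler_pM => //; exact: enorm_ge0.
  have m2 : enorm s * enorm (f c (x' c) (u' r) (v r) - F' r) <= 2 * Rb * eta.
    by apply: ler_pM => //; exact: enorm_ge0.
  have m3 := ler_wpM2l s0 n3.
  have -> : L * enorm s * (enorm s + e) = enorm s * (L * (enorm s + e)) by ring.
  clear - k1 k2 k3 m1 m2 m3 n4; lra.
have wc : enorm (w c - x' c) <= e by apply/ltW/wx'; rewrite tc (le_trans cd).
have zI : inner (z - x' c) I <= inner s I + e * (2 * M * (t - c)).
  have -> : z - x' c = s + (w c - x' c) by rewrite /s addrA subrK.
  rewrite innerDl lerD2l (le_trans (Cauchy_Schwarz _ _))//.
  by apply: ler_pM => //; exact: enorm_ge0.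
have zn : enorm (z - x' c) <= enorm s + e.
  by rewrite (le_trans (ler_distD_enorm (w c) _ _))// lerD2l.
have Dx : D <= enorm (x t - x' t) + e.
  rewrite (le_trans (ler_distD_enorm (x' t) _ _))// lerD2l enormB.
  by apply/ltW/wx'; rewrite (le_trans tc) ?(le_trans td).
have sq : enorm (x t - x' t) ^+ 2 = enorm (z - x' c) ^+ 2 + 2 * inner (z - x' c) I + enorm I ^+ 2.
  by rewrite E sqr_enormD.
have I2 : enorm I ^+ 2 <= 4 * M ^+ 2 * h * (t - c).
  have tch : t - c <= h by clear - td dch; lra.
  have t0' : 0 <= t - c by rewrite subr_ge0.
  apply: (@le_trans _ _ ((2 * M * (t - c)) ^+ 2)).
    by rewrite ler_pXn2r ?nnegrE ?enorm_ge0//; do 2 apply: mulr_ge0 => //.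
  have -> : (2 * M * (t - c)) ^+ 2 = 4 * M ^+ 2 * (t - c) * (t - c) by ring.
  by rewrite ler_wpM2r// ler_wpM2l// mulr_ge0// sqr_ge0.
have z2 : enorm (z - x' c) ^+ 2 <= (enorm s + e) ^+ 2.
  by rewrite ler_pXn2r ?nnegrE ?enorm_ge0// addr_ge0// ltW.
have Y0 := enorm_ge0 (x t - x' t).
have DY : D ^+ 2 <= enorm (x t - x' t) ^+ 2 + 2 * e * D.
  have [De|eD] := leP D e; first by clear - De D0 e0 Y0; nra.
  have : (D - e) ^+ 2 <= enorm (x t - x' t) ^+ 2.
    by rewrite ler_pXn2r ?nnegrE//; clear - Dx eD; lra.
  by clear - D0 e0; nra.
have t0' : 0 <= t - c by rewrite subr_ge0.
have e2 : e ^+ 2 <= e by rewrite expr2 ler_piMr// ltW.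
rewrite Epsi.
have z2' : enorm (z - x' c) ^+ 2 <= enorm s ^+ 2 + 2 * e * enorm s + e.
  by apply: (le_trans z2); rewrite sqrrD; clear - e2; lra.
lra.
Qed.

End Aiming.

(** * From full-memory strategies to quasi-strategies *)

Section Selection.
Variables (R : realType).

Lemma finite_net m (K : set 'rV[R]_m) d : compact K -> 0 < d ->
  exists s : seq 'rV[R]_m, (forall x, x \in s -> K x) /\
    forall x, K x -> exists2 y, y \in s & enorm (x - y) < d.
Proof.
rewrite compact_cover => cK d0.
have [|x Kx|D' DK cov] := cK _ K (fun x => [set y | enorm (x - y) < d]°).
- by move=> x _; exact: open_interior.
- by exists x => //; apply: nbhs_singleton; apply: nbhs_interior; exact: enorm_ball.
exists (finmap.enum_fset D'); split=> [x /DK|x Kx]; first by rewrite inE.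
have [y yD /interior_subset xy] := cov x Kx.
by exists y => //; rewrite enormB.
Qed.

Lemma argmin_exists m (K : set 'rV[R]_m) (phi : 'rV[R]_m -> R) :
  compact K -> K !=set0 ->
  (forall x e, K x -> 0 < e -> exists2 d, 0 < d &
     forall y, K y -> enorm (x - y) < d -> `|phi x - phi y| <= e) ->
  exists x, argmin K phi x.
Proof.
move=> cK K0 h.
have cphi : {within K, continuous phi}.
  apply/subspace_continuousP => x Kx; apply/cvgrPdist_le => e e0.
  have [d d0 hd] := h x e Kx e0.
  near=> y; apply: hd; first by near: y; exact: withinT.
  by near: y; apply: cvg_within; exact: enorm_ball.
have [x Kx xmin] := compact_EVT_min K0 cK cphi.
by exists x; split; [rewrite inE in Kx|move=> y Ky; apply: xmin; rewrite inE].
Unshelve. all: by end_near. Qed.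

(** The index of the first point of [s] close to [v t] takes finitely many
    values, each on a measurable set. *)
Lemma mf_find_net m (a b d : R) (v : R -> 'rV[R]_m) (s : seq 'rV[R]_m) (h : nat -> R) :
  (forall k, mf a b (fun t => v t ord0 k)) ->
  mf a b (fun t => h (find (fun y => enorm (v t - y) < d) s)).
Proof.
move=> mv; elim: s h => [|y s IH] h /=; first exact: measurable_cst.
have -> : (fun t => h (if enorm (v t - y) < d then 0%N
    else (find (fun y => enorm (v t - y) < d) s).+1)) =
  (fun t => if enorm (v t - y) < d then h 0%N
            else h (find (fun y => enorm (v t - y) < d) s).+1).
  by apply/funext => t /=; case: ifP.
apply: measurable_fun_if; first exact: leb_measurable_itv.
- apply: measurable_fun_ltr; last exact: measurable_cst.
  apply: mf_enorm => k.
  have -> : (fun t => (v t - y) ord0 k) = (fun t => v t ord0 k - y ord0 k).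
    by apply/funext => t; rewrite !mxE.
  by apply: measurable_funB; [exact: mv|exact: measurable_cst].
- exact: measurable_cst.
- by apply: measurable_funS (IH (fun i => h i.+1)); [exact: leb_measurable_itv|exact: subIsetl].
Qed.

End Selection.

Section Unrestricted.
Variables (R : realType) (n p q : nat) (g : game R n p q).
Hypothesis hg : standing_assumptions g.
Local Notation f := (dyn g).
Local Notation a := (t0 g).
Local Notation b := (theta g).
Local Notation tau := (tau g).
Local Notation L := (lip_const hg).
Local Notation Rb := (reach_radius hg).
Local Notation M := (speed hg).

Lemma dyn_eps c z u v e : a <= c <= b -> Pset g u -> Qset g v -> 0 < e ->
  exists2 d, 0 < d & forall u' v', Pset g u' -> Qset g v' ->
    enorm (u - u') < d -> enorm (v - v') < d ->
    enorm (f c z u v - f c z u' v') <= e.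
Proof.
move=> cT Pu Qv e0; have n1 : 0 < n%:R + 1 :> R by rewrite ltr_wpDl.
have e1 : 0 < e / (n%:R + 1) by rewrite divr_gt0.
have K0 : (`[a, b]%classic `*` [set: 'rV[R]_n] `*` Pset g `*` Qset g) (c, z, u, v).
  by do !split => //=; rewrite in_itv.
have [d d0 hd] := within_continuous_ball (dyn_continuous hg) K0 e1.
exists d => // u' v' Pu' Qv' uu vv.
have K1 : (`[a, b]%classic `*` [set: 'rV[R]_n] `*` Pset g `*` Qset g) (c, z, u', v').
  by do !split => //=; rewrite in_itv.
have : ball (c, z, u, v) d (c, z, u', v').
  split; last exact: ball_enorm.
  split; last exact: ball_enorm.
  by split; exact: ballxx.
move=> /(hd _ K1); rewrite mx_norm_ball /ball_/= => h.
apply: (le_trans (enorm_le_norm _)).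
move: h; rewrite ltr_pdivlMr// => h; apply: le_trans (ltW h).
by rewrite mulrC ler_wpM2l// lerDl.
Qed.

Lemma inner_dyn_argmin c z s v : a <= c <= b -> Qset g v ->
  exists u, argmin (Pset g) (fun u => inner s (f c z u v)) u.
Proof.
move=> cT Qv; apply: argmin_exists; [exact: P_compact hg|exact: P_nonempty hg|].
move=> u e Pu e0; have s1 : 0 < enorm s + 1 by rewrite ltr_wpDl// enorm_ge0.
have e1 : 0 < e / (enorm s + 1) by rewrite divr_gt0.
have [d d0 hd] := dyn_eps z cT Pu Qv e1.
exists d => // u' Pu' uu.
have {}hd : enorm (f c z u v - f c z u' v) <= e / (enorm s + 1).
  by apply: hd => //; rewrite subrr enorm0.
have key (x y : 'rV[R]_n) : enorm (x - y) <= e / (enorm s + 1) -> inner s x - inner s y <= e.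
  move=> xy; rewrite -innerBr (le_trans (Cauchy_Schwarz _ _))//.
  have s0 := enorm_ge0 s; have := enorm_ge0 (x - y).
  move: xy; rewrite ler_pdivlMr// => xy xy0; nra.
rewrite ler_norml key// andbT lerNl opprB key//.
by rewrite enormB.
Qed.

(** The accuracy, step and modulus with which aiming loses at most [rho] per
    unit of time. *)
Lemma aim_params rho : 0 < rho -> exists h eta kappa : R,
  [/\ 0 < h, 0 < eta, 0 < kappa &
   forall h', 0 <= h' <= h -> time_modulus hg h' eta /\
     2 * (4 * Rb * eta + kappa) + 4 * M ^+ 2 * h' <= rho].
Proof.
move=> r0; have Rb1 := Rb_ge1 hg; have Rb0 := lt_le_trans ltr01 Rb1.
have M0 := speed_ge0 hg.
have eta0 : 0 < rho / (32 * Rb) by rewrite divr_gt0// mulr_gt0.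
have [h0 h00 hm] := time_modulus_exists hg eta0.
have M1 : 0 < 16 * (M ^+ 2 + 1) by rewrite mulr_gt0// ltr_wpDl// sqr_ge0.
have hM : 0 < rho / (16 * (M ^+ 2 + 1)) by rewrite divr_gt0.
exists (Num.min h0 (rho / (16 * (M ^+ 2 + 1)))), (rho / (32 * Rb)), (rho / 8).
split=> //; [by rewrite lt_min h00|by rewrite divr_gt0|].
move=> h'; rewrite le_min => /andP[h'0 /andP[h1 h2]]; split; first exact: hm.
have -> : 4 * Rb * (rho / (32 * Rb)) = rho / 8 by field; rewrite gt_eqF.
move: h2; rewrite ler_pdivlMr// => h2.
have M2 : 0 <= M ^+ 2 by exact: sqr_ge0.
nra.
Qed.

Lemma aim_bound0_lt psi d t : 0 < d -> 0 <= psi ->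
  psi <= d ^+ 2 / (2 * ((b - a) * expR (2 * L * (b - a)))) -> a <= t <= b ->
  aim_bound hg 0 psi t < d ^+ 2.
Proof.
move=> d0 psi0 hpsi /andP[at_ tb]; have L0 := lip_const_gt0 hg.
set Lam := (b - a) * _ in hpsi.
have Lam0 : 0 < Lam by rewrite mulr_gt0 ?subr_gt0 ?expR_gt0//; exact: t0_lt_theta hg.
apply: (@le_lt_trans _ _ (psi * Lam)).
  rewrite /aim_bound add0r -mulrA ler_wpM2l//.
  apply: ler_pM; rewrite ?subr_ge0 ?expR_ge0 ?lerB//.
  by rewrite ler_expR ler_wpM2l ?lerB// mulr_ge0// ltW.
have : psi * Lam <= d ^+ 2 / 2.
  have -> : d ^+ 2 / 2 = d ^+ 2 / (2 * Lam) * Lam by field; rewrite gt_eqF.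
  by rewrite ler_wpM2r// ltW.
have : 0 < d ^+ 2 by rewrite exprn_gt0.
lra.
Qed.

Section FromStrategy.
Variables (z0 : 'rV[R]_n) (U : strategy R n p).
Hypotheses (Gz : G0 g z0) (SU : strategies g U).

(** The ultralimit of the motions for finer and finer partitions responds to
    the disturbance without anticipating it, although the partitions in a
    subsequence that realizes it depend on the whole disturbance. *)
Lemma limit_response : exists resp : (R -> 'rV[R]_q) -> (R -> 'rV[R]_n),
  [/\ forall v, disturbances g v -> good_path hg (resp v) /\ resp v a = z0,
      forall v, disturbances g v -> X_p g z0 U (resp v),
      forall v v' s, disturbances g v -> disturbances g v' -> a <= s <= b ->
        (forall t, a <= t <= s -> v t = v' t) ->
        forall t, a <= t <= s -> resp v t = resp v' t &
      forall v e, disturbances g v -> 0 < e -> exists u x,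
        [/\ controls g u, solution g a b z0 u v x &
            forall t, a <= t <= b -> enorm (resp v t - x t) < e]].
Proof.
have Gz' := Gz; have SU' := SU.
have exD (k : nat) : exists D, Defs.partition g D /\ Dmax g D <= k.+1%:R^-1.
  have k0 : 0 < k.+1%:R^-1 :> R by rewrite invr_gt0.
  by have [D pD hD] := fine_partition hg k0; exists D.
have [D hD] := choice exD.
have pD k : Defs.partition g (D k) := (hD k).1.
have [F [FU Foo]] := exists_ultra; have PF : ProperFilter F := ultra_proper.
have exm (vk : (R -> 'rV[R]_q) * nat) : exists ux : (R -> 'rV[R]_p) * (R -> 'rV[R]_n),
    disturbances g vk.1 -> [/\ controls g ux.1, solution g a b z0 ux.1 vk.1 ux.2 &
      follows g (D vk.2) (U (D vk.2)) ux.1 ux.2 (size (D vk.2))].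
  have [dv|ndv] := pselect (disturbances g vk.1); last first.
    by exists (fun=> 0, fun=> 0) => /ndv.
  have [x [u cu [fu sx]]] := motion_exists hg Gz' (pD vk.2) (SU' _ (pD vk.2)) dv.
  by exists (u, x).
have [ux hux] := choice exm.
pose x v k := (ux (v, k)).2; pose u v k := (ux (v, k)).1.
have H v k : disturbances g v -> [/\ controls g (u v k), solution g a b z0 (u v k) v (x v k) &
      follows g (D k) (U (D k)) (u v k) (x v k) (size (D k))].
  by move=> dv; exact: (hux (v, k) dv).
have gx v k : disturbances g v -> good_path hg (x v k).
  by move=> dv; have [cu sx _] := H v k dv; exact: solution_good_path Gz' cu dv sx.
pose resp v := path_lim F (x v).
have tt := ltW (t0_lt_theta hg).
have respP v : disturbances g v -> good_path hg (resp v) /\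
  forall e, 0 < e -> F [set k | forall t, a <= t <= b -> enorm (resp v t - x v k t) < e].
  by move=> dv; rewrite /resp; exact: (path_limP FU (fun k => gx v k dv)).
exists resp; split.
- move=> v dv; have [gr cr] := respP v dv; split=> //.
  apply/eqP; rewrite -subr_eq0; apply/eqP/enorm_le0/ler_addgt0Pr => e e0.
  near F => k.
  have h : forall t, a <= t <= b -> enorm (resp v t - x v k t) < e by near: k; exact: cr.
  have [_ sx _] := H v k dv.
  by rewrite add0r -(solution_init tt sx); apply/ltW/h; rewrite lexx.
- move=> v dv; have [gr cr] := respP v dv.
  have exk (k : nat) : exists j, (k <= j)%N /\
      forall t, a <= t <= b -> enorm (resp v t - x v j t) < k.+1%:R^-1.
    have k0 : 0 < k.+1%:R^-1 :> R by rewrite invr_gt0.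
    near F => j; exists j; split; last by near: j; exact: cr.
    by near: j; apply: Foo; exact: nbhs_infty_ge.
  have [j hj] := choice exk.
  exists v => //; split; first exact: good_path_Cts gr.
  exists (fun=> z0), (fun=> v), (fun k => D (j k)), (fun k => x v (j k)); split.
  + move=> k; split=> //; have [cu sx fx] := H v (j k) dv.
    by exists (u v (j k)).
  + exact: cvg_cst.
  + apply/cvgrPdist_lt => e e0; near=> k.
    rewrite sub0r normrN ger0_norm ?Dmax_ge0// (le_lt_trans (hD (j k)).2)//.
    have [kj _] := hj k.
    apply: (@le_lt_trans _ _ (k.+1%:R^-1)).
      by rewrite lef_pV2 ?posrE// ler_nat ltnS.
    by near: k; exact: (near_infty_natSinv_lt (PosNum e0)).
  + apply/uniform_cvg => e e0; near=> k => t; rewrite /= in_itv/= => tT.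
    have [_ h] := hj k; apply: (lt_trans (h t tT)).
    by near: k; exact: (near_infty_natSinv_lt (PosNum e0)).
- move=> v v' s dv dv' sT vv t ts; rewrite /resp /path_lim; congr (ulim F _).
  apply/funext => k.
  have [cu sx fx] := H v k dv; have [cu' sx' fx'] := H v' k dv'.
  by have [h _] := motion_agree hg Gz' (pD k) cu dv cu' dv' sx sx' fx fx' sT
    (fun _ _ _ _ _ => erefl) vv; exact: h.
- move=> v e dv e0; have [gr cr] := respP v dv; near F => k.
  have [cu sx fx] := H v k dv; exists (u v k), (x v k); split=> //.
  by near: k; exact: cr.
Unshelve. all: by end_near. Qed.

(** A quasi-strategy that aims at the response: on each interval of a fine
    partition it answers the current value of the disturbance, rounded to a
    finite net, by a control that minimizes the projection of the velocity on
    the current deviation from the response. *)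
Lemma track_response (resp : (R -> 'rV[R]_q) -> (R -> 'rV[R]_n)) d : 0 < d ->
  (forall v, disturbances g v -> good_path hg (resp v) /\ resp v a = z0) ->
  (forall v v' s, disturbances g v -> disturbances g v' -> a <= s <= b ->
     (forall t, a <= t <= s -> v t = v' t) ->
     forall t, a <= t <= s -> resp v t = resp v' t) ->
  (forall v e, disturbances g v -> 0 < e -> exists u x,
     [/\ controls g u, solution g a b z0 u v x &
         forall t, a <= t <= b -> enorm (resp v t - x t) < e]) ->
  exists alpha, quasi_strategies g alpha /\
    forall v x, disturbances g v -> solution g a b z0 (alpha v) v x ->
      forall t, a <= t <= b -> enorm (resp v t - x t) < d.
Proof.
move=> d0 respG respN respL; have Gz' := Gz.
have Rb1 := Rb_ge1 hg; have Rb0 := lt_le_trans ltr01 Rb1.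
have ab := t0_lt_theta hg.
pose Lam := (b - a) * expR (2 * L * (b - a)).
have Lam0 : 0 < Lam by rewrite mulr_gt0 ?subr_gt0 ?expR_gt0.
pose rho := d ^+ 2 / (2 * Lam).
have rho0 : 0 < rho by rewrite divr_gt0 ?exprn_gt0// mulr_gt0.
have [h [eta [kappa [h0 eta0 kappa0 hpar]]]] := aim_params rho0.
have k1 : 0 < kappa / (4 * Rb) by rewrite divr_gt0// mulr_gt0.
have [delta delta0 hdelta] := dyn_uniform hg k1.
have [net [netQ netC]] := finite_net (Q_compact hg) delta0.
have [D pD hD] := fine_partition hg h0.
have [u0 Pu0] := P_nonempty hg.
pose idx w := find (fun y : 'rV[R]_q => enorm (w - y) < delta) net.
have exsel (czsk : R * 'rV[R]_n * 'rV[R]_n * nat) : exists u, Pset g u /\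
    (a <= czsk.1.1.1 <= b -> (czsk.2 < size net)%N ->
     forall u', Pset g u' ->
       inner czsk.1.2 (f czsk.1.1.1 czsk.1.1.2 u (nth 0 net czsk.2)) <=
       inner czsk.1.2 (f czsk.1.1.1 czsk.1.1.2 u' (nth 0 net czsk.2))).
  case: czsk => [[[c z] s] k] /=.
  have [[cT kn]|no] := pselect (a <= c <= b /\ (k < size net)%N); last first.
    by exists u0; split=> // cT kn; case: no.
  have [u [Pu hu]] := inner_dyn_argmin z s cT (netQ _ (mem_nth 0 kn)).
  by exists u.
have [sel hsel] := choice exsel.
pose Fb v : feedback R n p := fun i x t =>
  sel (tau D i, x (tau D i), x (tau D i) - resp v (tau D i), idx (v t)).
have tauT i := tau_in i pD.
have fFb v : disturbances g v -> is_feedback g D (Fb v).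
  move=> [mv _] i iD x cx; exists (fun t => Fb v i (x \_ `[a, tau D i]) t) => //.
  split=> [k|t _]; last exact: (hsel _).1.
  exact: (@mf_find_net _ _ _ _ delta v net (fun j => sel (tau D i,
    (x \_ `[a, tau D i]) (tau D i),
    (x \_ `[a, tau D i]) (tau D i) - resp v (tau D i), j) ord0 k) mv).
have exm (v : R -> 'rV[R]_q) : exists ux : (R -> 'rV[R]_p) * (R -> 'rV[R]_n),
    disturbances g v -> [/\ controls g ux.1, solution g a b z0 ux.1 v ux.2 &
      follows g D (Fb v) ux.1 ux.2 (size D)].
  have [dv|ndv] := pselect (disturbances g v); last first.
    by exists (fun=> 0, fun=> 0) => /ndv.
  have [x [u cu [fu sx]]] := motion_exists hg Gz' pD (fFb v dv) dv.
  by exists (u, x).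
have [ux hux] := choice exm.
pose alpha v t := if t < b then (ux v).1 t else u0.
have ca v : disturbances g v -> controls g (alpha v).
  by move=> dv; have [cu _ _] := hux v dv; apply: controls_switch => //; exact: controls_cst.
exists alpha; split; first split=> [v dv|s v v' sT dv dv' vv]; first exact: ca.
  move=> t; rewrite in_itv/= => ts; rewrite /alpha; case: ifP => // tb.
  have {}sT : a <= s <= b by move: sT; rewrite /= in_itv.
  have {}vv r : a <= r <= s -> v r = v' r by move=> rs; apply: vv; rewrite in_itv.
  have [cu sx fx] := hux v dv; have [cu' sx' fx'] := hux v' dv'.
  have eF i x r : tau D i <= r < tau D i.+1 -> r <= s -> Fb v i x r = Fb v' i x r.
    move=> /andP[ir ri] rs; rewrite /Fb; have /andP[ai ib] := tauT i.
    by rewrite (respN v v' s dv dv' sT vv) ?vv//; clear - ir rs ai; lra.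
  by have [_ hu] := motion_agree hg Gz' pD cu dv cu' dv' sx sx' fx fx' sT eF vv; exact: hu.
move=> v x' dv sx'; have [cu sx fx] := hux v dv.
set x := (ux v).2 in sx fx; set u := (ux v).1 in cu sx fx.
have [gr r0] := respG v dv; have gx := solution_good_path hg Gz' cu dv sx.
have xx' t : a <= t <= b -> x t = x' t.
  apply: (solution_unique_T hg Gz' cu dv (ca v dv) dv sx sx'); first by rewrite lexx ltW.
  by move=> s /andP[_ sb]; rewrite /alpha sb.
have D0 := Dmax_ge0 g D.
have [tm psi_rho] := hpar (Dmax g D) ltac:(lra).
set psi := 2 * (4 * Rb * eta + kappa) + 4 * M ^+ 2 * Dmax g D in psi_rho.
have psi0 : 0 <= psi.
  have : 0 <= Rb * eta by rewrite mulr_ge0// ltW.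
  have : 0 <= M ^+ 2 * Dmax g D by rewrite mulr_ge0// sqr_ge0.
  by rewrite /psi; lra.
have ad := controls_admissible cu dv.
have step i : (i < size D)%N ->
    enorm (x (tau D i) - resp v (tau D i)) ^+ 2 <= aim_bound hg 0 psi (tau D i) ->
    forall t, tau D i <= t <= tau D i.+1 ->
      enorm (x t - resp v t) ^+ 2 <= aim_bound hg 0 psi t.
  move=> iD hi.
  have /andP[ai ib] := tauT i; have /andP[ai' ib'] := tauT i.+1.
  have ii := ltW (tau_S pD iD).
  have rxi : reach hg (tau D i) (x (tau D i)).
    by apply: (solution_reach (lexx _) (lexx _) ad sx (reach_init hg Gz')); rewrite ai.
  have approx e : 0 < e -> exists z' u' v' x', [/\ G0 g z', controls g u', disturbances g v',
     (forall t, tau D i <= t < tau D i.+1 -> v' t = v t) /\ solution g a b z' u' v' x' &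
     forall t, a <= t <= b -> enorm (resp v t - x' t) < e].
    by move=> e0; have [u' [y [cu' sy hy]]] := respL v e dv e0; exists z0, u', v, y.
  have aim t u1 : tau D i <= t < tau D i.+1 -> Pset g u1 ->
    inner (x (tau D i) - resp v (tau D i)) (f (tau D i) (x (tau D i)) (u t) (v t)) <=
    inner (x (tau D i) - resp v (tau D i)) (f (tau D i) (x (tau D i)) u1 (v t)) + kappa.
    move=> ti Pu1.
    have tI : t \in `[tau D i, tau D i.+1[ by rewrite in_itv.
    have tT : a <= t <= b by clear - ti ai ib'; lra.
    rewrite (fx i iD t tI) /Fb restrict_in ?lexx ?andbT//.
    set s := x (tau D i) - resp v (tau D i).
    have Qvt : Qset g (v t) by apply: dv.2; rewrite /= in_itv.
    have [y yn vy] := netC _ Qvt.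
    have hs : has (fun y => enorm (v t - y) < delta) net by apply/hasP; exists y.
    have kn : (idx (v t) < size net)%N by rewrite -has_find.
    have vq : enorm (v t - nth 0 net (idx (v t))) < delta := nth_find 0 hs.
    have [Psel hmin] := hsel (tau D i, x (tau D i), s, idx (v t)).
    have /= {}hmin := hmin (tauT i) kn u1 Pu1.
    set us := sel _ in Psel hmin *; set qv := nth 0 net _ in vq hmin.
    have Qq : Qset g qv by apply: netQ; exact: mem_nth.
    have xR : 1 + enorm (x (tau D i)) <= Rb.
      exact: (@reach_ball _ _ _ _ _ hg (tau D i)).
    have sR : enorm s <= 2 * Rb.
      have := gr.1 (tau D i) (tauT i); have := ler_enormD (x (tau D i)) (- resp v (tau D i)).
      by rewrite enormN -/s; clear - xR; lra.
    have close w : Pset g w ->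
        `|inner s (f (tau D i) (x (tau D i)) w (v t)) - inner s (f (tau D i) (x (tau D i)) w qv)| <= kappa / 2.
      move=> Pw; have E w1 w2 : enorm (w1 - w2) <= kappa / (4 * Rb) -> inner s w1 - inner s w2 <= kappa / 2.
        move=> ww; rewrite -innerBr (le_trans (Cauchy_Schwarz _ _))//.
        have -> : kappa / 2 = (2 * Rb) * (kappa / (4 * Rb)) by field; rewrite gt_eqF.
        by apply: ler_pM => //; exact: enorm_ge0.
      have fq : enorm (f (tau D i) (x (tau D i)) w (v t) - f (tau D i) (x (tau D i)) w qv) <= kappa / (4 * Rb).
        by apply: hdelta => //; rewrite subrr ?enorm0 ?normr0.
      by rewrite ler_norml E// andbT lerNl opprB E// enormB.
    have := close us Psel; have := close u1 Pu1; rewrite !ler_norml; clear - hmin; lra.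
  exact: (aim_step ai ii ib' (tau_step_le g iD) (admissible_sub ai ib' ad) rxi
    (solution_sub sx ai ii ib') gr approx tm (ltW eta0) aim (ltW kappa0) (lexx 0) _ hi).
have H i : (i <= size D)%N ->
    enorm (x (tau D i) - resp v (tau D i)) ^+ 2 <= aim_bound hg 0 psi (tau D i).
  elim: i => [_|i IH iD].
    rewrite tau0 (solution_init (ltW ab) sx) r0 subrr enorm0 expr0n/=.
    by rewrite /aim_bound subrr mulr0 addr0 mul0r.
  apply: (step i iD (IH (ltnW iD))).
  by rewrite lexx andbT ltW// tau_S.
move=> t tT; rewrite -xx'// enormB.
have : enorm (x t - resp v t) ^+ 2 <= aim_bound hg 0 psi t.
  have [tb|bt] := ltP t b.
    have tT' : a <= t < b by case/andP: tT => ->.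
    have [i iD /andP[it ti]] := tau_locate pD tT'.
    by apply: (step i iD (H i (ltnW iD))); rewrite it ltW.
  have -> : t = tau D (size D).
    by rewrite tau_last//; apply/eqP; rewrite eq_le bt andbT; case/andP: tT.
  exact: H.
move=> h1; rewrite -(ltr_pXn2r (n := 2)) ?nnegrE ?enorm_ge0 ?(ltW d0)//.
by apply: (le_lt_trans h1); exact: aim_bound0_lt.
Qed.

(** The responses are limit motions for constant disturbance sets, so that they
    cost at most [Gamma_p_of]; tracking them closely costs hardly more. *)
Lemma Gamma_q_le_Gamma_p_of : (Gamma_q g z0 <= Gamma_p_of g z0 U)%E.
Proof.
have [resp [respG respX respN respL]] := limit_response.
apply/lee_addgt0Pr => e e0.
have [d d0 hd] := cost_uniform hg e0.
have [alpha [qa ha]] := track_response d0 respG respN respL.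
apply: (@le_trans _ _ (Gamma_q_of g z0 alpha)).
  by apply: ereal_inf_lbound; exists alpha.
apply: ge_ereal_sup => _ [x [v dv sx] <-].
have [gr _] := respG v dv.
apply: (@le_trans _ _ ((cost g (resp v))%:E + e%:E)%E); last first.
  apply: leeD2r; apply: ereal_sup_ubound; exists (resp v) => //.
  exact: respX.
rewrite -EFinD lee_fin.
have := hd (resp v) x gr (solution_Cts sx) (ha v x dv sx).
by rewrite ltr_norml; lra.
Qed.

End FromStrategy.

Lemma Gamma_q_le_Gamma_p z0 : G0 g z0 -> (Gamma_q g z0 <= Gamma_p g z0)%E.
Proof.
by move=> Gz; apply: le_ereal_inf_tmp => _ [U SU <-]; exact: Gamma_q_le_Gamma_p_of.
Qed.

End Unrestricted.

(** * Compact sets of disturbances are uniformly close to continuous functions *)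

Section ContinuousApproximation.
Variables (R : realType) (a b : R).
Hypothesis ab : a <= b.
Local Notation D := (`[a, b]%classic : set (lebR R)).

Lemma J_negligible (N : set R) h : (@lebesgue_measure R).-negligible N ->
  mf a b h -> (forall s, a <= s <= b -> ~ N s -> h s = 0) -> J a b h = 0.
Proof.
move=> [A [mA A0 NA]] mh h0.
rewrite (_ : J a b h = J a b (fun=> 0)); first by rewrite J_cst// mul0r.
congr fine; apply: ae_eq_integral.
- exact: leb_measurable_itv.
- exact/measurable_EFinP.
- exact: measurable_cst.
- exists A; split; [exact: sub_caratheodory|exact: A0|].
  move=> x /= /not_implyP[]; rewrite in_itv/= => xab hx; apply: NA.
  by apply: contrapT => Nx; apply: hx; rewrite h0.
Qed.

(** Functions in the closure of the continuous ones for the [L_1] seminorm. *)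
Definition L1_approximable (h : R -> R) : Prop := ig a b h /\
  forall e, 0 < e -> exists2 c, continuous c & J a b (fun t => `|h t - c t|) <= e.

Lemma ig_continuous c : continuous c -> ig a b c.
Proof.
move=> cc; have cw : {within `[a, b], continuous c} by exact: continuous_subspaceT.
have mc : mf a b c by exact: mf_continuous.
have [B hB] : exists B, forall t, a <= t <= b -> `|c t| <= B.
  have ca : {within `[a, b], continuous (fun t => `|c t|)}.
    by apply: continuous_subspaceT => t; apply: cvg_norm; exact: cc.
  have [t _ ht] := EVT_max ab ca.
  by exists `|c t| => s sab; apply: ht; rewrite in_itv.
exact: ig_bounded mc hB.
Qed.

Lemma L1_approximableD h1 h2 : L1_approximable h1 -> L1_approximable h2 ->
  L1_approximable (fun t => h1 t + h2 t).
Proof.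
move=> [i1 a1] [i2 a2]; split=> [|e e0]; first exact: igD.
have e2 : 0 < e / 2 by rewrite divr_gt0.
have [c1 cc1 h1c] := a1 _ e2; have [c2 cc2 h2c] := a2 _ e2.
have ic1 := ig_continuous cc1; have ic2 := ig_continuous cc2.
exists (fun t => c1 t + c2 t); first by move=> t; apply: cvgD; [exact: cc1|exact: cc2].
have I1 : ig a b (fun t => `|h1 t - c1 t|) by apply: ig_abs; exact: igB.
have I2 : ig a b (fun t => `|h2 t - c2 t|) by apply: ig_abs; exact: igB.
apply: (@le_trans _ _ (J a b (fun t => `|h1 t - c1 t| + `|h2 t - c2 t|))).
  apply: J_le; [apply: ig_abs; apply: igB; exact: igD|exact: igD|].
  by move=> s _; rewrite opprD addrACA ler_normD.
by rewrite JD//; lra.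
Qed.

Lemma L1_approximableZ k h : L1_approximable h -> L1_approximable (fun t => k * h t).
Proof.
move=> [i1 a1]; split=> [|e e0]; first exact: igZ.
have k1 : 0 < `|k| + 1 by rewrite ltr_wpDl.
have e2 : 0 < e / (`|k| + 1) by rewrite divr_gt0.
have [c1 cc1 h1c] := a1 _ e2; have ic1 := ig_continuous cc1.
exists (fun t => k * c1 t); first by move=> t; apply: cvgM; [exact: cvg_cst|exact: cc1].
have I1 : ig a b (fun t => `|h t - c1 t|) by apply: ig_abs; exact: igB.
have -> : J a b (fun t => `|k * h t - k * c1 t|) = `|k| * J a b (fun t => `|h t - c1 t|).
  by rewrite -JZ//; apply: J_ext => s _; rewrite -mulrBr normrM.
move: h1c; rewrite ler_pdivlMr// => h1c.
have : 0 <= J a b (fun t => `|h t - c1 t|) by apply: J_ge0.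
by have := normr_ge0 k; nra.
Qed.

Lemma L1_approximable_cst k : L1_approximable (fun=> k).
Proof.
split=> [|e e0]; first exact: ig_cst.
exists (fun=> k); first by move=> t; exact: cvg_cst.
rewrite (@J_ext _ _ _ _ (fun=> 0)); first by rewrite J_cst// mul0r ltW.
by move=> s _; rewrite subrr normr0.
Qed.

Lemma L1_approximable_lim h : ig a b h ->
  (forall e, 0 < e -> exists2 h', L1_approximable h' &
     forall t, a <= t <= b -> `|h t - h' t| <= e) -> L1_approximable h.
Proof.
move=> ih H; split=> // e e0.
have l1 : 0 < b - a + 1 by have := ab; lra.
have e1 : 0 < e / 2 / (b - a + 1) by rewrite !divr_gt0.
have [h' [ih' ah'] hh'] := H _ e1.
have e2 : 0 < e / 2 by rewrite divr_gt0.
have [c cc hc] := ah' _ e2; have ic := ig_continuous cc; exists c => //.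
have I1 : ig a b (fun t => `|h' t - c t|) by apply: ig_abs; exact: igB.
have I2 : ig a b (fun t => `|h t - c t|) by apply: ig_abs; exact: igB.
apply: (@le_trans _ _ (J a b (fun t => e / 2 / (b - a + 1) + `|h' t - c t|))).
  apply: J_le => //; first by apply: igD => //; exact: ig_cst.
  move=> s sab; have := ler_distD (h' s) (h s) (c s); have := hh' s sab; lra.
rewrite JD//; last exact: ig_cst.
rewrite J_cst//.
have : e / 2 / (b - a + 1) * (b - a) <= e / 2.
  rewrite -[X in _ <= X](@divfK _ (b - a + 1)) ?gt_eqF//.
  by rewrite ler_wpM2l ?(ltW e1)//; lra.
lra.
Qed.

(** A Lebesgue measurable set is a Borel set up to a negligible one. *)
Lemma L1_approximable_indicator (E : set R) : measurable (E : set (lebR R)) ->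
  L1_approximable (\1_E : R -> R).
Proof.
move=> mE.
have := mE; rewrite -[X in X E]completed_caratheodory_measurable.
rewrite g_sigma_completed_algebra_genE => -[A mA [N nN AN]].
have mAl : measurable (A : set (lebR R)) by exact: sub_caratheodory.
have m1 : mf a b (\1_E : R -> R).
  by apply: (@measurable_funTS _ _ (lebR R)); exact: (measurable_indic mE).
have m2 : mf a b (\1_A : R -> R).
  by apply: (@measurable_funTS _ _ (lebR R)); exact: (measurable_indic mAl).
have b1 (B : set R) s : `|(\1_B : R -> R) s| <= 1.
  by rewrite indicE; case: (s \in B); rewrite ?normr1 ?normr0.
have i1 : ig a b (\1_E : R -> R) by apply: (ig_bounded m1 (M := 1)) => s _; exact: b1.
have i2 : ig a b (\1_A : R -> R) by apply: (ig_bounded m2 (M := 1)) => s _; exact: b1.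
split=> // e e0.
pose T := `[a, b]%classic : set (measurableTypeR R).
have mT : measurable T by exact: measurable_itv.
have mT1 : measurable_fun T (\1_A : measurableTypeR R -> R).
  by apply: measurable_funTS; exact: (measurable_indic mA).
have finT : (@lebesgue_measure R T < +oo)%E.
  by have -> : @lebesgue_measure R T = (b - a)%:E; [exact: leb_itv ab|exact: ltry].
have iT : (@lebesgue_measure R).-integrable T (EFin \o (\1_A : R -> R)).
  apply: measurable_bounded_integrable => //.
  by exists 1; split; [exact: num_real|move=> x x1 s _ /=; exact: le_trans (b1 _ _) (ltW x1)].
have [c_ [cc_ ic_ lim]] := approximation_continuous_integrable mT finT iT.
have /fine_fcvg/cvgrPdist_lt/(_ e e0)[k _ /(_ k (leqnn k)) /= hk] := lim.
have {}hk : `|0 - fine (\int[@lebesgue_measure R]_(z in T) `|(\1_A z - c_ k z)%:E|)%E| < e := hk.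
rewrite sub0r normrN in hk.
have cc : continuous (c_ k) := cc_ k.
have ic := ig_continuous cc; exists (c_ k) => //.
have I0 : ig a b (fun t => `|\1_E t - \1_A t|) by apply: ig_abs; exact: igB.
have I1 : ig a b (fun t => `|\1_A t - c_ k t|) by apply: ig_abs; exact: igB.
apply: (@le_trans _ _ (J a b (fun t => `|\1_E t - \1_A t| + `|\1_A t - c_ k t|))).
  apply: J_le; [by apply: ig_abs; exact: igB|exact: igD|].
  by move=> s _; exact: ler_distD.
rewrite JD// (@J_negligible N)//; first last.
- move=> s _ Ns; rewrite -AN !indicE in_setU.
  by rewrite (memNset Ns) orbF subrr normr0.
- exact: ig_mf.
rewrite add0r J_borel => [|//|//]; first last.
- apply: measurableT_comp => //; apply: measurable_funB => //.
  by apply: measurable_funTS; exact: continuous_measurable_fun.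
apply: ltW; apply: le_lt_trans hk; rewrite ger0_norm//.
by apply: fine_ge0; apply: integral_ge0.
Qed.

(** The layer cake formula, discretized with the step [d]. *)
Lemma layers_close (d x : R) N : 0 < d -> 0 <= x < N%:R * d ->
  `|x - \sum_(k < N) d * (k.+1%:R * d <= x)%R%:R| <= d.
Proof.
move=> d0 /andP[x0 xN].
suff : (N%:R * d <= x -> \sum_(k < N) d * (k.+1%:R * d <= x)%R%:R = N%:R * d) /\
       (x < N%:R * d -> x - d <= \sum_(k < N) d * (k.+1%:R * d <= x)%R%:R <= x).
  by move=> [_ /(_ xN)]; rewrite ler_norml; lra.
elim: N {xN} => [|N [IH1 IH2]].
  by rewrite big_ord0 mul0r; split=> //; move=> ?; lra.
rewrite big_ord_recr/=; split=> [xN|xN].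
  rewrite IH1; last by apply: le_trans xN; rewrite ler_wpM2r ?(ltW d0)// ler_nat.
  by rewrite xN mulr1 -natr1 mulrDl mul1r.
have -> : (N.+1%:R * d <= x) = false by rewrite leNgt xN.
rewrite mulr0 addr0.
have [Nx|xN'] := leP (N%:R * d) x; last exact: IH2.
by rewrite IH1//; move: xN; rewrite -natr1 mulrDl mul1r; lra.
Qed.

(** A bounded measurable function is a uniform limit of simple functions. *)
Lemma L1_approximable_bounded h B : mf a b h ->
  (forall t, a <= t <= b -> `|h t| <= B) -> L1_approximable h.
Proof.
move=> mh hB; have ih := ig_bounded mh hB.
apply: L1_approximable_lim => // e e0.
have [N hN] : exists N : nat, 2 * B / e < N%:R.
  by exists (Num.truncn (2 * B / e)).+1; exact: truncnS_gt.
have {}hN : 2 * B < N%:R * e by rewrite -ltr_pdivrMr.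
pose E k := D `&` [set t : lebR R | k.+1%:R * e <= h t + B].
have mE k : measurable (E k).
  have -> : E k = D `&` (h : lebR R -> R) @^-1` `[k.+1%:R * e - B, +oo[%classic.
    by apply/seteqP; split=> t /= [tD H]; split=> //; move: H;
      rewrite in_itv/= andbT lerBlDr.
  by apply: mh; [exact: leb_measurable_itv|exact: measurable_itv].
exists (fun t => - B + \sum_(k < N) e * (\1_(E k) t : R)).
  apply: L1_approximableD; first exact: L1_approximable_cst.
  elim: N {hN} => [|N IH].
    by under eq_fun do rewrite big_ord0; exact: L1_approximable_cst.
  under eq_fun do rewrite big_ord_recr.
  by apply: L1_approximableD => //; apply: L1_approximableZ; exact: L1_approximable_indicator.
move=> t tab; have hBt := hB t tab.
have xB : 0 <= h t + B < N%:R * e by move: hBt; rewrite ler_norml; lra.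
have := layers_close e0 xB.
rewrite (eq_bigr (fun k : 'I_N => e * (\1_(E k) t : R))); first by rewrite opprD addrA opprK.
move=> k _; rewrite indicE; congr (_ * _%:R); congr nat_of_bool.
apply/idP/idP => [H|]; first by rewrite inE; split=> //=; rewrite in_itv.
by rewrite inE => -[].
Qed.

Lemma continuous_approx_row m (v : R -> 'rV[R]_m) B e : 0 < e ->
  (forall k, mf a b (fun t => v t ord0 k)) ->
  (forall t, a <= t <= b -> enorm (v t) <= B) ->
  exists c : R -> 'rV[R]_m, [/\ forall k, mf a b (fun t => c t ord0 k),
    ig a b (fun t => enorm (v t - c t)),
    J a b (fun t => enorm (v t - c t)) <= e &
    exists2 h : R, 0 < h & forall s t, a <= s <= b -> a <= t <= b -> `|s - t| < h ->
      enorm (c s - c t) <= e].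
Proof.
move=> e0 mv vB.
have m1 : 0 < m%:R + 1 :> R by rewrite ltr_wpDl.
have e1 : 0 < e / (m%:R + 1) by rewrite divr_gt0.
have ex k : exists c, continuous c /\ J a b (fun t => `|v t ord0 k - c t|) <= e / (m%:R + 1).
  have [_ /(_ _ e1)[c cc hc]] : L1_approximable (fun t => v t ord0 k).
    apply: (L1_approximable_bounded (mv k) (B := B)) => t /vB.
    exact: le_trans (coord_le_enorm _ _).
  by exists c.
have [c hc] := choice ex.
have ick k := ig_continuous (hc k).1.
have ivk k : ig a b (fun t => v t ord0 k).
  by apply: (ig_bounded (mv k) (M := B)) => t /vB; exact: le_trans (coord_le_enorm _ _).
have iab k : ig a b (fun t => `|v t ord0 k - c k t|) by apply: ig_abs; exact: igB.
have mdiff : mf a b (fun t => enorm (v t - \row_k c k t)).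
  apply: mf_enorm => k.
  have -> : (fun t => (v t - \row_k c k t) ord0 k) = (fun t => v t ord0 k - c k t).
    by apply/funext => t; rewrite !mxE.
  by apply: measurable_funB; [exact: mv|exact: ig_mf].
have dle t : enorm (v t - \row_k c k t) <= \sum_(k < m) `|v t ord0 k - c k t|.
  by rewrite (le_trans (enorm_le_sum _))// ler_sum// => k _; rewrite !mxE.
have iS : ig a b (fun t => \sum_(k < m) `|v t ord0 k - c k t|) by exact: ig_sum.
have id : ig a b (fun t => enorm (v t - \row_k c k t)).
  apply: (@le_integrable _ _ _ _ _ _ _ (fun t : lebR R => (\sum_(k < m) `|v t ord0 k - c k t|)%:E)) iS.
  - exact: leb_measurable_itv.
  - exact/measurable_EFinP.
  - move=> t _; rewrite lee_fin ger0_norm ?enorm_ge0// ger0_norm//.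
    by apply: sumr_ge0.
have small : \sum_(k < m) (e / (m%:R + 1)) <= e.
  rewrite sumr_const card_ord -[X in X <= _]mulr_natr -mulrA ler_piMr ?(ltW e0)//.
  by rewrite mulrC ler_pdivrMr// mul1r lerDl.
exists (fun t => \row_k c k t); split => //.
- move=> k; have -> : (fun t => (\row_k c k t) ord0 k) = c k by apply/funext => t; rewrite mxE.
  exact: ig_mf.
- apply: (le_trans (J_le id iS (fun s _ => dle s))).
  rewrite J_sum//; apply: le_trans small.
  by apply: ler_sum => k _; exact: (hc k).2.
have uc k : exists h : R, 0 < h /\ forall s t, a <= s <= b -> a <= t <= b -> `|s - t| < h ->
    `|c k s - c k t| <= e / (m%:R + 1).
  have cw : {within `[a, b], continuous (c k : R -> R)} by apply: continuous_subspaceT; exact: (hc k).1.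
  have [h h0 hh] := compact_uniformly_continuous (@segment_compact R a b) cw e1.
  exists h; split=> // s t sab tab st; apply: ltW.
  by apply: (hh s t) => //; rewrite /= in_itv.
have [h hh] := choice uc.
exists (\big[Num.min/1]_k h k).
  by apply: lt_bigmin => // k _; exact: (hh k).1.
move=> s t sab tab st; apply: (le_trans (enorm_le_sum _)); apply: le_trans small.
apply: ler_sum => k _; rewrite !mxE; apply: (hh k).2 => //.
by apply: (lt_le_trans st); exact: bigmin_le.
Qed.

End ContinuousApproximation.

Section CompactDisturbances.
Variables (R : realType) (n p q : nat) (g : game R n p q).
Hypothesis hg : standing_assumptions g.
Local Notation a := (t0 g).
Local Notation b := (theta g).

Lemma L2ball_nbhs m (s t : R) (v : L2space m s t) r : 0 < r -> L2set s t v ->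
  L2norm s t (fun=> 0 : 'rV[R]_m) = 0%E -> nbhs v (L2ball (v, r)).
Proof.
move=> r0 Lv L0.
apply: open_nbhs_nbhs; split; last first.
  split=> //=; rewrite (_ : (fun t => v t - v t) = fun=> 0); first by rewrite L0 lte_fin.
  by apply/funext => x; rewrite subrr.
exists [set L2ball (v, r)]; last by rewrite bigcup_set1.
by move=> A ->; exact: finI_from1.
Qed.

Lemma disturbance_bounded : exists B : R, forall v t, disturbances g v ->
  a <= t <= b -> enorm (v t) <= B.
Proof.
have := Q_compact hg => /compact_bounded[M [_ hM]].
exists (q%:R * (`|M| + 1)) => v t [_ Qv] tT; apply: (le_trans (enorm_le_norm _)).
rewrite ler_wpM2l//; apply: (hM (`|M| + 1)); first by have := ler_norm M; lra.
by apply: Qv; rewrite /= in_itv.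
Qed.

Lemma mf_rowB (s t : R) m (v w : R -> 'rV[R]_m) : (forall k, mf s t (fun r => v r ord0 k)) ->
  (forall k, mf s t (fun r => w r ord0 k)) ->
  forall k, mf s t (fun r => (v r - w r) ord0 k).
Proof.
move=> mv mw k.
have -> : (fun r => (v r - w r) ord0 k) = (fun r => v r ord0 k - w r ord0 k).
  by apply/funext => r; rewrite !mxE.
by apply: measurable_funB; [exact: mv|exact: mw].
Qed.

Lemma L2norm_bounded m (s t : R) (w : R -> 'rV[R]_m) B :
  (forall k, mf s t (fun r => w r ord0 k)) ->
  (forall r, s <= r <= t -> enorm (w r) <= B) ->
  L2norm s t w = (Num.sqrt (J s t (fun r => enorm (w r) ^+ 2)))%:E.
Proof.
move=> mw wB.
have i2 : ig s t (fun r => enorm (w r) ^+ 2).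
  apply: (ig_bounded (M := B ^+ 2)) => [|r /wB h].
    by under eq_fun do rewrite expr2; apply: measurable_funM; exact: mf_enorm.
  rewrite ger0_norm ?sqr_ge0// ler_pXn2r ?nnegrE ?enorm_ge0//.
  exact: le_trans (enorm_ge0 _) h.
have J0 : 0 <= J s t (fun r => enorm (w r) ^+ 2) by apply: J_ge0 => r _; exact: sqr_ge0.
rewrite -powR12_sqrt// -poweR_EFin /L2norm; congr (_ `^ _)%E.
rewrite /J fineK//; apply: integrable_fin_num => //; exact: leb_measurable_itv.
Qed.

(** By the inequality [y <= r + y ^+ 2 / r] under the integral. *)
Lemma L1_le_L2 m (s t r B : R) (w : R -> 'rV[R]_m) : s <= t ->
  (forall k, mf s t (fun x => w x ord0 k)) ->
  (forall x, s <= x <= t -> enorm (w x) <= B) -> 0 < r ->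
  (L2norm s t w < r%:E)%E ->
  J s t (fun x => enorm (w x)) <= r * (t - s + 1).
Proof.
move=> st mw wB r0; rewrite (L2norm_bounded mw wB) lte_fin => h.
have J0 : 0 <= J s t (fun x => enorm (w x) ^+ 2) by apply: J_ge0 => x _; exact: sqr_ge0.
have {}h : J s t (fun x => enorm (w x) ^+ 2) < r ^+ 2.
  by rewrite -(sqr_sqrtr J0) ltr_pXn2r ?nnegrE ?sqrtr_ge0// ltW.
have i2 : ig s t (fun x => enorm (w x) ^+ 2).
  apply: (ig_bounded (M := B ^+ 2)) => [|x /wB hx].
    by under eq_fun do rewrite expr2; apply: measurable_funM; exact: mf_enorm.
  rewrite ger0_norm ?sqr_ge0// ler_pXn2r ?nnegrE ?enorm_ge0//.
  exact: le_trans (enorm_ge0 _) hx.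
have i1 : ig s t (fun x => enorm (w x)).
  by apply: (ig_bounded (mf_enorm mw) (M := B)) => x /wB; rewrite ger0_norm// enorm_ge0.
have ii : ig s t (fun x => r^-1 * enorm (w x) ^+ 2) by exact: igZ.
apply: (@le_trans _ _ (J s t (fun x => r + r^-1 * enorm (w x) ^+ 2))).
  apply: J_le => //; first by apply: igD => //; exact: ig_cst.
  move=> x _; rewrite -(ler_pM2l r0) mulrDr mulrA mulfV ?gt_eqF// mul1r.
  by have := enorm_ge0 (w x); nra.
rewrite JD//; last exact: ig_cst.
rewrite J_cst// JZ// [X in _ <= X]mulrDr mulr1 lerD2l.
by rewrite ler_pdivrMl// -expr2 ltW.
Qed.

(** In a compact subset of [L_2], finitely many continuous functions come
    uniformly close in mean to all disturbances; they have a common modulus of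
    continuity. *)
Lemma compact_disturbances (V : set (L2space q a b)) e :
  V `<=` disturbances g -> compact V -> 0 < e ->
  exists2 h : R, 0 < h & forall v, V v -> exists c : R -> 'rV[R]_q,
    [/\ ig a b (fun t => enorm (v t - c t)),
      J a b (fun t => enorm (v t - c t)) <= e &
      forall s t, a <= s <= b -> a <= t <= b -> `|s - t| <= h ->
        enorm (c s - c t) <= e].
Proof.
move=> Vd /compact_near_coveringP cV e0.
have ab := ltW (t0_lt_theta hg).
have [B hB] := disturbance_bounded.
pose P (h : R) (v : L2space q a b) := V v -> exists c : R -> 'rV[R]_q,
    [/\ ig a b (fun t => enorm (v t - c t)),
      J a b (fun t => enorm (v t - c t)) <= e &
      forall s t, a <= s <= b -> a <= t <= b -> `|s - t| <= h ->
        enorm (c s - c t) <= e].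
have L0 : L2norm a b (fun=> 0 : 'rV[R]_q) = 0%E.
  rewrite (@L2norm_bounded _ _ _ _ 0) => [| |r _]; last by rewrite enorm0.
    rewrite (@J_ext _ _ _ _ (fun=> 0)) => [|r _]; last by rewrite enorm0 expr0n.
    by rewrite J_cst// mul0r sqrtr0.
  by move=> k; rewrite [X in mf _ _ X](_ : _ = fun=> 0); [exact: measurable_cst|apply/funext => r; rewrite mxE].
have : \forall h \near 0^'+, V `<=` P h.
  apply: (cV R (0^'+)) => v Vv.
  have dv := Vd v Vv.
  have e2 : 0 < e / 2 by rewrite divr_gt0.
  have [c [mc ic hc [h0 h00 hh]]] := continuous_approx_row ab e2 dv.1 (fun t => hB v t dv).
  have e2e : e / 2 <= e by lra.
  have l1 : 0 < b - a + 1 by lra.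
  have r0 : 0 < e / 2 / (b - a + 1) by rewrite divr_gt0.
  have Lv : L2set a b v.
    by split; [exact: dv.1|rewrite (L2norm_bounded dv.1 (fun t => hB v t dv)); exact: ltry].
  near=> w h => Vw; have dw := Vd w Vw.
  have : L2ball (v, e / 2 / (b - a + 1)) w by near: w; exact: L2ball_nbhs.
  move=> [_ /= wv].
  have mwv := mf_rowB dw.1 dv.1.
  have bwv t : a <= t <= b -> enorm (w t - v t) <= 2 * B.
    move=> tT; have := hB w t dw tT; have := hB v t dv tT.
    by have := ler_enormD (w t) (- v t); rewrite enormN; lra.
  have jwv := L1_le_L2 ab mwv bwv r0 wv.
  have iwv : ig a b (fun t => enorm (w t - v t)).
    by apply: (ig_bounded (mf_enorm mwv) (M := 2 * B)) => t /bwv; rewrite ger0_norm// enorm_ge0.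
  have isum : ig a b (fun t => enorm (w t - v t) + enorm (v t - c t)) by exact: igD.
  have le1 t : enorm (w t - c t) <= enorm (w t - v t) + enorm (v t - c t).
    exact: ler_distD_enorm.
  have iw : ig a b (fun t => enorm (w t - c t)).
    apply: (@le_integrable _ _ _ _ _ _ _ (fun t : lebR R => (enorm (w t - v t) + enorm (v t - c t))%:E)) isum.
    - exact: leb_measurable_itv.
    - by apply/measurable_EFinP; exact: (mf_enorm (mf_rowB dw.1 mc)).
    - move=> t _; rewrite lee_fin ger0_norm ?enorm_ge0// ger0_norm//.
      by rewrite addr_ge0// enorm_ge0.
  exists c; split=> //.
  - apply: (le_trans (J_le iw isum (fun t _ => le1 t))); rewrite JD//.
    by rewrite (splitr e) lerD//; move: jwv; rewrite divfK ?gt_eqF.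
  - move=> s t sT tT st; have hh0 : h < h0 by near: h; exact: nbhs_right_lt.
    exact: le_trans (hh s t sT tT (le_lt_trans st hh0)) e2e.
move=> H; near (0 : R)^'+ => h; exists h; first by near: h; exact: nbhs_right_gt.
have hP : V `<=` P h by near: h.
by move=> v Vv; exact: hP.
Unshelve. all: by end_near. Qed.

(** At some [r] the distance to [c] hardly exceeds its mean; the value there,
    unlike the one of [c], can be taken by a disturbance. *)
Lemma typical_value m (s t e : R) (v c : R -> 'rV[R]_m) : s < t -> 0 < e ->
  (forall k, mf s t (fun r => v r ord0 k)) ->
  ig s t (fun r => enorm (v r - c r)) ->
  (forall r r', s <= r <= t -> s <= r' <= t -> enorm (c r - c r') <= e) ->
  exists2 r, s <= r <= t & ig s t (fun x => enorm (v x - v r)) /\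
    J s t (fun x => enorm (v x - v r)) <=
      2 * J s t (fun x => enorm (v x - c x)) + 2 * e * (t - s).
Proof.
move=> st e0 mv iv hc; set j := J s t _.
have ts0 : 0 < t - s by lra.
have [r rst hr] : exists2 r, s <= r <= t & enorm (v r - c r) * (t - s) <= j + e * (t - s).
  apply: contrapT => no.
  have : (j / (t - s) + e) * (t - s) <= j.
    rewrite -[X in X <= _]J_cst ?(ltW st)//.
    apply: J_le => // [|x xst]; first exact: ig_cst.
    rewrite leNgt; apply/negP => h; apply: no; exists x => //.
    rewrite -ler_pdivlMr// mulrDl mulfK ?gt_eqF//; exact: ltW.
  by rewrite mulrDl divfK ?gt_eqF//; have := mulr_gt0 e0 ts0; lra.
exists r => //.
have bd x : s <= x <= t -> enorm (v x - v r) <= enorm (v x - c x) + (e + enorm (v r - c r)).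
  move=> xst; rewrite (le_trans (ler_distD_enorm (c x) _ _))// lerD2l.
  rewrite (le_trans (ler_distD_enorm (c r) _ _))// (enormB (c r)) lerD2r.
  exact: hc.
have isum : ig s t (fun x => enorm (v x - c x) + (e + enorm (v r - c r))).
  by apply: igD => //; exact: ig_cst.
have ivr : ig s t (fun x => enorm (v x - v r)).
  apply: (@le_integrable _ _ _ _ _ _ _ (fun x : lebR R => (enorm (v x - c x) + (e + enorm (v r - c r)))%:E)) isum.
  - exact: leb_measurable_itv.
  - apply/measurable_EFinP; apply: mf_enorm; apply: mf_rowB => k; [exact: mv|exact: measurable_cst].
  - move=> x; rewrite /= in_itv/= => xst; rewrite lee_fin ger0_norm ?enorm_ge0//.
    exact: le_trans (bd x xst) (ler_norm _).
split=> //; apply: (le_trans (J_le ivr isum bd)).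
rewrite JD//; last exact: ig_cst.
rewrite J_cst ?(ltW st)// -/j; nra.
Qed.

End CompactDisturbances.

(** * The model motion of the constructed strategy *)

Section Probing.
Variables (R : realType) (n p q : nat) (g : game R n p q).
Hypothesis hg : standing_assumptions g.
Local Notation f := (dyn g).
Local Notation a := (t0 g).
Local Notation b := (theta g).
Local Notation tau := (tau g).
Local Notation L := (lip_const hg).
Local Notation Rb := (reach_radius hg).
Local Notation M := (speed hg).
Implicit Types (D : seq R).

Lemma dmin_gt0 D : Defs.partition g D -> 0 < dmin g D.
Proof.
move=> pD; rewrite /dmin big_seq_cond.
apply: (big_ind (fun x => 0 < x)) => [|x y x0 y0|i].
- by rewrite subr_gt0 t0_lt_theta.
- by rewrite lt_min x0.
- rewrite mem_index_iota andbT => /andP[i0 iD]; rewrite subr_gt0.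
  by have := tau_S pD (i := i.-1); rewrite prednK//; apply; exact: ltnW.
Qed.

Lemma dmin_le D i : (i.+1 < size D)%N -> dmin g D <= tau D i.+1 - tau D i.
Proof.
move=> iD; apply: (@ge_bigmin_seq _ _ _ _ (b - a) i.+1 xpredT (fun i => tau D i - tau D i.-1)) => //.
by rewrite mem_index_iota.
Qed.

Lemma balanced_le D : Defs.partition g D -> balanced g D -> Dmax g D <= 3 * dmin g D.
Proof. by move=> pD; rewrite /balanced ler_pdivrMr// dmin_gt0. Qed.

Section Probe.
Variables (eps : R) (net : seq 'rV[R]_p).
Local Notation probe := (probe g eps net).

Lemma probe0 D i : probe D i 0 = tau D i - eps * dmin g D.
Proof. by rewrite /Defs.probe mul0r mul0r addr0. Qed.

Lemma probe_step D i j : (0 < size net)%N ->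
  probe D i j.+1 - probe D i j = eps * dmin g D / (size net)%:R.
Proof.
move=> n0; have n1 : (size net)%:R != 0 :> R by rewrite pnatr_eq0 -lt0n.
by rewrite /Defs.probe -natr1; field.
Qed.

Lemma probe_last D i : (0 < size net)%N -> probe D i (size net) = tau D i.
Proof.
move=> n0; have n1 : (size net)%:R != 0 :> R by rewrite pnatr_eq0 -lt0n.
by rewrite /Defs.probe; field.
Qed.

Lemma probe_mono D i j k : 0 <= eps -> Defs.partition g D -> (j <= k)%N ->
  probe D i j <= probe D i k.
Proof.
move=> e0 pD jk; rewrite /Defs.probe lerD2l ler_wpM2r ?invr_ge0//.
by rewrite ler_wpM2r ?ler_nat// opprB addrCA subrr addr0 mulr_ge0// ltW// dmin_gt0.
Qed.

End Probe.

(** Uniform continuity in the disturbance, in a form that can be integrated. *)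
Lemma dyn_disturbance_modulus rho : 0 < rho -> exists2 C : R, 0 <= C &
  forall t x u v v', a <= t <= b -> 1 + enorm x <= Rb -> Pset g u -> Qset g v ->
    Qset g v' -> enorm (f t x u v - f t x u v') <= rho + C * enorm (v - v').
Proof.
move=> r0; have [d d0 hd] := dyn_uniform hg r0; have M0 := speed_ge0 hg.
have C0 : 0 <= 2 * M / d by rewrite divr_ge0 ?(ltW d0)//; lra.
exists (2 * M / d) => //.
move=> t x u v v' tT xR Pu Qv Qv'.
have e0 := enorm_ge0 (v - v').
have [vv|vv] := ltP (enorm (v - v')) d.
  apply: (@le_trans _ _ rho); first by apply: hd => //; rewrite subrr ?normr0 ?enorm0.
  by rewrite lerDl mulr_ge0.
have K0 := growth_rate_gt0 hg.
have h1 := dyn_growth hg x tT Pu Qv; have h2 := dyn_growth hg x tT Pu Qv'.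
have h3 : growth_rate hg * (1 + enorm x) <= M by rewrite /speed ler_wpM2l// ltW.
apply: (@le_trans _ _ (2 * M)).
  by have := ler_enormD (f t x u v) (- f t x u v'); rewrite enormN; lra.
apply: (@le_trans _ _ (2 * M / d * enorm (v - v'))); last by rewrite lerDr ltW.
rewrite -[X in X <= _](@divfK _ d) ?gt_eqF//.
by rewrite ler_wpM2l.
Qed.

Lemma dyn_control_modulus omega : 0 < omega -> exists2 e0 : R, 0 < e0 &
  forall t x u u' v, a <= t <= b -> 1 + enorm x <= Rb -> Pset g u -> Pset g u' ->
    Qset g v -> enorm (u - u') <= e0 -> enorm (f t x u v - f t x u' v) <= omega.
Proof.
move=> o0; have [d d0 hd] := dyn_uniform hg o0.
exists (d / 2); first by rewrite divr_gt0.
move=> t x u u' v tT xR Pu Pu' Qv uu.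
by apply: hd => //; rewrite ?subrr ?normr0 ?enorm0//; lra.
Qed.

Section Estimates.
Variables (eps : R) (net : seq 'rV[R]_p) (D : seq R).
Variables (h eta rho C : R).
Hypotheses (eps01 : 0 < eps < 1) (net0 : (0 < size net)%N).
Hypothesis netP : forall j, (j < size net)%N -> Pset g (nth 0 net j).
Hypothesis pD : Defs.partition g D.
Hypotheses (Dh : Dmax g D <= h) (tm : time_modulus hg h eta).
Hypothesis C0 : 0 <= C.
Hypothesis Cmod : forall t x u v v', a <= t <= b -> 1 + enorm x <= Rb ->
  Pset g u -> Qset g v -> Qset g v' ->
  enorm (f t x u v - f t x u v') <= rho + C * enorm (v - v').
Variables (x : R -> 'rV[R]_n) (u : R -> 'rV[R]_p) (v : R -> 'rV[R]_q) (z : 'rV[R]_n).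
Hypotheses (Gz : G0 g z) (cu : controls g u) (dv : disturbances g v).
Hypothesis sx : solution g a b z u v x.
Local Notation probe := (probe g eps net D).
Local Notation d := (dmin g D).

Let gx : good_path hg x. Proof. exact: (solution_good_path hg Gz cu dv sx). Qed.

Let xR t : a <= t <= b -> 1 + enorm (x t) <= Rb.
Proof.
move=> tT; apply: (@reach_ball _ _ _ _ _ hg t); first by case/andP: tT.
apply: (solution_reach (lexx _) (lexx _) (controls_admissible cu dv) sx _ tT).
exact: reach_init.
Qed.

Let Pu t : a <= t <= b -> Pset g (u t).
Proof. by move=> tT; apply: cu.2; rewrite /= in_itv. Qed.

Let Qv t : a <= t <= b -> Qset g (v t).
Proof. by move=> tT; apply: dv.2; rewrite /= in_itv. Qed.

Lemma probe_start_ge i : (i.+1 < size D)%N -> tau D i <= probe i.+1 0.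
Proof.
move=> iD; rewrite probe0; have := dmin_le iD; have := dmin_gt0 pD; have := eps01.
by move=> /andP[e0 e1] d0 dl; nra.
Qed.

Let frozen s t u1 v1 : a <= s <= b -> a <= t <= b -> `|s - t| <= h ->
  Pset g u1 -> Qset g v1 ->
  enorm (f s (x s) u1 v1 - f t (x t) u1 v1) <= eta.
Proof.
move=> sT tT st Pu1 Qv1; apply: tm => //; [exact: xR|exact: xR|].
by apply: (le_trans (gx.2 t s tT sT)); rewrite ler_wpM2l ?speed_ge0.
Qed.

(** Probing the disturbance with the controls of the net: the average velocity
    under the probing control differs from the velocity for a disturbance [vh]
    by what the disturbance differs from [vh] in mean. *)
Lemma mismatch_typical i vh : (i.+1 < size D)%N -> Qset g vh ->
  0 <= eta -> 0 <= rho ->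
  (forall j, (j < size net)%N -> forall t, probe i.+1 j <= t < probe i.+1 j.+1 ->
     u t = nth 0 net j) ->
  ig (probe i.+1 0) (tau D i.+1) (fun t => enorm (v t - vh)) ->
  mismatch g eps net D i.+1 x vh <= eta + rho +
    C * ((size net)%:R / (eps * d)) *
    J (probe i.+1 0) (tau D i.+1) (fun t => enorm (v t - vh)).
Proof.
move=> iD Qvh eta0 rho0 hu ivh; have pD' := pD; have Dh' := Dh; have C0' := C0.
have /andP[e0 e1] := eps01; have d0 := dmin_gt0 pD.
have ps := probe_start_ge iD.
set N := (size net)%:R : R; have N0 : 0 < N by rewrite ltr0n.
have J0 : 0 <= J (probe i.+1 0) (tau D i.+1) (fun t => enorm (v t - vh)).
  by apply: J_ge0 => *; exact: enorm_ge0.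
have K0 : 0 <= C * (N / (eps * d)).
  by rewrite mulr_ge0// divr_ge0 ?(ltW N0)// mulr_ge0// ltW.
rewrite /mismatch big_seq_cond; apply: bigmax_le => [|j].
  by rewrite addr_ge0 ?addr_ge0// mulr_ge0.
rewrite mem_index_iota andbT => /= jn.
have /andP[ai ib] := tau_in i pD; have /andP[ai' ib'] := tau_in i.+1 pD.
set s := probe i.+1 j; set t := probe i.+1 j.+1.
have st : t - s = eps * d / N by exact: probe_step.
have st0 : 0 < t - s by rewrite st !divr_gt0// mulr_gt0.
have ps' : probe i.+1 0 <= s by exact: (probe_mono _ _ (ltW e0) pD).
have ti : t <= tau D i.+1.
  by rewrite -(probe_last eps D i.+1 net0); exact: (probe_mono _ _ (ltW e0) pD).
have as_ : a <= s by lra.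
have tb : t <= b by lra.
have [iF Ex] := solution_incr sx as_ (ltac:(lra) : s <= t) tb.
set F := velocity g x u v in iF Ex.
set fs := f (tau D i.+1) (x (tau D i.+1)) (nth 0 net j) vh.
have ifs : vig s t (fun=> fs) by move=> k; exact: ig_cst.
have Efs : (t - s) *: fs = vJ s t (fun=> fs).
  by apply/rowP => k; rewrite !mxE J_cst 1?mulrC//; lra.
have -> : slope g eps net D i.+1 j x - fs = (t - s)^-1 *: vJ s t (fun r => F r - fs).
  rewrite vJB// -Efs scalerBr scalerA mulVf ?gt_eqF// scale1r; congr (_ - _).
  by rewrite /slope -/s -/t; congr (_ *: _); rewrite Ex addrC addKr.
have iv' : ig s t (fun r => enorm (v r - vh)) by exact: (ig_sub ps' ti ivh).
have tiS : tau D i.+1 - tau D i <= Dmax g D by exact: (tau_step_le g (ltnW iD)).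
have iFf : ig s t (fun r => enorm (F r - fs)).
  apply: (ig_bounded (M := M + enorm fs)).
    apply: mf_enorm => k; apply: (mf_rowB (w := fun=> fs)) => k'; last exact: measurable_cst.
    exact: ig_mf.
  move=> r rst; rewrite ger0_norm ?enorm_ge0// (le_trans (ler_enormD _ _))// enormN lerD2r.
  have rT : a <= r <= b by lra.
  have := velocity_bound hg x (lexx _) (lexx _) (controls_admissible cu dv) rT.
  move/le_trans; apply; rewrite /speed ler_wpM2l ?(ltW (growth_rate_gt0 hg))//.
  exact: xR.
have key r : s <= r < t -> enorm (F r - fs) - C * enorm (v r - vh) <= eta + rho.
  move=> rst; have rT : a <= r <= b by lra.
  have iT : a <= tau D i.+1 <= b by lra.
  have ur : u r = nth 0 net j by apply: hu => //; rewrite -/s -/t; lra.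
  rewrite /F /velocity ur.
  have Pj := netP jn; have Qr := Qv rT.
  have h1 := Cmod rT (xR rT) Pj Qr Qvh.
  have h2 : enorm (f r (x r) (nth 0 net j) vh - fs) <= eta.
    apply: frozen => //; rewrite distrC ger0_norm; lra.
  have := ler_distD_enorm (f r (x r) (nth 0 net j) vh) (f r (x r) (nth 0 net j) (v r)) fs.
  lra.
rewrite enormZ ger0_norm ?invr_ge0 ?(ltW st0)//.
have iCv : ig s t (fun r => C * enorm (v r - vh)) by exact: igZ.
have h1 : enorm (vJ s t (fun r => F r - fs)) <= J s t (fun r => enorm (F r - fs)).
  by apply: enorm_vJ_le => //; exact: vigB.
have h2 : J s t (fun r => enorm (F r - fs)) - C * J s t (fun r => enorm (v r - vh)) <=
    (eta + rho) * (t - s).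
  rewrite -JZ// -JB//; apply: J_le_half => //; [lra|exact: igB].
have h3 : J s t (fun r => enorm (v r - vh)) <=
    J (probe i.+1 0) (tau D i.+1) (fun t => enorm (v t - vh)).
  have i2 : ig s (tau D i.+1) (fun r => enorm (v r - vh)) by exact: (ig_sub ps' (lexx _) ivh).
  have le_st : s <= t by rewrite -subr_ge0 ltW.
  rewrite (J_split ps' (le_trans le_st ti) ivh) (J_split le_st ti i2).
  have : 0 <= J (probe i.+1 0) s (fun r => enorm (v r - vh)).
    by apply: J_ge0 => *; exact: enorm_ge0.
  have : 0 <= J t (tau D i.+1) (fun r => enorm (v r - vh)).
    by apply: J_ge0 => *; exact: enorm_ge0.
  lra.
set jj := J (probe i.+1 0) _ _ in J0 h3 *.
rewrite mulrC ler_pdivrMr//.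
have -> : (eta + rho + C * (N / (eps * d)) * jj) * (t - s) = (eta + rho) * (t - s) + C * jj.
  by rewrite st; field; rewrite !gt_eqF.
have := ler_wpM2l C0 h3; lra.
Qed.

(** The estimate [vb] explains the slopes at least as well as [vh] does: at each
    net control the two velocities differ by at most twice the mismatch. *)
Lemma identified omega i vh vb : (i < size D)%N -> Qset g vh ->
  is_net g eps net ->
  (forall t x u u' v, a <= t <= b -> 1 + enorm x <= Rb -> Pset g u -> Pset g u' ->
    Qset g v -> enorm (u - u') <= eps -> enorm (f t x u v - f t x u' v) <= omega) ->
  argmin (Qset g) (mismatch g eps net D i x) vb ->
  forall u1, Pset g u1 ->
    enorm (f (tau D i) (x (tau D i)) u1 vh - f (tau D i) (x (tau D i)) u1 vb) <=
      2 * omega + 2 * mismatch g eps net D i x vh.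
Proof.
move=> iD Qvh [_ netC] om [Qvb mb] u1 Pu1.
have iT := tau_in i pD; have Ri := xR iT.
have [j jn uj] := netC u1 Pu1; have Pj := netP jn.
set fi := f (tau D i) (x (tau D i)) in mb *.
have mm v1 : enorm (slope g eps net D i j x - fi (nth 0 net j) v1) <= mismatch g eps net D i x v1.
  apply: (@le_bigmax_seq _ _ _ _ 0 j xpredT (fun j =>
    enorm (slope g eps net D i j x - fi (nth 0 net j) v1))) => //.
  by rewrite mem_index_iota.
have o1 : enorm (fi u1 vh - fi (nth 0 net j) vh) <= omega by exact: om.
have o2 : enorm (fi u1 vb - fi (nth 0 net j) vb) <= omega by exact: om.
have m1 := mm vh; have m2 := le_trans (mm vb) (mb vh Qvh).
have := ler_distD_enorm (fi (nth 0 net j) vh) (fi u1 vh) (fi u1 vb).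
have := ler_distD_enorm (fi (nth 0 net j) vb) (fi (nth 0 net j) vh) (fi u1 vb).
have := ler_distD_enorm (slope g eps net D i j x) (fi (nth 0 net j) vh) (fi (nth 0 net j) vb).
rewrite (enormB (fi (nth 0 net j) vb) (fi u1 vb)).
rewrite (enormB (fi (nth 0 net j) vh) (slope _ _ _ _ _ _ _)); lra.
Qed.

(** Until the next probes the control is [ui], whose effect under [vb] is known;
    the probes themselves only last [eps * d], which gives the term with [M]. *)
Lemma defect_estimate m i ui vb vh : (i.+1 < size D)%N ->
  Pset g ui -> Qset g vb -> Qset g vh -> 0 <= eta -> 0 <= rho -> 0 <= m ->
  (forall u1, Pset g u1 ->
    enorm (f (tau D i) (x (tau D i)) u1 vh - f (tau D i) (x (tau D i)) u1 vb) <= m) ->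
  (forall t, tau D i <= t < probe i.+1 0 -> u t = ui) ->
  ig (tau D i) (tau D i.+1) (fun t => enorm (v t - vh)) ->
  J (tau D i) (tau D i.+1) (fun s => enorm (velocity g x u v s -
      velocity g x (cst ui) (cst vb) s)) <=
    (2 * eta + rho + m) * (tau D i.+1 - tau D i) + 2 * M * (eps * d) +
    C * J (tau D i) (tau D i.+1) (fun t => enorm (v t - vh)).
Proof.
move=> iD Pui Qvb Qvh eta0 rho0 m0 hm hu ivh; have Dh' := Dh; have C0' := C0.
have /andP[e0 e1] := eps01; have d0 := dmin_gt0 pD.
have ps := probe_start_ge iD.
have /andP[ai ib] := tau_in i pD; have /andP[ai' ib'] := tau_in i.+1 pD.
have ii := tau_S pD (ltnW iD).
have ad := admissible_sub ai ib' (controls_admissible cu dv).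
have ad' := admissible_sub ai ib' (controls_admissible (controls_cst Pui) (disturbances_cst Qvb)).
have cx : Cts (tau D i) (tau D i.+1) x by exact: (Cts_sub ai ib' (solution_Cts sx)).
have rx t : tau D i <= t <= tau D i.+1 -> reach hg t (x t).
  move=> tii; apply: (solution_reach (lexx _) (lexx _) (controls_admissible cu dv) sx _ _).
    exact: reach_init.
  lra.
have idf := defect_ig ai ib' ad ad' cx rx.
set df := fun s => enorm _ in idf *.
have pl : probe i.+1 0 <= tau D i.+1 by rewrite probe0 gerBl mulr_ge0// ltW.
rewrite (J_split ps pl idf) (J_split ps pl ivh).
have i1 : ig (tau D i) (probe i.+1 0) df by exact: (ig_sub (lexx _) pl idf).
have i2 : ig (probe i.+1 0) (tau D i.+1) df by exact: (ig_sub ps (lexx _) idf).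
have iv1 : ig (tau D i) (probe i.+1 0) (fun t => enorm (v t - vh)).
  exact: (ig_sub (lexx _) pl ivh).
have h2 : J (probe i.+1 0) (tau D i.+1) df <= 2 * M * (eps * d).
  have -> : eps * d = tau D i.+1 - probe i.+1 0 by rewrite probe0 opprB addrCA subrr addr0.
  rewrite -J_cst//; apply: J_le => //; first exact: ig_cst.
  move=> s sp; have sii : tau D i <= s <= tau D i.+1 by lra.
  rewrite /df (le_trans (ler_enormD _ _))// enormN.
  have v1 := velocity_bound hg x ai ib' ad sii.
  have v2 := velocity_bound hg x ai ib' ad' sii.
  have : growth_rate hg * (1 + enorm (x s)) <= M.
    rewrite /speed ler_wpM2l ?(ltW (growth_rate_gt0 hg))//; apply: xR; lra.
  lra.
have h3 : 0 <= J (probe i.+1 0) (tau D i.+1) (fun t => enorm (v t - vh)).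
  by apply: J_ge0 => *; exact: enorm_ge0.
have tS : tau D i.+1 - tau D i <= Dmax g D by exact: (tau_step_le g (ltnW iD)).
have h1 : J (tau D i) (probe i.+1 0) df -
    C * J (tau D i) (probe i.+1 0) (fun t => enorm (v t - vh)) <=
    (2 * eta + rho + m) * (probe i.+1 0 - tau D i).
  rewrite -JZ// -JB//; last exact: igZ.
  apply: J_le_half => //; first by apply: igB => //; exact: igZ.
  move=> s si; have sT : a <= s <= b by lra.
  have iT : a <= tau D i <= b by lra.
  have us : u s = ui by exact: hu.
  rewrite /df /velocity us /cst.
  set fs := f s (x s) ui; set fi := f (tau D i) (x (tau D i)) ui.
  have st : `|s - tau D i| <= h by rewrite ger0_norm; lra.
  have k1 : enorm (fs (v s) - fi (v s)) <= eta by apply: frozen => //; exact: Qv.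
  have k2 : enorm (fi (v s) - fi vh) <= rho + C * enorm (v s - vh).
    by apply: Cmod => //; [exact: xR|exact: Qv].
  have k3 : enorm (fi vh - fi vb) <= m by exact: hm.
  have k4 : enorm (fs vb - fi vb) <= eta by exact: frozen.
  have := ler_distD_enorm (fi (v s)) (fs (v s)) (fs vb).
  have := ler_distD_enorm (fi vh) (fi (v s)) (fs vb).
  have := ler_distD_enorm (fi vb) (fi vh) (fs vb).
  rewrite (enormB (fi vb)); lra.
have k0 : 0 <= 2 * eta + rho + m by lra.
have h4 : (2 * eta + rho + m) * (probe i.+1 0 - tau D i) <=
   (2 * eta + rho + m) * (tau D i.+1 - tau D i) by rewrite ler_wpM2l//; lra.
have h5 := mulr_ge0 C0 h3.
lra.
Qed.

End Estimates.

End Probing.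

Section ModelMotion.
Variables (R : realType) (n p q : nat) (g : game R n p q).
Hypothesis hg : standing_assumptions g.
Local Notation f := (dyn g).
Local Notation a := (t0 g).
Local Notation b := (theta g).
Local Notation tau := (tau g).
Local Notation L := (lip_const hg).
Local Notation Rb := (reach_radius hg).
Local Notation M := (speed hg).
Implicit Types (D : seq R).

(** What the construction provides along one motion [x]: a single model path
    [Y], with the controls [U i] and the estimates [Vb i] used after [tau_i]. *)
Record model_run w eps net D (x : R -> 'rV[R]_n) (u : R -> 'rV[R]_p) z
    (Y : R -> 'rV[R]_n) (U : nat -> 'rV[R]_p) (Vb : nat -> 'rV[R]_q) : Prop := ModelRun {
  run_init : Y a = z;
  run_PQ : forall i, (i < size D)%N -> Pset g (U i) /\ Qset g (Vb i);
  run_sol : forall i, (i.+1 < size D)%N ->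
    solution g (tau D i) (tau D i.+1) (Y (tau D i)) (cst (U i)) (cst (Vb i)) Y;
  run_est : forall i, (i.+1 < size D)%N ->
    argmin (Qset g) (mismatch g eps net D i.+1 x) (Vb i.+1);
  run_aim : forall i, (i.+1 < size D)%N ->
    argmin (Pset g) (fun u =>
      inner (Y (tau D i.+1) - w (tau D i.+1) (Y \_ `[a, tau D i.+1]) (tau D i.+1))
        (f (tau D i.+1) (Y (tau D i.+1)) u (Vb i.+1))) (U i.+1);
  run_main : forall i, (i.+1 < size D)%N -> forall t,
    tau D i <= t < probe g eps net D i.+1 0 -> u t = U i;
  run_probe : forall i, (i.+1 < size D)%N -> forall j, (j < size net)%N -> forall t,
    probe g eps net D i.+1 j <= t < probe g eps net D i.+1 j.+1 -> u t = nth 0 net j }.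

Lemma model_run_exists w eps net us vs D F z x u v :
  Pset g us -> Qset g vs -> 0 < eps < 1 -> (0 < size net)%N -> Defs.partition g D ->
  constructed_feedback g w eps net us vs D F -> G0 g z ->
  solution g a b z u v x -> follows g D F u x (size D) ->
  exists Y U Vb, model_run w eps net D x u z Y U Vb.
Proof.
move=> Pus Qvs e01 net0 pD [vb [ub [y [mb cf]]]] Gz sx fx.
have ab := ltW (t0_lt_theta hg).
have xa := solution_init ab sx.
have Gx : G0 g (x a) by rewrite xa.
have cx i : Cts a (tau D i) x.
  by have /andP[_ ib] := tau_in i pD; exact: (Cts_sub (lexx _) ib (solution_Cts sx)).
pose h i := x \_ `[a, tau D i].
pose Yi i := y i (h i).
have s0 := partition_size_gt0 hg pD.
have Yext i : (i.+1 < size D)%N -> forall t, a <= t <= tau D i -> Yi i.+1 t = Yi i t.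
  move=> iD t ti; have [H _ _ _] := mb i.+1 x iD (cx i.+1) Gx.
  by apply: H; rewrite in_itv.
have Ymono i j : (i <= j)%N -> (j < size D)%N -> forall t, a <= t <= tau D i -> Yi j t = Yi i t.
  elim: j => [|j IH]; first by rewrite leqn0 => /eqP ->.
  rewrite leq_eqVlt => /orP[/eqP -> //|ij] jD t ti.
  rewrite Yext//; first by apply: IH => //; exact: ltnW.
  by have := tau_le pD (ij : (i <= j)%N); lra.
pose Y := Yi (size D).-1.
have YE i : (i < size D)%N -> forall t, a <= t <= tau D i -> Y t = Yi i t.
  move=> iD t ti; apply: (Ymono i) => //; last by rewrite prednK.
  by rewrite -ltnS prednK.
have aT i : a <= tau D i <= tau D i by have /andP[-> _] := tau_in i pD; rewrite lexx.
exists Y, (fun i => ub i (h i)), (fun i => vb i (h i)); split.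
- rewrite (YE 0%N)//; last by rewrite tau0 lexx.
  by have [_ _ E] := mb 0%N x s0 (cx 0%N) Gx; exact: etrans E xa.
- case=> [_|i iD]; first by rewrite /h; have [-> -> _] := mb 0%N x s0 (cx 0%N) Gx.
  by have [_ _ [? _] [? _]] := mb i.+1 x iD (cx i.+1) Gx.
- move=> i iD; have [_ H _ _] := mb i.+1 x iD (cx i.+1) Gx.
  rewrite (YE i (ltnW iD) _ (aT i)).
  apply: (solution_ext H) => t tii; split=> //; rewrite (YE i.+1)//.
  by have /andP[? _] := tau_in i pD; lra.
- by move=> i iD; have [_ _ H _] := mb i.+1 x iD (cx i.+1) Gx.
- move=> i iD; have [_ _ _ H] := mb i.+1 x iD (cx i.+1) Gx.
  rewrite (YE i.+1 iD _ (aT i.+1)).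
  rewrite (@restrict_eq _ _ Y (Yi i.+1)) => [|t]; first exact: H.
  by rewrite /= in_itv/=; exact: YE.
- move=> i iD t ti; have := cf i x (ltnW iD) (cx i) Gx; rewrite iD => -[H _].
  rewrite (fx i (ltnW iD)); first by apply: H; rewrite in_itv.
  rewrite in_itv/=; case/andP: ti => -> /= /lt_le_trans; apply.
  by rewrite probe0 gerBl mulr_ge0 ?(ltW (dmin_gt0 hg pD))//; case/andP: e01 => /ltW.
- move=> i iD j jn t tj; have := cf i x (ltnW iD) (cx i) Gx; rewrite iD => -[_ H].
  have e0 : 0 <= eps by case/andP: e01 => /ltW.
  rewrite (fx i (ltnW iD)); first by apply: (H j jn); rewrite in_itv.
  rewrite in_itv/=; case/andP: tj => t1 t2; apply/andP; split.
    apply: le_trans t1; apply: (le_trans (probe_start_ge hg net e01 pD iD)).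
    exact: (probe_mono hg _ _ e0 pD).
  apply: (lt_le_trans t2); rewrite -(probe_last g eps D i.+1 net0).
  exact: (probe_mono hg _ _ e0 pD).
Qed.

Lemma model_run_reach w eps net D x u z Y U Vb : Defs.partition g D -> G0 g z ->
  model_run w eps net D x u z Y U Vb -> forall i, (i < size D)%N ->
  (forall t, a <= t <= tau D i -> reach hg t (Y t)) /\ lip_on a (tau D i) M Y.
Proof.
move=> pD Gz run; elim=> [_|i IH iD].
  have E t : a <= t <= tau D 0 -> t = a by rewrite tau0 => ?; lra.
  split=> [t /E ->|s t /E -> /E ->].
    by rewrite (run_init run); exact: reach_init.
  by rewrite !subrr enorm0 normr0 mulr0.
have [r l] := IH (ltnW iD).
have /andP[ai ib] := tau_in i pD; have /andP[ai' ib'] := tau_in i.+1 pD.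
have ii := ltW (tau_S pD (ltnW iD)).
have [PU QV] := run_PQ run (ltnW iD).
have ad := admissible_sub ai ib' (controls_admissible (controls_cst PU) (disturbances_cst QV)).
have sol := run_sol run iD.
have ri : reach hg (tau D i) (Y (tau D i)) by apply: r; rewrite ai lexx.
split; last exact: (lip_on_cat ai ii l (solution_lip ai ib' ad sol ri)).
move=> t tt; have [ti|it] := leP t (tau D i); first by apply: r; lra.
by apply: (solution_reach ai ib' ad sol ri); lra.
Qed.

Lemma step_arith (df eta rho omega m eps hi d C N A mm j : R) :
  0 < eps -> 0 < d -> 0 <= hi -> hi <= 3 * d -> d <= hi -> 0 <= N -> 0 <= C ->
  0 <= A -> 0 <= m -> mm <= eta + rho + C * (N / (eps * d)) * A -> j <= A ->
  df <= (2 * eta + rho + (2 * omega + 2 * mm)) * hi + 2 * m * (eps * d) + C * j ->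
  df <= (4 * eta + 3 * rho + 2 * omega + 2 * m * eps) * hi + C * (6 * (N / eps) + 1) * A.
Proof.
move=> e0 d0 hi0 hi3 dhi N0 C0 A0 m0 hmm jA /le_trans; apply.
have Ne : 0 <= N / eps by rewrite divr_ge0// ltW.
have q1 : N / (eps * d) * hi <= 3 * (N / eps).
  have -> : N / (eps * d) * hi = (N / eps) * (hi / d) by field; rewrite !gt_eqF.
  by rewrite mulrC ler_wpM2r// ler_pdivrMr.
have q2 : mm * hi <= (eta + rho + C * (N / (eps * d)) * A) * hi by rewrite ler_wpM2r.
have q3 : C * A * (N / (eps * d) * hi) <= C * A * (3 * (N / eps)).
  by rewrite ler_wpM2l// mulr_ge0.
have q4 : m * eps * d <= m * eps * hi by rewrite ler_wpM2l// mulr_ge0// ltW.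
have q5 : C * j <= C * A by rewrite ler_wpM2l.
move: (N / (eps * d)) (N / eps) q1 q2 q3 {Ne} => X1 X2 q1 q2 q3.
lra.
Qed.

Lemma sum_arith (c0 T0 T1 T2 J0 J1 J2 df k C2 e2 : R) :
  df <= k * (T2 - T1) + C2 * (2 * (J2 - J0) + 4 * e2 * (T2 - T1)) ->
  c0 + (k + 4 * C2 * e2) * (T1 - T0) + 2 * C2 * (J1 + J0) + df <=
  c0 + (k + 4 * C2 * e2) * (T2 - T0) + 2 * C2 * (J2 + J1).
Proof. by move=> h; lra. Qed.

(** The defect on an interval that follows an identification time: a typical
    value [vh] of the disturbance around that time serves as the common
    reference of the probes, of the estimate and of the disturbance. *)
Lemma step_defect w (eps : R) net D x u v z Y U Vb (eta rho omega C : R) c (e2 hc : R) :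
  0 < eps < 1 -> is_net g eps net -> (0 < size net)%N -> Defs.partition g D ->
  balanced g D -> G0 g z -> controls g u -> disturbances g v ->
  solution g a b z u v x -> model_run w eps net D x u z Y U Vb ->
  0 <= eta -> time_modulus hg (Dmax g D) eta -> 0 <= rho -> 0 <= C ->
  (forall t x u v v', a <= t <= b -> 1 + enorm x <= Rb -> Pset g u -> Qset g v ->
    Qset g v' -> enorm (f t x u v - f t x u v') <= rho + C * enorm (v - v')) ->
  (forall t x u u' v, a <= t <= b -> 1 + enorm x <= Rb -> Pset g u -> Pset g u' ->
    Qset g v -> enorm (u - u') <= eps -> enorm (f t x u v - f t x u' v) <= omega) ->
  0 <= omega ->
  0 < e2 -> ig a b (fun t => enorm (v t - c t)) ->
  (forall s t, a <= s <= b -> a <= t <= b -> `|s - t| <= hc -> enorm (c s - c t) <= e2) ->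
  2 * Dmax g D <= hc ->
  forall i, (i.+2 < size D)%N ->
  J (tau D i.+1) (tau D i.+2) (fun s => enorm (velocity g x u v s -
      velocity g x (cst (U i.+1)) (cst (Vb i.+1)) s)) <=
  (4 * eta + 3 * rho + 2 * omega + 2 * M * eps) * (tau D i.+2 - tau D i.+1) +
  C * (6 * ((size net)%:R / eps) + 1) * (2 * J (tau D i) (tau D i.+2) (fun t => enorm (v t - c t)) +
     4 * e2 * (tau D i.+2 - tau D i.+1)).
Proof.
move=> e01 isnet net0 pD bal Gz cu dv sx run eta0 tm rho0 C0 Cmod om om0 e20 ic hcm Dhc i iD.
have [netP _] := isnet; have /andP[e0 e1] := e01.
have iD' := ltnW iD; have iD'' := ltnW iD'.
have /andP[ai ib] := tau_in i.+1 pD; have /andP[ai' ib'] := tau_in i.+2 pD.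
have ii := ltW (tau_S pD iD'); have /andP[a0 b0] := tau_in i pD.
have d0 := dmin_gt0 hg pD; have D3 := balanced_le hg pD bal.
have N0 : 0 <= (size net)%:R :> R by [].
set N := (size net)%:R in N0 *.
pose phi t := enorm (v t - c t).
have phi0 s t : 0 <= J s t phi by apply: J_ge0 => *; exact: enorm_ge0.
have ps := probe_start_ge hg net e01 pD iD'.
have pl : probe g eps net D i.+1 0 <= tau D i.+1.
  by rewrite probe0 gerBl mulr_ge0// ltW.
have sE : tau D i.+1 - probe g eps net D i.+1 0 = eps * dmin g D.
  by rewrite probe0 opprB addrCA subrr addr0.
set s := probe g eps net D i.+1 0 in ps pl sE.
have ii' := tau_S pD iD'.
have dl := dmin_le g iD.
have ed : eps * dmin g D <= dmin g D by rewrite ler_piMl// ltW.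
have st : s < tau D i.+2 by exact: le_lt_trans pl ii'.
have as_ : a <= s by exact: le_trans a0 ps.
have mv : forall k, mf s (tau D i.+2) (fun r => v r ord0 k).
  by move=> k; exact: (mf_sub as_ ib' (dv.1 k)).
have ics : ig s (tau D i.+2) (fun r => enorm (v r - c r)) by exact: (ig_sub as_ ib' ic).
have hi := tau_step_le g iD'.
have osc r r' : s <= r <= tau D i.+2 -> s <= r' <= tau D i.+2 -> enorm (c r - c r') <= e2.
  move=> rs rs'; apply: hcm; [clear - rs as_ ib'; lra|clear - rs' as_ ib'; lra|].
  by rewrite ler_norml; clear - rs rs' sE ed dl hi Dhc; lra.
have [r rs [ivr jr]] := typical_value st e20 mv ics osc.
set vh := v r in ivr jr.
have rT : a <= r <= b by clear - rs as_ ib'; lra.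
have Qvh : Qset g vh by apply: dv.2; rewrite /= in_itv.
set A := J s (tau D i.+2) (fun t => enorm (v t - vh)) in jr.
have A0 : 0 <= A by apply: J_ge0 => *; exact: enorm_ge0.
have iv1 : ig s (tau D i.+1) (fun t => enorm (v t - vh)) by exact: (ig_sub (lexx _) ii ivr).
have iv2 : ig (tau D i.+1) (tau D i.+2) (fun t => enorm (v t - vh)) by exact: (ig_sub pl (lexx _) ivr).
have Asplit := J_split pl ii ivr; rewrite -/A in Asplit.
have j1 : 0 <= J s (tau D i.+1) (fun t => enorm (v t - vh)) by apply: J_ge0 => *; exact: enorm_ge0.
have j2 : 0 <= J (tau D i.+1) (tau D i.+2) (fun t => enorm (v t - vh)) by apply: J_ge0 => *; exact: enorm_ge0.
have M0 := speed_ge0 hg.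
have mmt := mismatch_typical e01 net0 netP pD (lexx _) tm C0 Cmod Gz cu dv sx iD' Qvh eta0 rho0
  (run_probe run iD') iv1.
set mm := mismatch g eps net D i.+1 x vh in mmt.
have mm0 : 0 <= mm by exact: bigmax_ge_id.
have mmA : mm <= eta + rho + C * (N / (eps * dmin g D)) * A.
  apply: (le_trans mmt); rewrite lerD2l; apply: ler_wpM2l; last first.
    by rewrite -/s; clear - Asplit j2; lra.
  by rewrite mulr_ge0// divr_ge0// mulr_ge0// ltW.
have idt := identified netP pD Gz cu dv sx iD' Qvh isnet om (run_est run iD').
rewrite -/mm in idt.
have [PU QV] := run_PQ run iD'.
have m0 : 0 <= 2 * omega + 2 * mm by clear - om0 mm0; lra.
have de := defect_estimate e01 pD (lexx _) tm C0 Cmod Gz cu dv sx iD PU QV Qvh eta0 rho0 m0 idt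
  (run_main run iD) iv2.
set df := J _ _ (fun s => enorm _) in de *.
set hi' := tau D i.+2 - tau D i.+1 in de hi dl *.
have hi0 : 0 <= hi' by rewrite subr_ge0.
have hi3 : hi' <= 3 * dmin g D by exact: le_trans hi D3.
have jA : J (tau D i.+1) (tau D i.+2) (fun t => enorm (v t - vh)) <= A.
  by clear - Asplit j1; lra.
have dfb := step_arith e0 d0 hi0 hi3 dl N0 C0 A0 M0 mmA jA de.
apply: (le_trans dfb); rewrite lerD2l; apply: ler_wpM2l.
  by rewrite mulr_ge0// addr_ge0// mulr_ge0// divr_ge0// ltW.
have jphi : J s (tau D i.+2) phi <= J (tau D i) (tau D i.+2) phi.
  have ip : ig (tau D i) (tau D i.+2) phi by exact: (ig_sub a0 ib' ic).
  by rewrite (J_split ps (ltW st) ip) lerDr; exact: phi0.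
apply: (le_trans jr); apply: lerD; first by rewrite ler_wpM2l.
have -> : 4 * e2 * hi' = 2 * e2 * (2 * hi') by ring.
apply: ler_wpM2l; first by rewrite mulr_ge0// ltW.
by clear - sE ed dl; rewrite /hi'; rewrite /hi' in dl; lra.
Qed.

(** The model stays close to the motion: between two identification times the
    distance increases by the defect, which is small in mean because the
    disturbance hardly changes from one interval to the next. *)
Lemma real_model_close w (eps : R) net D x u v z Y U Vb (eta rho omega C : R) c (e2 hc : R) :
  0 < eps < 1 -> is_net g eps net -> (0 < size net)%N -> Defs.partition g D ->
  balanced g D -> G0 g z -> controls g u -> disturbances g v ->
  solution g a b z u v x -> model_run w eps net D x u z Y U Vb ->
  0 <= eta -> time_modulus hg (Dmax g D) eta -> 0 <= rho -> 0 <= C ->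
  (forall t x u v v', a <= t <= b -> 1 + enorm x <= Rb -> Pset g u -> Qset g v ->
    Qset g v' -> enorm (f t x u v - f t x u v') <= rho + C * enorm (v - v')) ->
  0 <= omega ->
  (forall t x u u' v, a <= t <= b -> 1 + enorm x <= Rb -> Pset g u -> Pset g u' ->
    Qset g v -> enorm (u - u') <= eps -> enorm (f t x u v - f t x u' v) <= omega) ->
  0 < e2 -> ig a b (fun t => enorm (v t - c t)) ->
  (forall s t, a <= s <= b -> a <= t <= b -> `|s - t| <= hc -> enorm (c s - c t) <= e2) ->
  2 * Dmax g D <= hc ->
  let C2 := C * (6 * ((size net)%:R / eps) + 1) in
  let k1 := 4 * eta + 3 * rho + 2 * omega + 2 * M * eps + 4 * C2 * e2 in
  forall t, a <= t <= tau D (size D).-1 -> enorm (x t - Y t) <=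
    expR (L * (b - a)) * (2 * M * Dmax g D + k1 * (b - a) +
      4 * C2 * J a b (fun t => enorm (v t - c t))).
Proof.
move=> e01 isnet net0 pD bal Gz cu dv sx run eta0 tm rho0 C0 Cmod om0 om e20 ic hcm Dhc C2 k1.
have [netP _] := isnet.
have /andP[e0 e1] := e01; have M0 := speed_ge0 hg; have L0 := lip_const_gt0 hg.
have d0 := dmin_gt0 hg pD; have D3 := balanced_le hg pD bal.
have n0 : 0 < (size net)%:R :> R by rewrite ltr0n.
set N := (size _)%:R in n0 C2 k1 *.
have Dm := Dmax_ge0 g D; have s0 := partition_size_gt0 hg pD.
have ab := ltW (t0_lt_theta hg).
pose phi t := enorm (v t - c t).
have phi0 s t : 0 <= J s t phi by apply: J_ge0 => *; exact: enorm_ge0.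
have Ne : 0 <= N / eps by rewrite divr_ge0// ltW.
have C20 : 0 <= C2 by rewrite mulr_ge0//; lra.
have k10 : 0 <= k1 by rewrite /k1; have := mulr_ge0 M0 (ltW e0); have := mulr_ge0 C20 (ltW e20); lra.
have lipx := (solution_good_path hg Gz cu dv sx).2.
pose G i := 2 * M * Dmax g D + k1 * (tau D i - a) +
  2 * C2 * (J a (tau D i) phi + J a (tau D i.-1) phi).
pose Lam := expR (L * (b - a)).
have Gle i : G i <= 2 * M * Dmax g D + k1 * (b - a) + 4 * C2 * J a b phi.
  have Jle k : J a (tau D k) phi <= J a b phi.
    have /andP[ak kb] := tau_in k pD; rewrite (J_split ak kb ic) lerDl; exact: phi0.
  have /andP[_ ib] := tau_in i pD.
  have := ler_wpM2l k10 (lerB ib (lexx a)).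
  have := ler_wpM2l C20 (Jle i); have := ler_wpM2l C20 (Jle i.-1).
  by rewrite /G; clear; lra.
have MD0 : 0 <= 2 * M * Dmax g D by do 2 apply: mulr_ge0 => //.
have G0' i : 0 <= G i.
  have /andP[ai _] := tau_in i pD.
  have := mulr_ge0 C20 (phi0 a (tau D i)); have := mulr_ge0 C20 (phi0 a (tau D i.-1)).
  have : 0 <= k1 * (tau D i - a) by rewrite mulr_ge0//; clear - ai; lra.
  by rewrite /G; clear - MD0; lra.
have expmono (s t : R) : s <= t -> expR (L * s) <= expR (L * t).
  by move=> st; rewrite ler_expR ler_wpM2l// ltW.
have exp1 (t : R) : 0 <= t -> 1 <= expR (L * t).
  by move=> t0'; rewrite (le_trans _ (expR_ge1Dx _))// lerDl mulr_ge0// ltW.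
have claim i : (i < size D)%N ->
    enorm (x (tau D i) - Y (tau D i)) <= expR (L * (tau D i - a)) * G i /\
    forall t, a <= t <= tau D i -> enorm (x t - Y t) <=
      Lam * (2 * M * Dmax g D + k1 * (b - a) + 4 * C2 * J a b phi).
  have final s (k : nat) e : a <= s <= b -> e <= expR (L * (s - a)) * G k ->
      e <= Lam * (2 * M * Dmax g D + k1 * (b - a) + 4 * C2 * J a b phi).
    move=> sT he; apply: (le_trans he); apply: ler_pM.
    - exact: expR_ge0.
    - exact: G0'.
    - by apply: expmono; clear - sT; lra.
    - exact: Gle.
  elim: i => [_|i IH iD].
    have xYa : x a - Y a = 0 by rewrite (solution_init ab sx) (run_init run) subrr.
    split; first by rewrite tau0 xYa enorm0 mulr_ge0 ?expR_ge0.
    move=> t; rewrite tau0 => ta; have -> : t = a by clear - ta; lra.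
    by rewrite xYa enorm0 mulr_ge0 ?expR_ge0// (le_trans (G0' 0%N)).
  have iD' := ltnW iD.
  have [IHi IHt] := IH iD'.
  have /andP[ai ib] := tau_in i pD; have /andP[ai' ib'] := tau_in i.+1 pD.
  have ii := ltW (tau_S pD iD').
  have hi := tau_step_le g iD'.
  suff key t : tau D i <= t <= tau D i.+1 ->
      enorm (x t - Y t) <= expR (L * (t - a)) * G i.+1.
    split; first by apply: key; clear - ii; lra.
    move=> t tt; have [ti|it] := leP t (tau D i); first by apply: IHt; clear - tt ti; lra.
    apply: (@final t i.+1); first by clear - tt ib'; lra.
    by apply: key; clear - tt it; lra.
  move=> tii.
  case: (posnP i) => [i0|ipos].
    have [_ lipY] := model_run_reach pD Gz run iD.
    have Ei : tau D i = a by rewrite i0.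
    have xYa : x a - Y a = 0 by rewrite (solution_init ab sx) (run_init run) subrr.
    have h1 := lipx a t ltac:(clear - ab; lra) ltac:(clear - tii Ei ib'; lra).
    have h2 := lipY a t ltac:(clear - ai'; lra) ltac:(clear - tii Ei; lra).
    have -> : x t - Y t = (x t - x a) - (Y t - Y a).
      have -> : x a = Y a by apply/eqP; rewrite -subr_eq0 xYa.
      by rewrite opprB addrA subrK.
    have h3 : enorm ((x t - x a) - (Y t - Y a)) <= 2 * M * Dmax g D.
      rewrite (le_trans (ler_enormD _ _))// enormN.
      rewrite ger0_norm in h1; last by clear - tii Ei; lra.
      rewrite ger0_norm in h2; last by clear - tii Ei; lra.
      have : M * (t - a) <= M * Dmax g D by rewrite ler_wpM2l//; clear - hi tii Ei; lra.
      by clear - h1 h2; lra.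
    apply: (le_trans h3); apply: (@le_trans _ _ (G i.+1)); last first.
      by rewrite ler_peMl//; apply: exp1; clear - tii Ei; lra.
    have : 0 <= k1 * (tau D i.+1 - a) by rewrite mulr_ge0//; clear - ai'; lra.
    have := mulr_ge0 C20 (phi0 a (tau D i.+1)); have := mulr_ge0 C20 (phi0 a (tau D i)).
    by rewrite /G /=; clear - MD0; lra.
  case: i ipos IH iD iD' IHi IHt ai ib ai' ib' ii hi t tii => // i _ IH iD iD' IHi IHt
    ai ib ai' ib' ii hi t tii.
  have [PU QV] := run_PQ run iD'.
  have /andP[a0 _] := tau_in i pD.
  have sd := step_defect e01 isnet net0 pD bal Gz cu dv sx run eta0 tm rho0 C0 Cmod om om0 e20 ic hcm Dhc iD.
  set df := J _ _ (fun s => enorm _) in sd.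
  have GG : G i.+1 + df <= G i.+2.
    rewrite (_ : J (tau D i) _ _ = J a (tau D i.+2) phi - J a (tau D i) phi) in sd; last first.
      have ip : ig a (tau D i.+2) phi by exact: (ig_sub (lexx a) ib' ic).
      have i12 : tau D i <= tau D i.+2 by apply: (tau_le pD); rewrite -addn2 leq_addr.
      by rewrite (J_split a0 i12 ip) addrC addKr.
    have e := sum_arith (2 * M * Dmax g D) a (J a (tau D i.+1) phi) sd.
    exact: e.
  have ad := admissible_sub ai ib' (controls_admissible cu dv).
  have ad' := admissible_sub ai ib' (controls_admissible (controls_cst PU) (disturbances_cst QV)).
  have sxi := solution_sub sx ai ii ib'.
  have rxi : reach hg (tau D i.+1) (x (tau D i.+1)).
    by apply: (solution_reach (lexx _) (lexx _) (controls_admissible cu dv) sx (reach_init hg Gz)); rewrite ai.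
  have rYi : reach hg (tau D i.+1) (Y (tau D i.+1)).
    by apply: (model_run_reach pD Gz run iD').1; rewrite ai lexx.
  have cmp := solution_compare ai ib' ad ad' sxi (run_sol run iD) rxi rYi tii.
  apply: (le_trans cmp).
  have -> : expR (L * (t - a)) = expR (L * (tau D i.+1 - a)) * expR (L * (t - tau D i.+1)).
    by rewrite -expRD; congr expR; ring.
  rewrite mulrAC; apply: ler_wpM2r; first exact: expR_ge0.
  rewrite -/df; have df0 : 0 <= df by apply: J_ge0 => *; exact: enorm_ge0.
  have eg : expR (L * (tau D i.+1 - a)) * (G i.+1 + df) <= expR (L * (tau D i.+1 - a)) * G i.+2.
    by rewrite ler_wpM2l// expR_ge0.
  have ed1 : df <= expR (L * (tau D i.+1 - a)) * df by rewrite ler_peMl//; apply: exp1; clear - ai; lra.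
  by rewrite mulrDr in eg; clear - eg ed1 IHi; lra.
move=> t tt; apply: (claim (size D).-1 _).2 => //.
by rewrite prednK.
Qed.

End ModelMotion.

Lemma Cdist_le (R : realType) m (a b : R) (x y : R -> 'rV[R]_m) (r : R) :
  (Cdist a b x y <= r%:E)%E <-> forall t, a <= t <= b -> enorm (x t - y t) <= r.
Proof.
split=> [h t tab|h].
  rewrite -lee_fin; apply: le_trans h; apply: ereal_sup_ubound.
  by exists t => //=; rewrite in_itv.
by apply: ge_ereal_sup => _ [t + <-]; rewrite /= in_itv/= lee_fin; exact: h.
Qed.

Section ModelTarget.
Variables (R : realType) (n p q : nat) (g : game R n p q).
Hypothesis hg : standing_assumptions g.
Local Notation f := (dyn g).
Local Notation a := (t0 g).
Local Notation b := (theta g).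
Local Notation tau := (tau g).
Local Notation L := (lip_const hg).
Local Notation Rb := (reach_radius hg).
Local Notation M := (speed hg).
Implicit Types (D : seq R).

Lemma selector_le w s Y W r : target_selector g w -> a <= s <= b -> Cts a s Y ->
  G0 g (Y a) -> target g (Y a) W -> (forall t, a <= t <= s -> enorm (Y t - W t) <= r) ->
  exists wx, [/\ target g (Y a) wx, w s (Y \_ `[a, s]) s = wx s &
    forall t, a <= t <= s -> enorm (Y t - wx t) <= r].
Proof.
move=> hw sT cY GY tW YW.
have [[wx twx E] hmin] := hw s Y (ltac:(by rewrite /= in_itv)) cY GY.
exists wx; split=> //; first by rewrite -E restrict_in//; case/andP: sT => -> _ /=.
have h := hmin (W \_ `[a, s]) (ex_intro2 _ _ W tW erefl).
have : (Cdist a s (wx \_ `[a, s]) Y <= r%:E)%E.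
  rewrite E; apply: (le_trans h); apply/Cdist_le => t tt.
  by rewrite restrict_in// -enormN opprB; exact: YW.
by move/Cdist_le => H t tt; have := H t tt; rewrite restrict_in// -enormN opprB.
Qed.

(** Extremal shift for the model: it is aimed at its best approximation in the
    target set; since the target set is stable, that approximation can be
    continued along the estimated disturbance. *)
Lemma model_target w eps net D x u z Y U Vb eta : target_selector g w ->
  Defs.partition g D -> G0 g z -> model_run g w eps net D x u z Y U Vb ->
  time_modulus hg (Dmax g D) eta -> 0 <= eta ->
  exists2 W, target g z W & forall t, a <= t <= tau D (size D).-1 ->
    enorm (Y t - W t) ^+ 2 <= aim_bound hg ((2 * M * Dmax g D) ^+ 2)
      (2 * (4 * Rb * eta) + 4 * M ^+ 2 * Dmax g D) b.
Proof.
move=> hw pD Gz run tm eta0.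
have M0 := speed_ge0 hg; have Dm := Dmax_ge0 g D; have s0 := partition_size_gt0 hg pD.
have R1 := Rb_ge1 hg.
set A := (_ ^+ 2); set psi := (X in aim_bound _ _ X).
have A0 : 0 <= A by exact: sqr_ge0.
have psi0 : 0 <= psi.
  have Rb0 : 0 <= Rb by lra.
  by apply: addr_ge0; repeat (exact: sqr_ge0 || apply: mulr_ge0 => //).
have Ya : Y a = z := run_init run.
have [W0 tW0] := target_nonempty hg Gz.
have claim i : (i.+1 < size D)%N -> exists2 W, target g z W &
    forall t, a <= t <= tau D i.+1 -> enorm (Y t - W t) ^+ 2 <= aim_bound hg A psi (tau D i.+1).
  elim: i => [|i IH] iD.
    have [_ lY] := model_run_reach hg pD Gz run iD.
    have [[_ lW] Wa] := target_good_path hg Gz tW0.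
    have /andP[a1 b1] := tau_in 1 pD.
    have d1 := tau_step_le g (ltnW iD); rewrite tau0 in d1.
    exists W0 => // t /andP[at_ t1]; apply: (@le_trans _ _ (aim_bound hg A psi a)); last first.
      exact: aim_bound_mono.
    rewrite /aim_bound subrr !mulr0 expR0 addr0 mulr1 /A.
    have h1 := lY a t ltac:(lra) ltac:(lra).
    have h2 := lW a t ltac:(lra) ltac:(lra).
    rewrite ger0_norm in h1; last lra.
    rewrite ger0_norm in h2; last lra.
    have h3 : M * (t - a) <= M * Dmax g D by rewrite ler_wpM2l//; lra.
    rewrite lerXn2r ?nnegrE ?enorm_ge0//; first by do 2 apply: mulr_ge0 => //.
    have -> : Y t - W0 t = (Y t - Y a) - (W0 t - W0 a) by rewrite Ya Wa opprB addrA subrK.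
    by rewrite (le_trans (ler_enormD _ _))// enormN; lra.
  have [W tW YW] := IH (ltnW iD).
  have iD' := ltnW iD.
  have /andP[ai ib] := tau_in i.+1 pD; have /andP[ai' ib'] := tau_in i.+2 pD.
  have ii := ltW (tau_S pD iD').
  have [rY lY] := model_run_reach hg pD Gz run iD'.
  set Bi := aim_bound hg A psi (tau D i.+1) in YW *.
  have B0 : 0 <= Bi.
    by apply: (le_trans (sqr_ge0 _) (YW a _)); rewrite lexx ai.
  have YW' t : a <= t <= tau D i.+1 -> enorm (Y t - W t) <= Num.sqrt Bi.
    move=> tt; rewrite -(ler_pXn2r (n := 2)) ?nnegrE ?enorm_ge0 ?sqrtr_ge0//.
    by rewrite (sqr_sqrtr B0); exact: YW.
  have sT : a <= tau D i.+1 <= b by rewrite ai ib.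
  have cY : Cts a (tau D i.+1) Y by exact: lip_on_Cts lY.
  rewrite -Ya in tW.
  have [|wx [twx Ew Ywx]] := selector_le hw sT cY _ tW YW'; first by rewrite Ya.
  rewrite Ya in twx.
  have [PU QV] := run_PQ run iD'.
  have [W' [tW' WE Wapp]] := target_stable hg Gz twx sT (disturbances_cst QV).
  have Wi : W' (tau D i.+1) = wx (tau D i.+1) by apply: WE; rewrite ai lexx.
  have bound_i t : a <= t <= tau D i.+1 -> enorm (Y t - W' t) ^+ 2 <= Bi.
    move=> tt; rewrite WE// -(sqr_sqrtr B0).
    by rewrite lerXn2r ?nnegrE ?enorm_ge0 ?sqrtr_ge0//; exact: Ywx.
  have Ai := run_aim run iD'; rewrite Ew -Wi in Ai.
  exists W' => // t /andP[at_ ti'].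
  have [ti|it] := leP t (tau D i.+1).
    by apply: (le_trans (bound_i t _)); [rewrite at_|exact: aim_bound_mono].
  apply: (@le_trans _ _ (aim_bound hg A psi t)); last exact: aim_bound_mono.
  have ad := admissible_sub ai ib' (controls_admissible (controls_cst PU) (disturbances_cst QV)).
  apply: (aim_step (c := tau D i.+1) (d := tau D i.+2) (kappa := 0) ai ii ib'
     (tau_step_le g iD') ad (rY _ _) (run_sol run iD) _ _ tm eta0) => //.
  - by rewrite ai lexx.
  - exact: (target_good_path hg Gz tW').1.
  - move=> e e0; have [u' [v' [x' [cu' dv' vE sx' Wx']]]] := Wapp e e0.
    exists z, u', v', x'; split=> //; split=> // r /andP[r1 _]; exact: vE.
  - by move=> r u0 _ Pu0; rewrite addr0; exact: Ai.2.
  - by rewrite /psi addr0.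
  - by apply: bound_i; rewrite ai lexx.
  - by rewrite (ltW it) ti'.
case: (posnP (size D).-1) => [E|Epos].
  exists W0 => // t; rewrite E tau0 => ta; have -> : t = a by lra.
  have [_ ->] := target_good_path hg Gz tW0; rewrite Ya subrr enorm0 expr0n /=.
  by rewrite mulr_ge0 ?expR_ge0// addr_ge0// mulr_ge0//; have := t0_lt_theta hg; lra.
have [|W tW YW] := claim (size D).-2; first by rewrite !prednK.
exists W => // t; rewrite -(prednK Epos) => tt; apply: (le_trans (YW t tt)).
have /andP[? ?] := tau_in (size D).-2.+1 pD.
exact: aim_bound_mono.
Qed.

End ModelTarget.

(** * Distance of the constructed motions from the target set *)

Section Guarantee.
Variables (R : realType) (n p q : nat) (g : game R n p q).
Hypothesis hg : standing_assumptions g.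
Local Notation f := (dyn g).
Local Notation a := (t0 g).
Local Notation b := (theta g).
Local Notation tau := (tau g).
Local Notation L := (lip_const hg).
Local Notation Rb := (reach_radius hg).
Local Notation M := (speed hg).
Implicit Types (D : seq R).

Lemma tau_subseq D D' i : subseq D' D -> (i < size D')%N ->
  exists k, tau D' i = tau D k.
Proof.
case: i => [_ _|i sub iD]; first by exists 0%N.
have /nthP : nth b D' i \in D by apply: (mem_subseq sub); apply: mem_nth; exact: ltnW.
by move=> /(_ b)[k _ e]; exists k.+1; exact: esym e.
Qed.

(** The points of [D'] are among those of [D], so that each interval of [D] lies
    in a single interval of [D']. *)
Lemma motion_coarser D D' F F' z v x : Defs.partition g D -> Defs.partition g D' ->
  subseq D' D -> runs_coarser g D D' F F' -> G0 g z -> motion g z D F v x ->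
  motion g z D' F' v x.
Proof.
move=> pD pD' sub rc Gz [u cu [fu sx]]; exists u => //; split=> // i' iD' t.
have ab := ltW (t0_lt_theta hg).
rewrite in_itv/= => /andP[it ti].
have /andP[ai' _] := tau_in i' pD'; have /andP[_ ib'] := tau_in i'.+1 pD'.
have tT : a <= t < b by rewrite (le_trans ai' it) (lt_le_trans ti ib').
have [i iD /andP[it' ti']] := tau_locate pD tT.
have tin : t \in `[tau D i, tau D i.+1[ by rewrite in_itv/= it'.
rewrite (fu i iD t tin); apply: (rc _ _ iD iD') => //.
- apply/andP; split; last exact: le_lt_trans ti.
  have [k E] := tau_subseq sub iD'; rewrite E in it *.
  apply: (tau_le pD); rewrite -ltnS ltnNge; apply/negP => /(tau_le pD) ki.
  by have := lt_le_trans ti' (le_trans ki it); rewrite ltxx.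
- have /andP[_ ib] := tau_in i pD; exact: (Cts_sub (lexx _) ib (solution_Cts sx)).
- by rewrite (solution_init ab sx).
Qed.

Lemma close_arith (Lam T s D eta rho om Me c4 j r M : R) :
  1 <= Lam -> 0 < T -> 0 < s -> 24 * Lam * (1 + T) * s = r ->
  2 * M * D <= s -> 4 * eta <= s -> 3 * rho <= s -> 2 * om <= s -> Me <= s ->
  c4 <= s -> j <= s ->
  Lam * (2 * M * D + (4 * eta + 3 * rho + 2 * om + Me + c4) * T + j) <= r / 3.
Proof.
move=> L1 T0 s0 <- hD h1 h2 h3 h4 h5 h6.
have k : (4 * eta + 3 * rho + 2 * om + Me + c4) * T <= 5 * s * T.
  by rewrite ler_wpM2r//; [exact: ltW|lra].
have -> : 24 * Lam * (1 + T) * s / 3 = Lam * (8 * (1 + T) * s) by field.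
apply: ler_wpM2l; first lra.
have : 0 < s * T by exact: mulr_gt0.
lra.
Qed.

Lemma aim_arith (Lam T s r A psi : R) :
  1 <= Lam -> 0 < T -> 0 < s -> 24 * Lam * (1 + T) * s = r ->
  0 <= A -> A <= s -> psi <= (r / 3) ^+ 2 / (2 * (1 + T) * Lam ^+ 2) ->
  (A ^+ 2 + psi * T) * Lam ^+ 2 <= (r / 3) ^+ 2.
Proof.
move=> L1 T0 s0 E A0 As hpsi.
have L0 : 0 < Lam by lra.
have h1 : A * Lam <= r / 24.
  have -> : r / 24 = (1 + T) * s * Lam by rewrite -E; field.
  rewrite ler_wpM2r//; first exact: ltW.
  by have := mulr_gt0 T0 s0; lra.
have h2 : A ^+ 2 * Lam ^+ 2 <= (r / 24) ^+ 2.
  by rewrite -exprMn lerXn2r ?nnegrE// ?mulr_ge0// ?divr_ge0// ?ltW//; rewrite -E !mulr_gt0//; lra.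
have h3 : psi * T * Lam ^+ 2 <= (r / 3) ^+ 2 / 2.
  have := hpsi; rewrite ler_pdivlMr; last by rewrite !mulr_gt0// ?exprn_gt0//; lra.
  have rr0 : 0 <= (r / 3) ^+ 2 by exact: sqr_ge0.
  move=> hp; have [p0|p0] := leP psi 0.
    apply: (@le_trans _ _ 0); last by rewrite divr_ge0.
    by rewrite mulr_le0_ge0 ?sqr_ge0// mulr_le0_ge0// ltW.
  have : 0 < psi * Lam ^+ 2 by rewrite mulr_gt0// exprn_gt0.
  lra.
have : 0 <= r ^+ 2 by exact: sqr_ge0.
rewrite mulrDl; lra.
Qed.

(** The motions of the constructed strategies for fine partitions stay close to
    the target set: they are close to the model, and the model is close to the
    target set. On the last interval, where the model is not defined, the
    bounded speed is enough. *)
Lemma guarantee w (r : R) : target_selector g w -> 0 < r ->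
  exists2 eps0 : R, 0 < eps0 & forall eps U, 0 < eps < 1 -> eps <= eps0 ->
  constructed_strategy g w eps U ->
  forall V : set (L2space q a b), V `<=` disturbances g -> compact V ->
  exists2 h : R, 0 < h & forall D, Defs.partition g D -> Dmax g D <= h ->
  forall z v x, G0 g z -> V v -> motion g z D (U D) v x ->
  exists2 W, target g z W & forall t, a <= t <= b -> enorm (x t - W t) <= r.
Proof.
move=> hw r0; have M0 := speed_ge0 hg; have L0 := lip_const_gt0 hg.
have tt := t0_lt_theta hg.
pose T := b - a; have T0 : 0 < T by rewrite subr_gt0.
pose Lam := expR (L * T).
have L1 : 1 <= Lam.
  by rewrite (le_trans _ (expR_ge1Dx _))// lerDl mulr_ge0// ltW.
have Lam0 : 0 < Lam by exact: expR_gt0.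
have r23 : 2 / 3 * r <= r by lra.
have den0 : 0 < 24 * Lam * (1 + T).
  by rewrite mulr_gt0//; [rewrite mulr_gt0|lra].
(* All terms of the bound in [real_model_close], the initial deviation in
   [aim_bound] and the distance covered on the last interval will be at most
   [s]. *)
pose s := r / (24 * Lam * (1 + T)).
have s0 : 0 < s by rewrite divr_gt0.
have sE : 24 * Lam * (1 + T) * s = r by rewrite mulrCA divff ?mulr1// gt_eqF.
have sr : s <= r / 24.
  rewrite /s -!mulrA ler_wpM2l//; first exact: ltW.
  rewrite lef_pV2 ?posrE//; last by rewrite mulrA.
  by rewrite -[leLHS]mulr1 ler_wpM2l// mulr_ege1//; lra.
have [e1 e10 He1] := dyn_control_modulus hg (divr_gt0 s0 (ltr0n R 2)).
have M1 : 0 < 2 * (M + 1) by lra.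
have Ms0 : 0 < s / (2 * (M + 1)) by rewrite divr_gt0.
have MsE y : 0 <= y -> y <= s / (2 * (M + 1)) -> 2 * M * y <= s.
  move=> y0; rewrite ler_pdivlMr// => h.
  by have := mulr_ge0 M0 y0; lra.
exists (Num.min e1 (s / (2 * (M + 1)))); first by rewrite lt_min e10.
move=> eps U e01; rewrite le_min => /andP[ee1 ees] [_ [net [us [vs [isnet Pus Qvs HU]]]]] V Vd cV.
have /andP[e0 _] := e01.
have net0 : (0 < size net)%N.
  have [j + _] := isnet.2 us Pus; exact: leq_ltn_trans.
have [C C0 HC] := dyn_disturbance_modulus hg (divr_gt0 s0 (ltr0n R 3)).
pose C2 := C * (6 * ((size net)%:R / eps) + 1).
have C20 : 0 <= C2.
  by rewrite mulr_ge0// addr_ge0// mulr_ge0// divr_ge0// ltW.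
pose e2 := s / (4 * C2 + 1).
have C21 : 0 < 4 * C2 + 1 by lra.
have e20 : 0 < e2 by rewrite divr_gt0.
have e2E y : y <= e2 -> 4 * C2 * y <= s.
  move=> ye; apply: (@le_trans _ _ (4 * C2 * e2)).
    by rewrite ler_wpM2l//; lra.
  have E : (4 * C2 + 1) * e2 = s by rewrite mulrCA divff ?mulr1// gt_eqF.
  lra.
have [hc hc0 Hc] := compact_disturbances hg Vd cV e20.
have [h1 h10 Hh1] := time_modulus_exists hg (divr_gt0 s0 (ltr0n R 4)).
have pi0 : 0 < (r / 3) ^+ 2 / (2 * (1 + T) * Lam ^+ 2).
  by rewrite divr_gt0 ?exprn_gt0 ?divr_gt0//; rewrite !mulr_gt0 ?exprn_gt0//; lra.
have [h2 [eta2 [kap [h20 eta20 kap0 Hh2]]]] := aim_params hg pi0.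
pose h := Num.min (Num.min h1 h2) (Num.min (hc / 2) (s / (2 * (M + 1)))).
have h0 : 0 < h by rewrite !lt_min h10 h20 Ms0 divr_gt0.
have bal_case D : Defs.partition g D -> balanced g D -> Dmax g D <= h ->
    forall z v x, G0 g z -> V v -> motion g z D (U D) v x ->
    exists2 W, target g z W & forall t, a <= t <= b -> enorm (x t - W t) <= r.
  move=> pD bal; rewrite !le_min => /andP[/andP[Dh1 Dh2] /andP[Dhc Ds]] z v x Gz Vv.
  move=> [u cu [fu sx]]; have dv := Vd v Vv.
  have Dm := Dmax_ge0 g D.
  have [Y [Ui [Vb run]]] := model_run_exists hg Pus Qvs e01 net0 pD ((HU D pD).1 bal) Gz sx fu.
  have [c [ic jc cm]] := Hc v Vv.
  have Dhc2 : 2 * Dmax g D <= hc by clear - Dhc; lra.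
  have om := He1.
  have {}om t x0 u0 u' v0 : a <= t <= b -> 1 + enorm x0 <= Rb -> Pset g u0 -> Pset g u' ->
      Qset g v0 -> enorm (u0 - u') <= eps -> enorm (f t x0 u0 v0 - f t x0 u' v0) <= s / 2.
    by move=> ? ? ? ? ? h'; apply: om => //; exact: le_trans h' ee1.
  have xY := real_model_close e01 isnet net0 pD bal Gz cu dv sx run
    (ltW (divr_gt0 s0 (ltr0n R 4))) (Hh1 _ Dh1) (ltW (divr_gt0 s0 (ltr0n R 3))) C0 HC
    (ltW (divr_gt0 s0 (ltr0n R 2))) om e20 ic cm Dhc2.
  have [tm2 psib] := Hh2 (Dmax g D) ltac:(by rewrite Dm Dh2).
  have [W tW YW] := model_target hw pD Gz run tm2 (ltW eta20).
  have Mds := MsE _ Dm Ds.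
  have near1 t : a <= t <= tau D (size D).-1 -> enorm (x t - W t) <= 2 / 3 * r.
    move=> tt'; apply: (le_trans (ler_distD_enorm (Y t) _ _)).
    have k1 : enorm (x t - Y t) <= r / 3.
      apply: (le_trans (xY t tt')); apply: (close_arith (s := s)) => //.
      - by rewrite mulrCA divff// mulr1.
      - by rewrite mulrCA divff// mulr1.
      - by rewrite mulrCA divff// mulr1.
      - by apply: MsE => //; exact: ltW.
      - exact: e2E.
      - exact: e2E.
    have k2 : enorm (Y t - W t) <= r / 3.
      rewrite -(ler_pXn2r (n := 2)) ?nnegrE ?enorm_ge0//; last by rewrite divr_ge0// ltW.
      apply: (le_trans (YW t tt')); rewrite /aim_bound.
      have -> : expR (2 * L * (b - a)) = Lam ^+ 2.
        by rewrite /Lam expr2 -expRD; congr expR; rewrite /T; ring.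
      apply: (aim_arith L1 T0 s0 sE) => //; first by do 2 apply: mulr_ge0 => //.
      by clear - psib kap0; lra.
    clear - k1 k2; lra.
  exists W => // t /andP[at_ tb].
  have [ts|st] := leP t (tau D (size D).-1).
    by apply: (le_trans (near1 t _) r23); rewrite at_.
  have sz := partition_size_gt0 hg pD.
  have st1 : tau D (size D).-1 < b by exact: lt_le_trans st tb.
  have /andP[as_ _] := tau_in (size D).-1 pD.
  have sT : a <= tau D (size D).-1 <= tau D (size D).-1 by rewrite as_ lexx.
  have k0 := near1 _ sT.
  have dt : t - tau D (size D).-1 <= Dmax g D.
    have := @tau_step_le _ _ _ _ g D (size D).-1; rewrite prednK// tau_last// => /(_ (leqnn _)).
    by clear - tb; lra.
  set s1 := tau D (size D).-1 in st st1 as_ sT k0 dt *.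
  have lx := (solution_good_path hg Gz cu dv sx).2 s1 t ltac:(clear - as_ st1; lra) ltac:(clear - at_ tb; lra).
  have lW := (target_good_path hg Gz tW).1.2 s1 t ltac:(clear - as_ st1; lra) ltac:(clear - at_ tb; lra).
  rewrite ger0_norm in lx; last by clear - st; lra.
  rewrite ger0_norm in lW; last by clear - st; lra.
  have Mt : M * (t - s1) <= M * Dmax g D by rewrite ler_wpM2l.
  have -> : x t - W t = (x t - x s1) + ((x s1 - W s1) - (W t - W s1)).
    by apply/rowP => k; rewrite !mxE; ring.
  apply: (le_trans (ler_enormD _ _)).
  have := ler_enormD (x s1 - W s1) (- (W t - W s1)); rewrite enormN.
  clear - lx lW k0 Mt Mds sr r0; lra.
(* Thinning may triple the diameter of the partition. *)
exists (h / 3) => [|D pD Dh z v x Gz Vv mx]; first by rewrite divr_gt0.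
have [bal|nbal] := pselect (balanced g D).
  by apply: (bal_case D pD bal _ z v x) => //; clear - Dh h0; lra.
have [D' [pD' sub bal' D'3] rc] := (HU D pD).2 nbal.
apply: (bal_case D' pD' bal' _ z v x) => //; first by clear - Dh D'3; lra.
exact: (motion_coarser pD pD' sub rc Gz mx).
Qed.

End Guarantee.

(** * The upper bound for the constructed strategies *)

Section UpperBound.
Variables (R : realType) (n p q : nat) (g : game R n p q).
Hypothesis hg : standing_assumptions g.
Local Notation a := (t0 g).
Local Notation b := (theta g).

(** A limit motion is close to motions that are close to paths of the target
    sets for their initial states [z k]. Such paths cost at most
    [Gamma_q g (z k)], which is upper semicontinuous. *)
Lemma Gamma_c_of_le w z0 (rho : R) : target_selector g w -> G0 g z0 -> 0 < rho ->
  exists2 eps0 : R, 0 < eps0 & forall eps U, 0 < eps < 1 -> eps <= eps0 ->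
  constructed_strategy g w eps U -> (Gamma_c_of g z0 U <= Gamma_q g z0 + rho%:E)%E.
Proof.
move=> hw Gz0 rho0; have [r Er] := Gamma_q_fin hg Gz0.
have rho3 : 0 < rho / 3 by rewrite divr_gt0.
have [d d0 hd] := cost_uniform hg rho3.
have dd : d / 2 < d by lra.
have [eps0 eps00 G] := guarantee hg hw (divr_gt0 d0 (ltr0n R 2)).
exists eps0 => // eps U e01 ee cU; rewrite Er -EFinD.
apply: ge_ereal_sup => _ [x [V [_ Vd cV] [cx [z [v [D [y [H zz DD yx]]]]]]] <-].
rewrite lee_fin.
have [h h0 Gh] := G eps U e01 ee cU V Vd cV.
have [dz dz0 hdz] := Gamma_q_usc hg Gz0 rho3.
have [dx dx0 hdx] := cost_ball hg cx rho3.
have /cvgrPdist_lt DD' := DD; have /cvg_enormP zz' := zz; have /uniform_cvg yx' := yx.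
near \oo => k.
have [Gz Vv pD m] := H k.
have Dh : Dmax g (D k) <= h.
  have : `|0 - Dmax g (D k)| < h by near: k; exact: DD'.
  by rewrite sub0r normrN ger0_norm ?Dmax_ge0//; exact: ltW.
have zk : enorm (z0 - z k) < dz by near: k; exact: zz'.
have xk t : a <= t <= b -> enorm (x t - y k t) < dx.
  suff H1 : forall t, `[a, b]%classic t -> enorm (x t - y k t) < dx.
    by move=> tt; apply: H1; rewrite /= in_itv.
  by near: k; exact: yx'.
have [W tW xW] := Gh (D k) pD Dh _ _ _ Gz Vv m.
have cy : Cts a b (y k) by case: m => u _ [_ sx]; exact: solution_Cts sx.
have [gW _] := target_good_path hg Gz tW.
have [rk Erk] := Gamma_q_fin hg Gz.
have h1 := target_cost hg Gz Erk tW.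
have h2 : rk <= r + rho / 3.
  by have := hdz _ Gz zk; rewrite Er Erk -EFinD lee_fin.
have h3 : `|cost g W - cost g (y k)| < rho / 3.
  apply: hd => // t tt; rewrite -enormN opprB; apply: (le_lt_trans (xW t tt)).
  exact: dd.
have h4 := hdx _ cy xk.
move: h3 h4; rewrite !ltr_norml => /andP[? ?] /andP[? ?].
lra.
Unshelve. all: by end_near. Qed.

Lemma limsup_Gamma_c_le w U z0 : G0 g z0 -> target_selector g w ->
  (forall eps : R, 0 < eps < 1 -> constructed_strategy g w eps (U eps)) ->
  (limf_esup (fun eps => Gamma_c_of g z0 (U eps)) 0^'+ <= Gamma_q g z0)%E.
Proof.
move=> Gz0 hw cU; have [r Er] := Gamma_q_fin hg Gz0.
rewrite Er; apply/lee_addgt0Pr => rho rho0; rewrite -Er.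
have [eps0 eps00 H] := Gamma_c_of_le hw Gz0 rho0.
pose e := Num.min eps0 1; have e0 : 0 < e by rewrite lt_min eps00 /=.
apply: (@le_trans _ _ (ereal_sup ((fun eps => Gamma_c_of g z0 (U eps)) @` [set x | 0 < x < e]))).
  apply: ereal_inf_lbound; exists [set x | 0 < x < e] => //.
  have H1 : \forall x \near (0 : R)^'+, 0 < x < e; last exact: H1.
  near=> x; apply/andP; split; near: x; [exact: nbhs_right_gt|exact: nbhs_right_lt].
apply: ge_ereal_sup => _ [x /andP[x0 xe] <-].
move: xe; rewrite lt_min => /andP[x1 x2].
have x01 : 0 < x < 1 by rewrite x0.
exact: (H _ _ x01 (ltW x1) (cU x x01)).
Unshelve. all: by end_near. Qed.

End UpperBound.

(** * Existence of best approximations *)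

Section Selector.
Variables (R : realType) (n p q : nat) (g : game R n p q).
Hypothesis hg : standing_assumptions g.
Local Notation a := (t0 g).
Local Notation b := (theta g).

Lemma target_closed F z (x : nat -> R -> 'rV[R]_n) : UltraFilter F -> G0 g z ->
  (forall k, target g z (x k)) -> target g z (path_lim F x).
Proof.
move=> FU Gz tx; have PF : ProperFilter F := ultra_proper.
have [gl cl] := path_limP FU (fun k => (target_good_path hg Gz (tx k)).1).
apply/targetP; split=> [|d e d0 e0]; first exact: good_path_Cts gl.
have e2 : 0 < e / 2 by rewrite divr_gt0.
have [k hk] := filter_ex (cl _ e2).
have /targetP[_ h] := tx k; have [al [y [nal Xy xy]]] := h d _ d0 e2.
exists al, y; split=> // t tt; have := hk t tt; have := xy t tt.
by have := ler_distD_enorm (x k t) (path_lim F x t) (y t); lra.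
Qed.

(** Minimizing sequences have limits, by compactness of the target set. *)
Lemma best_approximation z s (y : R -> 'rV[R]_n) : G0 g z -> a <= s <= b ->
  exists W, argmin [set x \_ `[a, s] | x in target g z] (fun x => Cdist a s x y) W.
Proof.
move=> Gz /andP[as_ sb].
set S := [set _ | _ in _]; pose C := [set Cdist a s x y | x in S].
have [W0 tW0] := target_nonempty hg Gz.
have S0 : S (W0 \_ `[a, s]) by exists W0.
have C0 c : C c -> (0 <= c)%E.
  move=> [x _ <-]; apply: (@le_trans _ _ (enorm (x a - y a))%:E).
    by rewrite lee_fin enorm_ge0.
  by apply: ereal_sup_ubound; exists a => //=; rewrite in_itv/= lexx.
have m0 : (0 <= ereal_inf C)%E by apply: le_ereal_inf_tmp => c; exact: C0.
case E : (ereal_inf C) m0 => [r||] // _; last first.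
  exists (W0 \_ `[a, s]); split=> // x Sx.
  apply: (@le_trans _ _ +oo%E); first exact: leey.
  by rewrite -E; apply: ereal_inf_lbound; exists x.
have fC : ereal_inf C \is a fin_num by rewrite E.
have ex k : exists x, target g z x /\
    forall t, a <= t <= s -> enorm (x t - y t) <= r + k.+1%:R^-1.
  have k0 : 0 < k.+1%:R^-1 :> R by rewrite invr_gt0.
  have [_ [_ [x tx <-] <-] /ltW h] := lb_ereal_inf_adherent k0 fC.
  exists x; split=> // t tt; move: h; rewrite E -EFinD => /Cdist_le /(_ t tt).
  by rewrite restrict_in.
have [x hx] := choice ex.
have [F [FU Foo]] := exists_ultra; have PF : ProperFilter F := ultra_proper.
have tl := target_closed FU Gz (fun k => (hx k).1).
have [_ cl] := path_limP FU (fun k => (target_good_path hg Gz (hx k).1).1).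
exists (path_lim F x \_ `[a, s]); split; first by exists (path_lim F x).
move=> x' Sx'; apply: (@le_trans _ _ r%:E); last first.
  by rewrite -E; apply: ereal_inf_lbound; exists x'.
apply/Cdist_le => t tt; rewrite restrict_in//; apply/ler_addgt0Pr => e e0.
have e2 : 0 < e / 2 by rewrite divr_gt0.
near F => k.
have h1 : forall t, a <= t <= b -> enorm (path_lim F x t - x k t) < e / 2.
  by near: k; exact: cl.
have h2 : k.+1%:R^-1 < e / 2 :> R.
  by near: k; apply: Foo; exact: (near_infty_natSinv_lt (PosNum e2)).
have tb : a <= t <= b by have /andP[-> ts] := tt; exact: le_trans sb.
have := h1 t tb; have := (hx k).2 t tt; move: (k.+1%:R^-1) h2 => d h2.
by have := ler_distD_enorm (x k t) (path_lim F x t) (y t); lra.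
Unshelve. all: by end_near. Qed.

Lemma selector_exists : exists w, target_selector g w.
Proof.
exists (fun s h => xget (cst 0) (argmin [set x \_ `[a, s] | x in target g (h a)]
  (fun x => Cdist a s x h))) => s y; rewrite /= in_itv/= => sT cy Gy.
have aT : a <= a <= s by case/andP: sT => -> _; rewrite lexx.
have -> : (y \_ `[a, s]) a = y a by rewrite restrict_in.
have -> : (fun x => Cdist a s x (y \_ `[a, s])) = fun x => Cdist a s x y.
  apply/funext => x; rewrite /Cdist; congr ereal_sup; apply: eq_imagel => t /=.
  by rewrite in_itv/= => tt; rewrite restrict_in.
have [W hW] := best_approximation y Gy sT.
exact: (xgetI (cst 0) hW).
Qed.

End Selector.

(** * Existence of the constructed strategies *)

(** Greedy thinning: a point is kept as soon as it is at least [h] away from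
    the last kept one [c]; [x] is the last point seen. *)
Lemma greedy_thinning (R : realType) (h d c x : R) (s : seq R) :
  0 < h -> c <= x -> x - c < h -> s != [::] ->
  path (fun u v => (u < v) && (v - u <= h)) x s ->
  exists s', [/\ subseq s' s, last c s' = last x s,
    path (fun u v => (u < v) && (v - u <= 2 * h)) c s' &
    forall i, (i.+1 < size s')%N -> h <= nth d (c :: s') i.+1 - nth d (c :: s') i].
Proof.
move=> h0; elim: s c x => // y [|z s] IH c x cx xc _ /=.
  move=> /andP[/andP[xy yx] _]; exists [:: y]; split=> //=; rewrite ?eqxx//.
  by rewrite andbT; lra.
move=> /andP[/andP[xy yx] ps].
have [hy|yh] := leP h (y - c).
  have [s' [ss l ps' H]] := IH y y (lexx y) ltac:(by rewrite subrr) isT ps.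
  exists (y :: s'); split=> //; first by rewrite /= eqxx.
    by rewrite /= ps' andbT; lra.
  by case=> [|i] //= iS; exact: H.
have [s' [ss l ps' H]] := IH c y ltac:(lra) yh isT ps.
by exists s'; split=> //; exact: subseq_trans ss (subseq_cons _ _).
Qed.

Section Thinning.
Variables (R : realType) (n p q : nat) (g : game R n p q).
Hypothesis hg : standing_assumptions g.
Local Notation tau := (tau g).

(** The intervals kept are at most [2 * Dmax g D] long, and at least [Dmax g D]
    with the exception of the last one, which [dmin] ignores. *)
Lemma thinning_exists D : Defs.partition g D -> exists D', thinning g D D'.
Proof.
move=> pD; have tt := t0_lt_theta hg; have s0 := partition_size_gt0 hg pD.
have [pl /eqP lD] := pD.
have h0 : 0 < Dmax g D.
  by have := tau_step_le g s0; have := tau_S pD s0; lra.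
have [||s' [ss l ps' H]] := @greedy_thinning _ (Dmax g D) (theta g) (t0 g) (t0 g) D h0 (lexx _) ltac:(by rewrite subrr).
- by rewrite -size_eq0 -lt0n.
- apply/(pathP (theta g)) => i iD.
  by rewrite (tau_S pD iD : nth _ _ _ < nth _ _ _)/= (tau_step_le g iD).
have pD' : Defs.partition g s'.
  split; last by rewrite l lD.
  by apply: sub_path ps' => u v /andP[].
have st i : (i < size s')%N -> tau s' i.+1 - tau s' i <= 2 * Dmax g D.
  by move=> iD; have /(pathP (theta g))/(_ i iD)/andP[] := ps'.
have D2 : Dmax g s' <= 2 * Dmax g D by apply: Dmax_le => //; lra.
exists s'; split=> //; last by lra.
rewrite /balanced; have s0' := partition_size_gt0 hg pD'.
rewrite ler_pdivrMr; last exact: (dmin_gt0 hg pD').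
have [s1|s1] := leqP (size s') 1.
  have E : size s' = 1%N by apply/eqP; rewrite eqn_leq s1.
  have -> : dmin g s' = theta g - t0 g by rewrite /dmin E big_geq.
  apply: (@le_trans _ _ (theta g - t0 g)); last by lra.
  apply: Dmax_le => [|i _]; first by lra.
  by have /andP[? ?] := tau_in i pD'; have /andP[? ?] := tau_in i.+1 pD'; lra.
suff : Dmax g D <= dmin g s' by lra.
rewrite /dmin big_seq_cond; apply: le_bigmin => [|i].
  apply: Dmax_le => [|i _]; first by lra.
  by have /andP[? ?] := tau_in i pD; have /andP[? ?] := tau_in i.+1 pD; lra.
rewrite mem_index_iota andbT => /andP[i0 iD].
by rewrite -(prednK i0) /=; apply: H; rewrite prednK.
Qed.

End Thinning.

Lemma xget_sub (T : choiceType) (x0 : T) (A B : set T) :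
  A `<=` B -> B x0 -> B (xget x0 A).
Proof. by move=> AB Bx0; case: xgetP => // x -> /AB. Qed.

Section Construction.
Variables (R : realType) (n p q : nat) (g : game R n p q).
Hypothesis hg : standing_assumptions g.
Local Notation f := (dyn g).
Local Notation a := (t0 g).
Local Notation b := (theta g).
Local Notation tau := (tau g).
Variables (w : R -> (R -> 'rV[R]_n) -> (R -> 'rV[R]_n)) (eps : R) (net : seq 'rV[R]_p)
  (us : 'rV[R]_p) (vs : 'rV[R]_q).
Hypotheses (eps01 : 0 < eps < 1) (isnet : is_net g eps net) (Pus : Pset g us) (Qvs : Qset g vs).
Local Notation probe := (probe g eps net).
Local Notation mismatch := (mismatch g eps net).
Implicit Types (D : seq R) (h x : R -> 'rV[R]_n).

Lemma net_gt0 : (0 < size net)%N.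
Proof. by have [j + _] := isnet.2 us Pus; exact: leq_ltn_trans. Qed.

Lemma mismatch_local D i h h' : Defs.partition g D -> (i.+1 < size D)%N ->
  (forall t, a <= t <= tau D i.+1 -> h t = h' t) -> mismatch D i.+1 h = mismatch D i.+1 h'.
Proof.
move=> pD iD hh; apply/funext => v; rewrite /Defs.mismatch; apply: eq_big_nat => j /andP[_ jn].
have N0 := net_gt0; have /andP[e0 _] := eps01.
have pT k : (k <= size net)%N -> a <= probe D i.+1 k <= tau D i.+1.
  move=> kn; have kl : probe D i.+1 k <= tau D i.+1.
    by rewrite -(probe_last g eps D i.+1 N0); exact: (probe_mono hg _ _ (ltW e0) pD kn).
  rewrite kl andbT.
  have /andP[ai _] := tau_in i pD; apply: (le_trans ai).
  apply: (le_trans (probe_start_ge hg net eps01 pD iD)).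
  exact: (probe_mono hg _ _ (ltW e0) pD).
have /andP[ai _] := tau_in i.+1 pD.
by rewrite /slope !hh ?ai ?lexx//; apply: pT => //; exact: ltnW.
Qed.

Lemma mismatch_argmin D i x : Defs.partition g D ->
  exists v, argmin (Qset g) (mismatch D i x) v.
Proof.
move=> pD; have iT := tau_in i pD.
apply: argmin_exists; [exact: Q_compact hg|exact: Q_nonempty hg|move=> v e Qv e0].
set F := f (tau D i) (x (tau D i)).
have [d d0 hd] : exists2 d : R, 0 < d & forall v', Qset g v' -> enorm (v - v') < d ->
    forall j, (j < size net)%N -> enorm (F (nth 0 net j) v - F (nth 0 net j) v') <= e.
  have : (size net <= size net)%N by [].
  elim: {1 3}(size net) => [_|m IH mn]; first by exists 1.
  have [d1 d10 h1] := IH (ltnW mn).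
  have [d2 d20 h2] := dyn_eps hg (x (tau D i)) iT (isnet.1 m mn) Qv e0.
  exists (Num.min d1 d2) => [|v' Qv' vv j]; first by rewrite lt_min d10.
  move: vv; rewrite lt_min => /andP[vv1 vv2].
  rewrite ltnS leq_eqVlt => /orP[/eqP ->|jm]; last exact: h1.
  by apply: h2 => //; [exact: isnet.1|rewrite subrr enorm0].
exists d => // v' Qv' vv.
have key v1 v2 : (forall j, (j < size net)%N ->
    enorm (F (nth 0 net j) v1 - F (nth 0 net j) v2) <= e) ->
    mismatch D i x v1 <= mismatch D i x v2 + e.
  move=> h; rewrite {1}/Defs.mismatch big_seq_cond; apply: bigmax_le => [|j].
    by apply: addr_ge0; [exact: bigmax_ge_id|exact: ltW].
  rewrite mem_index_iota andbT => jn.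
  have := ler_distD_enorm (F (nth 0 net j) v2) (slope g eps net D i j x) (F (nth 0 net j) v1).
  move=> /le_trans; apply; apply: lerD; last by rewrite -enormN opprB; exact: h.
  apply: (@le_bigmax_seq _ _ _ _ 0 j xpredT
    (fun j => enorm (slope g eps net D i j x - F (nth 0 net j) v2))) => //.
  by rewrite mem_index_iota.
have k1 := key v v' (hd v' Qv' vv).
have k2 := key v' v (fun j jn => ltac:(by rewrite -enormN opprB; exact: hd)).
rewrite ler_norml; lra.
Qed.

(** The state of the construction at [tau_i] for a history [h]: the model
    motion, the control and the estimate of the disturbance. *)
Fixpoint model D h i : (R -> 'rV[R]_n) * 'rV[R]_p * 'rV[R]_q :=
  if i is k.+1 then
    let s := model D h k in
    let y := fun t => if t <= tau D k then s.1.1 t else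
      xget (cst 0) (solution g (tau D k) (tau D i) (s.1.1 (tau D k)) (cst s.1.2) (cst s.2)) t in
    let v := xget vs (argmin (Qset g) (mismatch D i h)) in
    let u := xget us (argmin (Pset g) (fun u =>
      inner (y (tau D i) - w (tau D i) (y \_ `[a, tau D i]) (tau D i))
            (f (tau D i) (y (tau D i)) u v))) in
    (y, u, v)
  else (cst (h a), us, vs).

Lemma model_PQ D h i : Pset g (model D h i).1.2 /\ Qset g (model D h i).2.
Proof. by case: i => [|i] //=; split; apply: xget_sub => // ? []. Qed.

(** The construction does not look ahead, so that restricting the history to
    [[t0, tau_i]] does not change it. *)
Lemma model_local D h h' i : Defs.partition g D -> (i < size D)%N ->
  (forall t, a <= t <= tau D i -> h t = h' t) -> model D h i = model D h' i.
Proof.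
move=> pD; elim: i => [_ hh|i IH iD hh] /=.
  by rewrite hh// tau0 lexx.
rewrite -(IH (ltnW iD)) => [|t /andP[at_ ti]].
  by rewrite (mismatch_local pD iD hh).
by apply: hh; rewrite at_ (le_trans ti)//; exact/ltW/tau_S/ltnW.
Qed.

Lemma model_solution D h i : Defs.partition g D -> (i < size D)%N ->
  reach hg (tau D i) ((model D h i).1.1 (tau D i)) ->
  solution g (tau D i) (tau D i.+1) ((model D h i).1.1 (tau D i))
    (cst (model D h i).1.2) (cst (model D h i).2) (model D h i.+1).1.1.
Proof.
move=> pD iD ri /=; have [PU QV] := model_PQ D h i.
move: (model D h i) ri PU QV => s ri PU QV.
have /andP[ai _] := tau_in i pD; have /andP[_ ib] := tau_in i.+1 pD.
have ii := ltW (tau_S pD iD).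
have ad := admissible_sub ai ib (controls_admissible (controls_cst PU) (disturbances_cst QV)).
have [x0 sx0] := solution_exists ai ib ad ri.
have sx := xgetI (cst 0) sx0; set x := xget _ _ in sx *.
apply: (solution_ext sx) => t /andP[it _]; split=> //.
case: (ltrgtP t (tau D i)) it => // -> _; exact: (solution_init ii sx).
Qed.

Lemma model_reach D h i : Defs.partition g D -> (i < size D)%N -> G0 g (h a) ->
  reach hg (tau D i) ((model D h i).1.1 (tau D i)).
Proof.
move=> pD + Gh; elim: i => [_|i IH iD]; first by rewrite tau0; exact: reach_init.
have ri := IH (ltnW iD); have sx := model_solution pD (ltnW iD) ri.
have [PU QV] := model_PQ D h i.
have /andP[ai _] := tau_in i pD; have /andP[_ ib] := tau_in i.+1 pD.
have ii := ltW (tau_S pD (ltnW iD)).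
have ad := admissible_sub ai ib (controls_admissible (controls_cst PU) (disturbances_cst QV)).
by apply: (solution_reach ai ib ad sx ri); rewrite lexx ii.
Qed.

Fixpoint probing D i j m (t : R) : 'rV[R]_p :=
  if m is m'.+1 then if t < probe D i j.+1 then nth 0 net j else probing D i j.+1 m' t
  else us.

Lemma probing_controls D i j m : (j + m <= size net)%N -> controls g (probing D i j m).
Proof.
elim: m j => [|m IH] j; first by move=> _; exact: (controls_cst Pus).
rewrite addnS -addSn => jm; apply: controls_switch; last exact: IH.
by apply: controls_cst; apply: isnet.1; exact: leq_trans (leq_addr _ _) jm.
Qed.

Lemma probingE D i j m k t : Defs.partition g D -> (j <= k < j + m)%N ->
  probe D i k <= t < probe D i k.+1 -> probing D i j m t = nth 0 net k.
Proof.
move=> pD; elim: m j => [|m IH] j; first by rewrite addn0 => /andP[jk]; rewrite ltnNge jk.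
move=> /andP[jk km] /andP[kt tk] /=.
move: jk km; rewrite leq_eqVlt => /orP[/eqP -> _|jk km]; first by rewrite tk.
rewrite ltNge (le_trans _ kt)/=; last first.
  by have /andP[e0 _] := eps01; exact: (probe_mono hg _ _ (ltW e0) pD).
by apply: IH; rewrite ?kt// jk addSn -addnS.
Qed.

Definition aim_feedback D : feedback R n p := fun i h t =>
  if (i.+1 < size D)%N then
    if t < probe D i.+1 0 then (model D h i).1.2 else probing D i.+1 0 (size net) t
  else (model D h i).1.2.

Lemma aim_feedback_controls D i h : controls g (aim_feedback D i h).
Proof.
have [PU _] := model_PQ D h i; have cU := controls_cst PU.
rewrite /aim_feedback; case: (i.+1 < size D)%N => //.
by apply: controls_switch => //; exact: probing_controls.
Qed.

Lemma aim_feedback_constructed D : Defs.partition g D ->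
  constructed_feedback g w eps net us vs D (aim_feedback D).
Proof.
move=> pD; have /andP[e0 _] := eps01.
exists (fun i h => (model D h i).2), (fun i h => (model D h i).1.2),
  (fun i h => (model D h i).1.1); split=> [i x iD cx Gx h|i x iD cx Gx h].
  have at0 : a <= a <= tau D i by have /andP[-> _] := tau_in i pD; rewrite lexx.
  have Gh : G0 g (h a) by rewrite /h restrict_in.
  case: i iD cx @h at0 Gh => [|i] iD cx h at0 Gh.
    by split=> //=; rewrite /h restrict_in.
  move=> h'; have iD' := ltnW iD; have ii := ltW (tau_S pD iD').
  have hh t : a <= t <= tau D i -> h' t = h t.
    move=> /andP[at_ ti]; rewrite /h /h' !restrict_in ?at_ ?ti//.
    by rewrite (le_trans ti).
  have E : model D h i = model D h' i by apply/esym/model_local.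
  split.
  - by move=> t; rewrite in_itv/= => /andP[_ ti]; rewrite ti E.
  - rewrite -E; exact: (model_solution pD iD' (model_reach pD iD' Gh)).
  - have hx : mismatch D i.+1 h = mismatch D i.+1 x.
      by apply: (mismatch_local pD iD) => t tt; rewrite /h restrict_in.
    have [v hv] := mismatch_argmin i.+1 x pD.
    rewrite -hx in hv; rewrite -hx; exact: (xgetI vs hv).
  - set y := (model D h i.+1).1.1; set v := (model D h i.+1).2.
    have Qv : Qset g v by exact: (model_PQ D h i.+1).2.
    have [u hu] := inner_dyn_argmin hg (y (tau D i.+1))
      (y (tau D i.+1) - w (tau D i.+1) (y \_ `[a, tau D i.+1]) (tau D i.+1)) (tau_in i.+1 pD) Qv.
    exact: (xgetI us hu).
rewrite /aim_feedback; case: (i.+1 < size D)%N => //.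
split=> [t|j jn t]; rewrite in_itv/=; first by case/andP=> _ ->.
move=> tj; have /andP[jt _] := tj.
rewrite ltNge (le_trans _ jt)/=; last exact: (probe_mono hg _ _ (ltW e0) pD).
by apply: probingE.
Qed.

End Construction.

(** * Equality of the values *)

Section Equality.
Variables (R : realType) (n p q : nat) (g : game R n p q).
Hypothesis hg : standing_assumptions g.
Local Notation a := (t0 g).
Local Notation b := (theta g).
Local Notation tau := (tau g).

Lemma net_exists (eps : R) : 0 < eps -> exists net, is_net g eps net.
Proof.
move=> e0; have [s [sP sn]] := finite_net (P_compact hg) e0.
exists s; split=> [j js|u Pu]; first by apply: sP; exact: mem_nth.
have [_ /(nthP 0) [j js <-] uv] := sn u Pu.
by exists j => //; exact: ltW.
Qed.

Lemma tau_index_unique D D' i k k' : Defs.partition g D' ->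
  tau D' k <= tau D i < tau D' k.+1 -> tau D' k' <= tau D i < tau D' k'.+1 -> k = k'.
Proof.
move=> pD'.
have H l l' : tau D' l <= tau D i < tau D' l.+1 -> tau D' l' <= tau D i < tau D' l'.+1 ->
    ~~ (l < l')%N.
  move=> /andP[_ h1] /andP[h2 _]; apply/negP => /(tau_le pD') h3.
  by have := lt_le_trans h1 (le_trans h3 h2); rewrite ltxx.
move=> h h'; apply/eqP; rewrite eqn_leq; apply/andP; split; rewrite leqNgt.
  exact: (H _ _ h' h).
exact: (H _ _ h h').
Qed.

Lemma constructed_strategy_exists w (eps : R) : 0 < eps < 1 ->
  exists U, constructed_strategy g w eps U.
Proof.
move=> e01; have /andP[e0 _] := e01.
have [net isnet] := net_exists e0.
have [us Pus] := P_nonempty hg; have [vs Qvs] := Q_nonempty hg.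
pose F := aim_feedback g w eps net us vs.
have [th Hth] : exists th : seq R -> seq R, forall D, Defs.partition g D -> thinning g D (th D).
  have ex D : exists D', Defs.partition g D -> thinning g D D'.
    have [pD|npD] := pselect (Defs.partition g D); last by exists D.
    by have [D' tD'] := thinning_exists hg pD; exists D'.
  by have [th Hth] := choice ex; exists th.
(* The interval of the thinned partition that contains [tau D i]. *)
pose loc D i := xget 0%N [set k | tau (th D) k <= tau D i < tau (th D) k.+1].
pose U D : feedback R n p := if pselect (balanced g D) then F D else
  fun i h => F (th D) (loc D i) (h \_ `[a, tau (th D) (loc D i)]).
have cF D i h : controls g (F D i h) by exact: aim_feedback_controls.
have UF D : balanced g D -> U D = F D by rewrite /U; case: pselect.
exists U; split.
  move=> D pD i iD x cx; exists (U D i (x \_ `[a, tau D i])) => //.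
  by rewrite /U; case: pselect => ?; exact: cF.
exists net, us, vs; split=> // D pD; split=> [bal|nbal].
  by rewrite UF//; exact: aim_feedback_constructed.
have [pD' sub bal' D'3] := Hth D pD.
exists (th D) => // i k iD kD ik x cx Gx t tin.
rewrite (UF _ bal') /U; case: pselect => // ? /=.
have -> : loc D i = k.
  apply: (@tau_index_unique D (th D) i _ _ pD') => //.
  exact: (xgetI (P := [set k | tau (th D) k <= tau D i < tau (th D) k.+1]) 0%N ik).
congr (F (th D) k _ t); apply: restrict_eq => r; rewrite /= in_itv/= => /andP[ar rk].
rewrite restrict_in// ar (le_trans rk)//; by case/andP: ik.
Qed.

Lemma Gamma_c_le_Gamma_q z0 : G0 g z0 -> (Gamma_c g z0 <= Gamma_q g z0)%E.
Proof.
move=> Gz0; have [r Er] := Gamma_q_fin hg Gz0.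
rewrite Er; apply/lee_addgt0Pr => rho rho0; rewrite -Er.
have [w hw] := selector_exists hg.
have [eps0 eps00 H] := Gamma_c_of_le hg hw Gz0 rho0.
pose e := Num.min eps0 2^-1.
have e01 : 0 < e < 1.
  by rewrite lt_min eps00 invr_gt0 ltr0n /= gt_min invf_lt1 ?ltr1n ?orbT.
have [U cU] := constructed_strategy_exists w e01.
apply: le_trans (H e U e01 _ cU); last by rewrite ge_min lexx.
by apply: ereal_inf_lbound; exists U => //; case: cU.
Qed.

(** A single disturbance forms a compact set. *)
Lemma Gamma_p_le_Gamma_c z0 : (Gamma_p g z0 <= Gamma_c g z0)%E.
Proof.
apply: le_ereal_inf_tmp => _ [U sU <-].
apply: (@le_trans _ _ (Gamma_p_of g z0 U)); first by apply: ereal_inf_lbound; exists U.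
apply: ge_ereal_sup => _ [x [v dv xX] <-]; apply: ereal_sup_ubound; exists x => //.
by exists [set v] => //; split; [exists v|move=> _ ->|exact: compact_set1].
Qed.

End Equality.

Theorem theorem2 (R : realType) (n p q : nat) (g : game R n p q)
    (hg : standing_assumptions g) (z0 : 'rV[R]_n) (hz0 : G0 g z0) :
  (forall (w : R -> (R -> 'rV[R]_n) -> (R -> 'rV[R]_n))
          (U : R -> strategy R n p),
     target_selector g w ->
     (forall eps : R, 0 < eps < 1 -> constructed_strategy g w eps (U eps)) ->
     (limf_esup (fun eps => Gamma_c_of g z0 (U eps)) 0^'+ <= Gamma_q g z0)%E) /\
  Gamma_p g z0 = Gamma_c g z0 /\ Gamma_c g z0 = Gamma_q g z0.
Proof.
have pc := Gamma_p_le_Gamma_c g z0.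
have cq := Gamma_c_le_Gamma_q hg hz0.
have qp := Gamma_q_le_Gamma_p hg hz0.
split; first by move=> w U hw cU; exact: limsup_Gamma_c_le cU.
by split; apply/eqP; rewrite eq_le ?pc ?cq/=; [exact: le_trans qp|exact: le_trans pc].
Qed.
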